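(* Let $n\ge 3$ be an integer and let $f:[0,1]\to\mathbb{R}$ be a non-negative, differentiable, non-decreasing function. Then the map $u_0(x)=\frac{x}{\|x\|}$ minimizes the energy $E_{1,f}(u)=\int_{\mathbf{B}^n} f(\|x\|)\,\|\nabla u\|\,dx$: for every $u\in W^{1,1}(\mathbf{B}^n,\mathbb{S}^{n-1})$ with $u(x)=x$ on $\mathbb{S}^{n-1}$, one has $$\int_{\mathbf{B}^n} f(r)\,\|\nabla u_0\|\,dx\le \int_{\mathbf{B}^n} f(r)\,\|\nabla u\|\,dx ,\qquad r=\|x\|.$$ Moreover, if $f$ has no critical points in $(0,1)$ (i.e. $f'(r)\neq 0$ for all $r\in(0,1)$), then $u_0$ is the unique minimizer of $E_{1,f}$ in this class, that is, equality holds in the last inequality if and only if $u=u_0$.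
   Context: $\mathbf{B}^n$ is the Euclidean unit ball of $\mathbb{R}^n$, $\mathbb{S}^{n-1}$ its boundary sphere, $\|\cdot\|$ the Euclidean norm, $r=\|x\|$. For $p\ge1$, $W^{1,p}(\mathbf{B}^n,\mathbb{S}^{n-1})=\{u\in W^{1,p}(\mathbf{B}^n,\mathbb{R}^n): \|u\|=1 \text{ a.e.}\}$. The condition $u(x)=x$ on $\mathbb{S}^{n-1}$ is understood in the sense of traces, and equality of maps is almost everywhere. $\|\nabla u\|=\big(\sum_{i,j}|\partial u_i/\partial x_j|^2\big)^{1/2}$. *)

(* Defs.v *)
From HB Require Import structures.
From mathcomp Require Import all_boot all_order all_algebra.
From mathcomp Require Import all_classical all_reals all_analysis.
From mathcomp Require Import measurable_realfun.
Set Implicit Arguments.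
Unset Strict Implicit.
Unset Printing Implicit Defensive.
Import Order.TTheory GRing.Theory Num.Theory.
Import numFieldNormedType.Exports.
Local Open Scope classical_set_scope.
Local Open Scope ring_scope.

(* R^n is 'rV[R]_n, with the product sigma-algebra, that is the one generated
   by the coordinate functions. *)
Definition rV_display : measure_display -> measure_display.
Proof. exact. Qed.

Section measurable_rV.
Context {d} {T : measurableType d}.
Variable n : nat.

Let coor : 'I_n -> 'rV[T]_n -> T := fun i x => x ord0 i.

Let rV_set0 : g_sigma_preimage coor set0.
Proof. exact: sigma_algebra0. Qed.

Let rV_setC A : g_sigma_preimage coor A -> g_sigma_preimage coor (~` A).
Proof. exact: sigma_algebraC. Qed.

Let rV_bigcup (F : _^nat) : (forall i, g_sigma_preimage coor (F i)) ->
  g_sigma_preimage coor (\bigcup_i (F i)).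
Proof. exact: sigma_algebra_bigcup. Qed.

HB.instance Definition _ := @isMeasurable.Build (rV_display d)
  'rV[T]_n (g_sigma_preimage coor) rV_set0 rV_setC rV_bigcup.

Lemma measurable_coor (i : 'I_n) :
  measurable_fun [set: 'rV[T]_n] (fun x : 'rV[T]_n => x ord0 i).
Proof.
move=> _ Y mY; rewrite setTI; apply: sub_sigma_algebra => /=.
rewrite -bigcup_seq/=; exists i => /=; first by rewrite mem_index_enum.
by exists Y => //; rewrite setTI.
Qed.

End measurable_rV.

Lemma measurable_fun_rVP d d' (T : measurableType d) (T' : measurableType d')
    n (f : T -> 'rV[T']_n) :
  (forall i, measurable_fun setT (fun x => f x ord0 i)) ->
  measurable_fun setT f.
Proof.
move=> mf.
suff H : g_sigma_preimage (fun (i : 'I_n) => (fun x : 'rV[T']_n => x ord0 i) \o f)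
    `<=` measurable.
  rewrite g_sigma_preimage_comp in H.
  by move=> _ A mA; apply: H; exists A.
apply: smallest_sub; first exact: sigma_algebra_measurable.
case: n => [|n] in f mf *; first by rewrite big_ord0.
rewrite -bigcup_mkord_ord; apply: bigcup_sub => i Ii.
by move=> A [B mB <-]; exact: mf.
Qed.

Section lebesgue_rV.
Context {R : realType}.

Definition rV_cons n (p : R * 'rV[R]_n) : 'rV[R]_n.+1 :=
  row_mx (p.1%:M : 'M[R]_1) p.2.

Lemma rV_cons0 n (p : R * 'rV[R]_n) : rV_cons p ord0 ord0 = p.1.
Proof.
by rewrite mxE; case: splitP => // j; rewrite ord1 mxE.
Qed.

Lemma rV_consS n (p : R * 'rV[R]_n) (i : 'I_n) :
  rV_cons p ord0 (lift ord0 i) = p.2 ord0 i.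
Proof.
rewrite mxE; case: splitP => [[[]] //|k /= [ik]].
by congr (_ _ _); exact/esym/val_inj.
Qed.

Lemma measurable_rV_cons n : measurable_fun setT (@rV_cons n).
Proof.
apply: measurable_fun_rVP => i; case: (unliftP ord0 i) => [j|] ->.
  under eq_fun do rewrite rV_consS.
  by apply: (measurableT_comp (f:=fun x : 'rV[R]_n => x ord0 j) (measurable_coor j)).
by under eq_fun do rewrite rV_cons0; exact: measurable_fst.
Qed.

Section step.
Variables (n : nat) (m : {sigma_finite_measure set 'rV[R]_n -> \bar R}).

Definition lebesgue_step : set 'rV[R]_n.+1 -> \bar R :=
  pushforward (lebesgue_measure \x m)%E (@rV_cons n).

Let mcons (A : set 'rV[R]_n.+1) :
  measurable A -> measurable (@rV_cons n @^-1` A).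
Proof. by move=> mA; rewrite -[X in measurable X]setTI; exact: measurable_rV_cons. Qed.

Let lebesgue_step0 : lebesgue_step set0 = 0%E.
Proof. by rewrite /lebesgue_step /pushforward preimage_set0 measure0. Qed.

Let lebesgue_step_ge0 A : (0 <= lebesgue_step A)%E.
Proof. by rewrite /lebesgue_step /pushforward measure_ge0. Qed.

Let lebesgue_step_sigma_additive : semi_sigma_additive lebesgue_step.
Proof.
move=> F mF tF mUF; rewrite /lebesgue_step /pushforward preimage_bigcup.
apply: measure_semi_sigma_additive.
- by move=> k; exact: mcons.
- apply/trivIsetP => /= i j _ _ ij; rewrite -preimage_setI.
  by move/trivIsetP : tF => /(_ _ _ _ _ ij) ->//; rewrite preimage_set0.
- by rewrite -preimage_bigcup; exact: mcons.
Qed.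

HB.instance Definition _ := isMeasure.Build _ _ _ lebesgue_step
  lebesgue_step0 lebesgue_step_ge0 lebesgue_step_sigma_additive.

Let lebesgue_step_sigma_finite : sigma_finite setT lebesgue_step.
Proof.
have /sigma_finiteP[F [TF ndF Foo]] := sigma_finiteT (@lebesgue_measure R).
have /sigma_finiteP[G [TG ndG Goo]] := sigma_finiteT m.
pose tail (v : 'rV[R]_n.+1) : 'rV[R]_n := \row_i v ord0 (lift ord0 i).
pose FG k := [set v : 'rV[R]_n.+1 | F k (v ord0 ord0)] `&` tail @^-1` G k.
have mtail : measurable_fun setT tail.
  apply: measurable_fun_rVP => i.
  by under eq_fun do rewrite mxE; exact: measurable_coor.
have FGE k : @rV_cons n @^-1` FG k = F k `*` G k.
  rewrite /FG preimage_setI; congr setI; apply/seteqP; split => -[t v] /=;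
    rewrite ?rV_cons0 // (_ : tail _ = v) //;
    by apply/rowP => i; rewrite mxE rV_consS.
exists FG.
  apply/esym/seteqP; split => // v _.
  have [i _ Fi] : (\bigcup_i F i) (v ord0 ord0) by rewrite -TF.
  have [j _ Gj] : (\bigcup_i G i) (tail v) by rewrite -TG.
  exists (maxn i j) => //; split => /=.
  - by move: Fi; exact/subsetPset/ndF/leq_maxl.
  - by move: Gj; exact/subsetPset/ndG/leq_maxr.
move=> k; have [mF Fk] := Foo k; have [mG Gk] := Goo k; split.
  apply: measurableI; last first.
    by rewrite -[X in measurable X]setTI; exact: mtail.
  by rewrite -[X in measurable X]setTI; exact: measurable_coor.
rewrite /= /lebesgue_step /pushforward FGE product_measure1E//.
by rewrite lte_mul_pinfty// ge0_fin_numE.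
Qed.

HB.instance Definition _ :=
  Measure_isSigmaFinite.Build _ _ _ lebesgue_step lebesgue_step_sigma_finite.
End step.

(* The n-fold product of the Lebesgue measure of R, transported to 'rV[R]_n. *)
Fixpoint lebesgue_rV n : {sigma_finite_measure set 'rV[R]_n -> \bar R} :=
  if n is n'.+1 then lebesgue_step (lebesgue_rV n') else \d_(0 : 'rV[R]_0).

End lebesgue_rV.

Section euclidean.
Context {R : realType}.

Section norms.
Variable n : nat.
Implicit Types x : 'rV[R]_n.

(* `|x| is the maximum norm on 'rV[R]_n, so the Euclidean one is defined. *)
Definition enorm x : R := Num.sqrt (\sum_i x ord0 i ^+ 2).

Definition uball : set 'rV[R]_n := [set x | enorm x < 1].
Definition usphere : set 'rV[R]_n := [set x | enorm x = 1].

Definition radial x : 'rV[R]_n := (enorm x)^-1 *: x.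

Definition frobenius (A : 'M[R]_n) : R :=
  Num.sqrt (\sum_i \sum_j A i j ^+ 2).

Lemma measurable_enorm : measurable_fun setT enorm.
Proof.
apply: (measurableT_comp (f := @Num.sqrt R)).
  by apply: continuous_measurable_fun; exact: sqrt_continuous.
apply: measurable_sum => i.
by apply: measurable_funX; exact: measurable_coor.
Qed.

Lemma measurable_uball : measurable uball.
Proof.
rewrite (_ : uball = setT `&` enorm @^-1` `]-oo, 1[%classic).
  exact: measurable_enorm.
by apply/seteqP; split => x /=; rewrite in_itv //= => -[].
Qed.

Lemma measurable_radial : measurable_fun setT radial.
Proof.
apply: measurable_fun_rVP => i.
rewrite (_ : (fun x => _) = (fun x => enorm x `^ (-1) * x ord0 i)); last first.
  by apply/funext => x; rewrite mxE powR_inv1 ?sqrtr_ge0.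
apply: measurable_funM; last exact: measurable_coor.
by apply: (measurableT_comp (measurable_powR _)); exact: measurable_enorm.
Qed.

(* Surface measure of the unit sphere by the cone formula
   sigma(A) = n * |{x in B^n | x / ||x|| in A}|; the origin, which radial maps
   to 0, is negligible. *)
Definition sphere_measure : set 'rV[R]_n -> \bar R := fun A =>
  (n%:R%:E * lebesgue_rV n (radial @^-1` A `&` uball))%E.

Let mradial (A : set 'rV[R]_n) : measurable A -> measurable (radial @^-1` A).
Proof. by move=> mA; rewrite -[X in measurable X]setTI; exact: measurable_radial. Qed.

Let sphere_measure0 : sphere_measure set0 = 0%E.
Proof. by rewrite /sphere_measure preimage_set0 set0I measure0 mule0. Qed.

Let sphere_measure_ge0 A : (0 <= sphere_measure A)%E.
Proof. by rewrite /sphere_measure mule_ge0// lee_fin. Qed.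

Let sphere_measure_sigma_additive : semi_sigma_additive sphere_measure.
Proof.
move=> F mF tF mUF; rewrite /sphere_measure preimage_bigcup setI_bigcupl.
under eq_fun do rewrite -ge0_sume_distrr //.
apply: cvgeZl => //; apply: measure_semi_sigma_additive.
- by move=> k; apply: measurableI; [exact: mradial|exact: measurable_uball].
- apply/trivIsetP => /= i j _ _ ij; rewrite setIACA setIid -preimage_setI.
  by move/trivIsetP : tF => /(_ _ _ _ _ ij) ->//; rewrite preimage_set0 set0I.
- rewrite -setI_bigcupl -preimage_bigcup.
  by apply: measurableI; [exact: mradial|exact: measurable_uball].
Qed.

HB.instance Definition _ := isMeasure.Build _ _ _ sphere_measure
  sphere_measure0 sphere_measure_ge0 sphere_measure_sigma_additive.

End norms.

Section sobolev.
Variable n : nat.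
Local Notation mu := (lebesgue_rV n).
Implicit Types (v w g phi : 'rV[R]_n -> R) (u : 'rV[R]_n -> 'rV[R]_n).

Definition partial (j : 'I_n) phi : 'rV[R]_n -> R :=
  fun x => 'D_(delta_mx ord0 j) phi x.

Fixpoint Ck (k : nat) phi : Prop :=
  match k with
  | 0 => continuous phi
  | k'.+1 => continuous phi /\
      (forall j, (forall x, derivable phi x (delta_mx ord0 j)) /\
                 Ck k' (partial j phi))
  end.

Definition test_function phi : Prop :=
  (forall k, Ck k phi) /\
  exists2 rho : R, rho < 1 & forall x, rho <= enorm x -> phi x = 0.

Definition L1ball v : Prop := mu.-integrable (@uball n) (EFin \o v).

Definition is_weak_partial (j : 'I_n) v g : Prop :=
  forall phi, test_function phi ->
    (\int[mu]_(x in @uball n) (v x * partial j phi x)%:E =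
     - \int[mu]_(x in @uball n) (g x * phi x)%:E)%E.

Definition W11 v : Prop :=
  L1ball v /\ forall j, exists2 g, L1ball g & is_weak_partial j v g.

(* A choice of weak derivative; it is unique up to a null set. *)
Definition weak_partial (j : 'I_n) v : 'rV[R]_n -> R :=
  xget (fun=> 0) [set g | L1ball g /\ is_weak_partial j v g].

(* For v in W11, h is the trace of v on the sphere: the trace operator is the
   continuous extension to W11, with values in L^1 of the sphere, of the
   restriction map of C^1 functions. *)
Definition has_trace v (h : 'rV[R]_n -> R) : Prop :=
  exists2 w : ('rV[R]_n -> R)^nat, (forall k, Ck 1 (w k)) &
    [/\ (fun k => \int[mu]_(x in @uball n) `|w k x - v x|%:E)%E @ \oo
          --> 0%E,
        forall j, (fun k => \int[mu]_(x in @uball n)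
          `|partial j (w k) x - weak_partial j v x|%:E)%E @ \oo --> 0%E &
        (fun k => \int[@sphere_measure n]_(x in @usphere n)
          `|w k x - h x|%:E)%E @ \oo --> 0%E].

Definition component u (i : 'I_n) : 'rV[R]_n -> R := fun x => u x ord0 i.

Definition W11_sphere u : Prop :=
  (forall i, W11 (component u i)) /\
  {ae mu, forall x, uball x -> enorm (u x) = 1}.

(* Maps in W^{1,1}(B^n, S^{n-1}) with u(x) = x on the sphere. *)
Definition admissible u : Prop :=
  W11_sphere u /\ forall i, has_trace (component u i) (fun x => x ord0 i).

Definition weak_gradient u (x : 'rV[R]_n) : 'M[R]_n :=
  \matrix_(i, j) weak_partial j (component u i) x.

Definition energy (f : R -> R) u : \bar R :=
  (\int[mu]_(x in @uball n) (f (enorm x) * frobenius (weak_gradient u x))%:E)%E.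

End sobolev.

(* Differentiability of the restriction of f to [0, 1], hence one-sided at the
   endpoints. *)
Definition differentiable01 (f : R -> R) : Prop :=
  forall x, 0 <= x <= 1 ->
    cvg ((fun y => (f y - f x) / (y - x)) @ within `[0, 1]%classic x^').

End euclidean.

(* Main.v *)
(* Let V = u0 - u.  Since |u| = 1, the columns of the weak gradient are
   orthogonal to u, so Cauchy-Schwarz against the projection onto the
   hyperplane orthogonal to u gives div u <= sqrt (n - 1) * |grad u|, with
   equality for u0 = x / |x|.  It is therefore enough to show that the integral
   of f(|x|) div V is at most 0.  As V has zero trace, integrating by parts
   against smooth nondecreasing approximations p_m(|x|^2) of f(|x|) gives

     int p_m(|x|^2) div V = - 2 int p_m'(|x|^2) (V . x),

   and V . x = |x| - u . x >= 0.  If equality holds and f' > 0, Fatou's lemma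
   forces V . x = 0 almost everywhere, hence u = u0.

   The integration by parts rests on |int_B d_j w| <= 4 int_S |w| for w of class
   C^1: multiply w by a cutoff supported in the ball and compare the annulus
   t <= |x| < 1 with the cone measure on the sphere, by scaling. *)

From HB Require Import structures.
Require Import Defs.
From mathcomp Require Import all_boot all_order all_algebra.
From mathcomp Require Import all_classical all_reals all_analysis.
From mathcomp Require Import measurable_realfun ring lra.
Set Implicit Arguments.
Unset Strict Implicit.
Unset Printing Implicit Defensive.
Import Order.TTheory GRing.Theory Num.Theory.
Import numFieldNormedType.Exports.
Local Open Scope classical_set_scope.
Local Open Scope ring_scope.

(** * Integration on R^n *)

(** The weight f is merely differentiable and f' need not be continuous, so f(|x|) cannot serve
    directly as a C^1 multiplier. The approximants p_m are difference quotients of a primitive of s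
    -> f(sqrt s). They are C^1 because f is continuous, their derivatives are nonnegative because f
    is monotone, and these derivatives converge pointwise to a multiple of f', which is all that
    Fatou's lemma asks. The variable is |x|^2 because |x| is not differentiable at the origin.
    Orthogonality of u to the columns of its gradient comes from differentiating |u|^2 = 1. The C^1
    functions approximating a component of u in W^{1,1} need not be bounded, however, so their
    squares need not converge. A truncated square with bounded Lipschitz derivative replaces the
    square; it changes nothing on u, whose components lie in [-1, 1]. The weak gradient is a choice
    of function, so an explicit gradient is reached through uniqueness almost everywhere. The map u0
    must itself be placed in the class, which rests on the integrability of 1/|x| on the ball. *)

Section measurable_structure_of_rV.
Context {R : realType}.

(** The sigma-algebra is the product one, so open sets need an argument: each is the union of the
    cubes with rational centre and radius 1/(k+1) that it contains, and there are countably many of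
    these. *)
Lemma open_measurable_rV n (U : set 'rV[R]_n) : open U -> measurable U.
Proof.
move=> oU.
pose Bq (p : 'rV[rat]_n * nat) : set 'rV[R]_n :=
  [set x | forall i, `|ratr (p.1 ord0 i) - x ord0 i| < p.2.+1%:R^-1].
have mBq p : measurable (Bq p).
  rewrite (_ : Bq p = \bigcap_(i in [set: 'I_n])
      ((fun x : 'rV[R]_n => x ord0 i) @^-1`
        [set y | `|ratr (p.1 ord0 i) - y| < p.2.+1%:R^-1])); last first.
    by apply/seteqP; split => x /= h i => [_|]; exact: h.
  apply: fin_bigcap_measurable; first exact: finite_finset.
  move=> i _; rewrite -[X in measurable X]setTI; apply: measurable_coor => //.
  exact: (open_measurable (ball_open (ratr (p.1 ord0 i) : R) _)).
rewrite (_ : U = \bigcup_p (if pselect (Bq p `<=` U) then Bq p else set0)).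
  apply: countable_bigcupT_measurable; first exact: countableP.
  by move=> p; case: pselect => ? /=; [exact: mBq|exact: measurable0].
apply/seteqP; split=> [x Ux|x [p _]]; last first.
  by case: pselect => //= BU Bx; exact: BU.
(* A rational point within 1/(m+1) < e/2 of x gives a cube that contains x and stays within e of
   x. *)
have /nbhs_ballP[e /= e0 xeU] : nbhs x U by exact: open_nbhs_nbhs.
pose m := Num.truncn (2 / e).
have me : m.+1%:R^-1 < e / 2 :> R.
  by rewrite invf_plt ?posrE ?divr_gt0 ?invf_div ?truncnS_gt.
have m0 : 0 < m.+1%:R^-1 :> R by rewrite invr_gt0.
have q i : {q : rat | `|ratr q - x ord0 i| < m.+1%:R^-1}.
  apply: cid; have /rat_in_itvoo[q] : x ord0 i - m.+1%:R^-1 < x ord0 i + m.+1%:R^-1.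
    by rewrite ltrD2l (lt_trans _ m0)// oppr_lt0.
  by rewrite in_itv /= => /andP[? ?]; exists q; rewrite ltr_distl; apply/andP.
exists (\row_i sval (q i), m) => //; case: pselect => [_|[]] /=.
  by move=> i /=; rewrite mxE; case: (q i).
move=> y /= By; apply: xeU; split => // i j; rewrite ord1 /ball /=.
have := By j; rewrite mxE; case: (q j) => r /= xr yr.
rewrite (_ : _ - _ = (ratr r - y ord0 j) - (ratr r - x ord0 j)); last ring.
rewrite (le_lt_trans (ler_normB _ _))// [ltRHS]splitr ltrD// (lt_trans _ me)//.
Qed.

Lemma continuous_measurable_rV n (h : 'rV[R]_n -> R) :
  continuous h -> measurable_fun setT h.
Proof.
move=> /continuousP ch.
apply: (measurability _ (RGenOpens.measurableE R)) => _ [_ [a [b ->] <-]].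
by rewrite setTI; apply: open_measurable_rV; apply/ch/interval_open.
Qed.

End measurable_structure_of_rV.

Section integral_on_rV.
Context {R : realType}.
Local Open Scope ereal_scope.
Local Notation leb := (@lebesgue_measure R).
Local Notation mu := (@lebesgue_rV R _).

Lemma measurable_comp_rV_cons n (h : 'rV[R]_n.+1 -> \bar R) :
  measurable_fun setT h -> measurable_fun setT (h \o @rV_cons R n).
Proof. by move=> mh; apply: measurableT_comp => //; exact: measurable_rV_cons. Qed.

(** The measure in dimension n+1 unfolds to the pushforward of a product along [rV_cons], so this is
    Tonelli's theorem; it drives the induction in the scaling formula. *)
Lemma ge0_integral_rVS n (h : 'rV[R]_n.+1 -> \bar R) :
  measurable_fun setT h -> (forall x, 0 <= h x) ->
  \int[mu]_x h x = \int[mu]_y \int[leb]_s h (rV_cons (s, y)).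
Proof.
move=> mh h0.
rewrite [LHS](_ : _ = \int[pushforward (leb \x mu) (@rV_cons R n)]_x h x)//.
rewrite ge0_integral_pushforward//; last exact: measurable_rV_cons.
rewrite preimage_setT.
apply: (@fubini_tonelli2 _ _ (measurableTypeR R) _ R leb mu).
  exact: measurable_comp_rV_cons.
by move=> x; exact: h0.
Qed.

Lemma integrable_rVS n (h : 'rV[R]_n.+1 -> \bar R) :
  mu.-integrable setT h -> (leb \x mu).-integrable setT (h \o @rV_cons R n).
Proof.
move=> /integrableP[mh hoo]; apply/integrableP; split.
  exact: measurable_comp_rV_cons.
apply: le_lt_trans hoo.
rewrite [leRHS](_ : _ = \int[pushforward (leb \x mu) (@rV_cons R n)]_x `|h x|)//.
rewrite ge0_integral_pushforward//; first exact: measurable_rV_cons.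
exact: measurableT_comp.
Qed.

(** Both orders of integration are recorded because a derivative is integrated out first, and its
    direction may be the head coordinate or one of the tail. *)
Lemma integral_rVS n (h : 'rV[R]_n.+1 -> \bar R) :
  mu.-integrable setT h ->
  \int[mu]_x h x = \int[mu]_y \int[leb]_s h (rV_cons (s, y)) /\
  \int[mu]_x h x = \int[leb]_s \int[mu]_y h (rV_cons (s, y)).
Proof.
move=> ih.
have ihc := integrable_rVS ih.
have -> : \int[mu]_x h x = \int[leb \x mu]_p (h \o @rV_cons R n) p.
  rewrite [LHS](_ : _ = \int[pushforward (leb \x mu) (@rV_cons R n)]_x h x)//.
  rewrite integral_pushforward ?preimage_setT//.
  - exact: measurable_rV_cons.
  - exact: measurable_int ih.
by split; [exact/esym/integral21_prod_meas1|exact/esym/integral12_prod_meas1].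
Qed.

End integral_on_rV.

(** * Lebesgue measure under dilations *)

Section scaling.
Context {R : realType}.
Local Open Scope ereal_scope.
Local Notation leb := (@lebesgue_measure R).
Local Notation mu := (@lebesgue_rV R _).

(** Lebesgue measure is t times its image under s -> t s, because the two agree on half-open
    intervals; the formula is the change of variables for that image. *)
Lemma ge0_integral_lebesgue_scale (t : R) (h : measurableTypeR R -> \bar R) :
  (0 < t)%R -> measurable_fun setT h -> (forall s, 0 <= h s) ->
  \int[leb]_s h s = t%:E * \int[leb]_s h (t * s)%R.
Proof.
move=> t0 mh h0.
pose phi : measurableTypeR R -> measurableTypeR R := fun s : R => (t * s)%R.
have mphi : measurable_fun setT phi by exact: mulrl_measurable.
have tge0 : (0 <= t)%R by exact: ltW.
pose t' := NngNum tge0.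
have lebnu A : measurable A -> leb A = mscale t' (pushforward leb phi) A.
  apply: lebesgue_measure_unique => X [[a b] ab <-] /=.
  rewrite /mscale /= /pushforward.
  rewrite [phi @^-1` _](_ : _ = `]a / t, b / t]%classic)%R; last first.
    apply/seteqP; split => s /=; rewrite !in_itv /= /phi;
      by rewrite ltr_pdivrMr// ler_pdivlMr// (mulrC s t).
  rewrite !lebesgue_measure_itv /= !lte_fin.
  rewrite ltr_pM2r ?invr_gt0//; case: ifPn => _; last by rewrite mule0.
  by rewrite -EFinD -EFinM -mulrBl mulrC divfK// gt_eqF.
rewrite [LHS](_ : _ = \int[mscale t' (pushforward leb phi)]_s h s); last first.
  by apply: eq_measure_integral => A mA _; exact: lebnu.
by rewrite ge0_integral_mscale// ge0_integral_pushforward.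
Qed.

Lemma measurable_rV_cons_slice n (h : 'rV[R]_n.+1 -> \bar R) (y : 'rV[R]_n) :
  measurable_fun setT h ->
  measurable_fun setT (fun s : measurableTypeR R => h (rV_cons (s, y))).
Proof.
move=> mh.
have mh2 : measurable_fun setT (h \o @rV_cons R n) by exact: measurable_comp_rV_cons.
exact: (measurable_fun_pair1 y mh2).
Qed.

Lemma measurable_scale_rV n (t : R) :
  measurable_fun setT (fun x : 'rV[R]_n => t *: x)%R.
Proof.
apply: measurable_fun_rVP => i.
under eq_fun do rewrite mxE.
by apply: measurable_funM; [exact: measurable_cst|exact: measurable_coor].
Qed.

Lemma scale_rV_cons n (t s : R) (y : 'rV[R]_n) :
  (t *: rV_cons (s, y) = rV_cons (t * s, t *: y))%R.
Proof.
apply/rowP => i; rewrite mxE; case: (unliftP ord0 i) => [j|] ->.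
  by rewrite !rV_consS mxE.
by rewrite !rV_cons0.
Qed.

(** Dilations act on the head and on the tail separately, so Tonelli reduces dimension n+1 to
    dimension n and to the line, each step contributing one factor t. *)
Lemma ge0_integral_rV_scale n (t : R) (h : 'rV[R]_n -> \bar R) :
  (0 < t)%R -> measurable_fun setT h -> (forall x, 0 <= h x) ->
  \int[mu]_x h x = (t ^+ n)%:E * \int[mu]_x h (t *: x)%R.
Proof.
move=> t0; elim: n => [|n IH] in h *; move=> mh h0.
  rewrite expr0 mul1e; apply: eq_integral => x _; congr h.
  by apply/rowP => -[].
have mht : measurable_fun setT (fun x : 'rV[R]_n.+1 => h (t *: x)%R).
  by apply: measurableT_comp => //; exact: measurable_scale_rV.
rewrite !ge0_integral_rVS//.
under [in RHS]eq_integral do under eq_integral do rewrite scale_rV_cons.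
pose H y := \int[leb]_s h (rV_cons (s, y)).
have mh2 : measurable_fun setT (h \o @rV_cons R n) by exact: measurable_comp_rV_cons.
have mH : measurable_fun setT H.
  apply: (@measurable_fun_fubini_tonelli_G _ _ (measurableTypeR R) _ R leb
    (h \o @rV_cons R n)) => //.
  by move=> x; exact: h0.
have H0 y : 0 <= H y by apply: integral_ge0.
rewrite (IH H mH H0 : \int[mu]_y \int[leb]_s h (rV_cons (s, y)) = _).
have mHt : measurable_fun setT (fun y : 'rV[R]_n => H (t *: y)%R).
  by apply: measurableT_comp => //; exact: measurable_scale_rV.
have HE (y : 'rV[R]_n) :
    H (t *: y)%R = t%:E * \int[leb]_s h (rV_cons (t * s, t *: y)%R).
  rewrite -(@ge0_integral_lebesgue_scale t (fun s => h (rV_cons (s, t *: y)%R)))//.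
  exact: measurable_rV_cons_slice.
rewrite exprSr EFinM -muleA; congr (_ * _).
transitivity (\int[mu]_(y in setT) (t%:E * \int[leb]_s h (rV_cons (t * s, t *: y)%R))).
  by apply: eq_integral => y _; exact: HE.
rewrite ge0_integralZl//; last 3 first.
- rewrite (_ : (fun y => _) = fun y => t^-1%:E * H (t *: y)%R).
    exact: measurable_funeM.
  by apply/funext => y; rewrite HE muleA -EFinM mulVf ?gt_eqF// mul1e.
- by move=> y _; exact: integral_ge0.
- by rewrite lee_fin ltW.
Qed.

(** A product of intervals, hence compact and of finite measure; supports and bounds are expressed
    with it. *)
Definition cube n (M : R) : set 'rV[R]_n :=
  [set x | forall i, (`|x ord0 i| <= M)%R].

Lemma measurable_cube n M : measurable (@cube n M).
Proof.
rewrite (_ : @cube n M = \bigcap_(i in [set: 'I_n])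
    ((fun x : 'rV[R]_n => x ord0 i) @^-1` `[(- M)%R, M])); last first.
  by apply/seteqP; split => x /= h i => [_|];
    move: (h i); rewrite /= in_itv /= ler_norml //; apply.
apply: fin_bigcap_measurable; first exact: finite_finset.
by move=> i _; rewrite -[X in measurable X]setTI; exact: measurable_coor.
Qed.

Lemma cube_lty n M : mu (@cube n M) < +oo.
Proof.
elim: n => [|n IH]; first by rewrite /= diracE; case: (_ \in _); rewrite ltry.
rewrite /= /lebesgue_step /pushforward.
rewrite (_ : _ @^-1` _ = `[(- M)%R, M]%classic `*` @cube n M).
  rewrite product_measure1E//; last exact: measurable_cube.
  apply: lte_mul_pinfty => //=.
  rewrite lebesgue_measure_itv /=; case: ifPn => // _.
apply/seteqP; split => -[s y] /=.
  move=> h; split.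
    by have := h ord0; rewrite rV_cons0 in_itv /= ler_norml.
  by move=> i; have := h (lift ord0 i); rewrite rV_consS.
rewrite in_itv /= -ler_norml => -[sM yM] i.
by case: (unliftP ord0 i) => [j|] ->; rewrite ?rV_consS ?rV_cons0//; exact: yM.
Qed.

End scaling.

Section euclidean_norm.
Context {R : realType}.
Local Open Scope ereal_scope.
Local Notation mu := (@lebesgue_rV R _).
Variable n : nat.
Implicit Types x y : 'rV[R]_n.

Lemma enorm_ge0 x : (0 <= enorm x)%R.
Proof. exact: sqrtr_ge0. Qed.

Lemma sqr_enorm x : (enorm x ^+ 2 = \sum_i x ord0 i ^+ 2)%R.
Proof. by rewrite sqr_sqrtr// sumr_ge0// => i _; exact: sqr_ge0. Qed.

Lemma le_coor_enorm x i : (`|x ord0 i| <= enorm x)%R.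
Proof.
rewrite -sqrtr_sqr ler_sqrt ?sumr_ge0// => [|j _]; last exact: sqr_ge0.
by rewrite (bigD1 i)//= lerDl sumr_ge0// => j _; exact: sqr_ge0.
Qed.

Lemma enormZ (t : R) x : (enorm (t *: x) = `|t| * enorm x)%R.
Proof.
rewrite /enorm -sqrtr_sqr -sqrtrM ?sqr_ge0// mulr_sumr; congr Num.sqrt.
by apply: eq_bigr => i _; rewrite mxE exprMn.
Qed.

Lemma enorm_eq0 x : (enorm x == 0)%R = (x == 0)%R.
Proof.
apply/eqP/eqP => [x0|->].
  apply/rowP => i; rewrite mxE; apply/normr0_eq0/le_anti.
  by rewrite normr_ge0 andbT -x0 le_coor_enorm.
by rewrite /enorm big1 ?sqrtr0// => i _; rewrite mxE expr0n.
Qed.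

Lemma enorm_radial x : x != 0%R -> enorm (radial x) = 1%R.
Proof.
move=> x0; rewrite enormZ ger0_norm ?invr_ge0 ?enorm_ge0// mulVf//.
by rewrite enorm_eq0.
Qed.

Lemma radialZ (t : R) x : (0 < t)%R -> radial (t *: x) = radial x.
Proof.
move=> t0; rewrite /radial enormZ gtr0_norm// invfM scalerA mulrAC.
by rewrite mulVf ?mul1r// gt_eqF.
Qed.

Definition eball (r : R) : set 'rV[R]_n := [set x | (enorm x < r)%R].

Lemma measurable_eball r : measurable (eball r).
Proof.
rewrite (_ : eball r = setT `&` @enorm R n @^-1` `]-oo, r[%classic).
  exact: measurable_enorm.
by apply/seteqP; split => x /=; rewrite in_itv //= => -[].
Qed.

Lemma uball_lty : mu (@uball R n) < +oo.
Proof.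
apply: le_lt_trans (cube_lty n 1); apply: le_measure.
- by rewrite inE; exact: measurable_uball.
- by rewrite inE; exact: measurable_cube.
- by move=> x /= /ltW x1 i; rewrite (le_trans (le_coor_enorm _ _)).
Qed.

Lemma uball_fin_num : mu (@uball R n) \is a fin_num.
Proof. by rewrite ge0_fin_numE// uball_lty. Qed.

Lemma ge0_integral_eball (t : R) (h : 'rV[R]_n -> \bar R) :
  (0 < t)%R -> measurable_fun setT h -> (forall x, 0 <= h x) ->
  \int[mu]_(x in eball t) h x =
  (t ^+ n)%:E * \int[mu]_(x in @uball R n) h (t *: x)%R.
Proof.
move=> t0 mh h0; rewrite integral_mkcond [in RHS]integral_mkcond.
rewrite (ge0_integral_rV_scale t0); last 2 first.
- by apply/(measurable_restrictT _ _).1; [exact: measurable_eball|exact: measurable_funTS].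
- by move=> x; exact: erestrict_ge0.
congr (_ * _); apply: eq_integral => x _; rewrite /patch.
rewrite (_ : (t *: x \in eball t)%R = (x \in @uball R n))//.
apply/idP/idP; rewrite !inE /eball /uball /= enormZ gtr0_norm//;
  by rewrite gtr_pMr.
Qed.

Lemma measurable_rV_set1_0 : measurable [set (0%R : 'rV[R]_n)].
Proof.
rewrite (_ : [set _] = @cube R n 0); first exact: measurable_cube.
apply/seteqP; split => x /= => [-> i|h].
  by rewrite mxE normr0.
by apply/rowP => i; rewrite mxE; apply/normr0_eq0/le_anti; rewrite h normr_ge0.
Qed.

(** Doubling fixes the origin but multiplies measures by 2^n, and the mass of the origin is finite
    since the unit ball contains it. *)
Lemma lebesgue_rV_set1_0 : (0 < n)%N -> mu [set (0%R : 'rV[R]_n)] = 0.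
Proof.
move=> n0.
have m0 := measurable_rV_set1_0.
have e0 : (enorm (0%R : 'rV[R]_n) = 0)%R by apply/eqP; rewrite enorm_eq0.
have foo : mu [set (0%R : 'rV[R]_n)] \is a fin_num.
  rewrite ge0_fin_numE//; apply: le_lt_trans uball_lty; apply: le_measure.
  - by rewrite inE.
  - by rewrite inE; exact: measurable_uball.
  - by move=> x /= ->; rewrite /uball /= e0 ltr01.
have := @ge0_integral_rV_scale R n 2 (fun x => (\1_[set (0%R : 'rV[R]_n)] x)%:E).
rewrite -(_ : \int[mu]_x (\1_[set (0%R : 'rV[R]_n)] x)%:E =
              \int[mu]_x (\1_[set (0%R : 'rV[R]_n)] (2 *: x)%R)%:E); last first.
  apply: eq_integral => x _; rewrite !indicE.
  suff -> : (x \in [set 0%R : 'rV[R]_n]) = ((2 *: x)%R \in [set 0%R : 'rV[R]_n]) by [].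
  apply/idP/idP => /set_mem /= x0; apply/mem_set => /=; first by rewrite x0 scaler0.
  by have /eqP := x0; rewrite scaler_eq0 pnatr_eq0 => /eqP.
rewrite integral_indic// setIT -(fineK foo) => /(_ (ltr0n _ _)) H.
have {H} : fine (mu [set (0%R : 'rV[R]_n)]) =
           (2 ^+ n * fine (mu [set (0%R : 'rV[R]_n)]))%R.
  apply: EFin_inj; rewrite EFinM; rewrite fineK//; apply: H.
  - by apply/measurable_EFinP; exact: measurable_indic.
  - by move=> x; rewrite lee_fin.
set m := fine _ => mE.
have : ((2 ^+ n - 1) * m = 0)%R by rewrite mulrBl -mE mul1r subrr.
move=> /eqP; rewrite mulf_eq0 => /orP[|/eqP ->//].
by rewrite subr_eq0 gt_eqF// exprn_egt1// -?lt0n// ltr1n.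
Qed.

Lemma enorm_gt0 (x : 'rV[R]_n) : (x != 0)%R -> (0 < enorm x)%R.
Proof. by move=> x0; rewrite lt_neqAle enorm_ge0 eq_sym enorm_eq0 x0. Qed.

Lemma ae_rV_neq0 : (0 < n)%N -> {ae mu, forall x : 'rV[R]_n, (x != 0)%R}.
Proof.
move=> n0.
exists [set 0%R]; split; [exact: measurable_rV_set1_0|exact: lebesgue_rV_set1_0|].
by move=> x /= /negP; rewrite negbK => /eqP.
Qed.

End euclidean_norm.

(** * Functions of class C^k *)

Section chain_rule.
Context {R : realType}.

(** Reduces directional derivatives to one real variable, where Caratheodory's characterization by a
    continuous slope function is available. *)
Lemma is_derive_line (V : normedModType R) (f : V -> R) (x v : V) (df : R) :
  is_derive x v f df <-> is_derive (0 : R) 1 (fun h : R => f (h *: v + x)) df.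
Proof.
have E : (fun h : R => h^-1 *: ((f \o shift x) (h *: v) - f x)) =
    (fun h : R => h^-1 *: (((fun h : R => f (h *: v + x)) \o shift 0) (h *: 1)
       - f (0 *: v + x))).
  by apply/funext => h /=; rewrite addr0 scale0r add0r [_%:A]mulr1.
by split => -[dfx vE]; split; move: dfx vE; rewrite /derivable /derive E.
Qed.

(** The inner function has only a directional derivative, as in [Ck], and need not be
    differentiable. Along the line, the slope functions of h and g multiply. *)
Lemma is_derive_comp (V : normedModType R) (h : R -> R) (g : V -> R)
    (x v : V) (dh dg : R) :
  is_derive (g x) 1 h dh -> is_derive x v g dg ->
  is_derive x v (h \o g) (dh * dg).
Proof.
move=> dhx /is_derive_line dgx; apply/is_derive_line.
have g0 : g (0 *: v + x) = g x by rewrite scale0r add0r.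
have /derivable1_diffP/differentiable_continuous cg : derivable (fun t : R => g (t *: v + x)) 0 1.
  by case: dgx.
move/is_derive1_caratheodory : dgx => [G [GE cG G0]].
move/is_derive1_caratheodory : dhx => [H [HE cH H0]].
apply/is_derive1_caratheodory; exists (fun t : R => H (g (t *: v + x)) * G t).
split; last by rewrite g0 H0 G0.
- by move=> t /=; rewrite g0 HE -g0 GE mulrA.
- apply: continuousM => //.
  by apply: continuous_comp; [exact: cg|rewrite g0].
Qed.

End chain_rule.

Section Ck_calculus.
Context {R : realType}.
Variable n : nat.
Implicit Types (phi psi : 'rV[R]_n -> R) (h : R -> R).
Local Notation e_ j := (delta_mx ord0 j : 'rV[R]_n).

Lemma Ck_continuous k phi : Ck k phi -> continuous phi.
Proof. by case: k => //= k []. Qed.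

Lemma CkW k phi : Ck k.+1 phi -> Ck k phi.
Proof.
elim: k phi => [|k IH] phi [cphi dphi] //; split => // j.
by have [? ?] := dphi j; split => //; exact: IH.
Qed.

Lemma Ck_is_derive k phi x j : Ck k.+1 phi -> is_derive x (e_ j) phi (partial j phi x).
Proof. by move=> [_ /(_ j)[dphi _]]; split. Qed.

Lemma CkS_partial k phi j : Ck k.+1 phi -> Ck k (partial j phi).
Proof. by move=> [_ /(_ j)[]]. Qed.

Lemma CkS_intro k phi (dphi : 'I_n -> 'rV[R]_n -> R) :
  continuous phi -> (forall j x, is_derive x (e_ j) phi (dphi j x)) ->
  (forall j, Ck k (dphi j)) -> Ck k.+1 phi.
Proof.
move=> cphi dphiE Cdphi; split => // j; split => [x|]; first by case: (dphiE j x).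
rewrite (_ : partial j phi = dphi j); first exact: Cdphi.
by apply/funext => x; case: (dphiE j x).
Qed.

Lemma Ck_cst k (c : R) : Ck k (fun _ : 'rV[R]_n => c).
Proof.
elim: k c => [|k IH] c /=; first exact: cst_continuous.
by apply: (@CkS_intro k _ (fun _ _ => 0)) => //; exact: cst_continuous.
Qed.

Lemma Ck_add k phi psi : Ck k phi -> Ck k psi -> Ck k (fun x => phi x + psi x).
Proof.
elim: k phi psi => [|k IH] phi psi Cphi Cpsi /=.
  by move=> x; apply: continuousD; [exact: Cphi|exact: Cpsi].
apply: (@CkS_intro k _ (fun j x => partial j phi x + partial j psi x)).
- by move=> x; apply: continuousD; [exact: (Ck_continuous Cphi)|exact: (Ck_continuous Cpsi)].
- by move=> j x; apply: is_deriveD; [exact: (Ck_is_derive _ _ Cphi)|exact: (Ck_is_derive _ _ Cpsi)].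
- by move=> j; apply: IH; [exact: (CkS_partial _ Cphi)|exact: (CkS_partial _ Cpsi)].
Qed.

Lemma Ck_mul k phi psi : Ck k phi -> Ck k psi -> Ck k (fun x => phi x * psi x).
Proof.
elim: k phi psi => [|k IH] phi psi Cphi Cpsi /=.
  by move=> x; apply: continuousM; [exact: Cphi|exact: Cpsi].
apply: (@CkS_intro k _
  (fun j x => phi x * partial j psi x + psi x * partial j phi x)).
- by move=> x; apply: continuousM; [exact: (Ck_continuous Cphi)|exact: (Ck_continuous Cpsi)].
- by move=> j x; apply: is_deriveM; [exact: (Ck_is_derive _ _ Cphi)|exact: (Ck_is_derive _ _ Cpsi)].
- by move=> j; apply: Ck_add; apply: IH;
    by [exact: (CkW Cphi)|exact: (CkW Cpsi)|exact: (CkS_partial _ Cphi)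
       |exact: (CkS_partial _ Cpsi)].
Qed.

Lemma Ck_opp k phi : Ck k phi -> Ck k (fun x => - phi x).
Proof.
move=> Cphi; rewrite (_ : (fun x => - phi x) = (fun x => -1 * phi x)).
  by apply: Ck_mul => //; exact: Ck_cst.
by apply/funext => x; rewrite mulN1r.
Qed.

Lemma Ck_sub k phi psi : Ck k phi -> Ck k psi -> Ck k (fun x => phi x - psi x).
Proof. by move=> Cphi Cpsi; apply: Ck_add => //; exact: Ck_opp. Qed.

Lemma Ck_sum k (I : Type) (r : seq I) (F : I -> 'rV[R]_n -> R) :
  (forall i, Ck k (F i)) -> Ck k (fun x => \sum_(i <- r) F i x).
Proof.
move=> CF; elim: r => [|i r IH].
  by under eq_fun do rewrite big_nil; exact: Ck_cst.
by under eq_fun do rewrite big_cons; exact: Ck_add.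
Qed.

Lemma Ck_prod k (I : Type) (r : seq I) (F : I -> 'rV[R]_n -> R) :
  (forall i, Ck k (F i)) -> Ck k (fun x => \prod_(i <- r) F i x).
Proof.
move=> CF; elim: r => [|i r IH].
  by under eq_fun do rewrite big_nil; exact: Ck_cst.
by under eq_fun do rewrite big_cons; exact: Ck_mul.
Qed.

Lemma is_derive_coor (i : 'I_n) (x v : 'rV[R]_n) :
  is_derive x v (fun y : 'rV[R]_n => y ord0 i) (v ord0 i).
Proof.
apply/is_derive_line; apply/is_derive1_caratheodory; exists (fun=> v ord0 i).
by split => // [t|]; [rewrite !mxE; ring|exact: cst_continuous].
Qed.

Lemma Ck_coor k (i : 'I_n) : Ck k (fun x : 'rV[R]_n => x ord0 i).
Proof.
case: k => [|k]; first exact: coord_continuous.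
apply: (@CkS_intro k _ (fun j _ => e_ j ord0 i)).
- exact: coord_continuous.
- by move=> j x; exact: is_derive_coor.
- by move=> j; exact: Ck_cst.
Qed.

(** One-variable counterpart of [Ck]; the derivative is a witness, so an explicit formula can be
    supplied for it. *)
Fixpoint smooth (k : nat) h : Prop :=
  match k with
  | 0 => continuous h
  | k'.+1 => exists2 dh : R -> R, (forall s : R, is_derive s 1 h (dh s)) & smooth k' dh
  end.

Lemma is_derive_continuous h (dh : R -> R) :
  (forall s : R, is_derive s 1 h (dh s)) -> continuous h.
Proof.
by move=> dhE s; apply/differentiable_continuous/derivable1_diffP; case: (dhE s).
Qed.

Lemma smooth_continuous k h : smooth k h -> continuous h.
Proof. by case: k => // k [dh /is_derive_continuous]. Qed.

Lemma Ck_comp k h phi : smooth k h -> Ck k phi -> Ck k (h \o phi).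
Proof.
elim: k h phi => [|k IH] h phi sh Cphi.
  by move=> x; apply: continuous_comp; [exact: Cphi|exact: sh].
have ch := smooth_continuous sh; case: sh => dh dhE sdh.
apply: (@CkS_intro k _ (fun j x => dh (phi x) * partial j phi x)).
- by move=> x; apply: continuous_comp; [exact: Ck_continuous Cphi _|exact: ch].
- by move=> j x; apply: is_derive_comp => //; exact: (Ck_is_derive _ _ Cphi).
- move=> j; apply: Ck_mul; last exact: (CkS_partial _ Cphi).
  exact: IH (CkW Cphi).
Qed.

Definition sqnorm (x : 'rV[R]_n) : R := \sum_i x ord0 i ^+ 2.

Lemma sqnormE x : sqnorm x = enorm x ^+ 2.
Proof. by rewrite sqr_enorm. Qed.

Lemma sqnorm_ge0 x : 0 <= sqnorm x.
Proof. by rewrite sqnormE sqr_ge0. Qed.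

Lemma Ck_sqnorm k : Ck k sqnorm.
Proof.
apply: Ck_sum => i; under eq_fun do rewrite expr2.
by apply: Ck_mul; exact: Ck_coor.
Qed.

Lemma is_derive_sqnorm x j : is_derive x (e_ j) sqnorm (2 * x ord0 j).
Proof.
rewrite (_ : sqnorm = \sum_(i < n) (fun x : 'rV[R]_n => x ord0 i * x ord0 i)); last first.
  by apply/funext => y; rewrite fct_sumE; apply: eq_bigr => i _; rewrite expr2.
apply: is_derive_eq.
  by apply: is_derive_sum => i; apply: is_deriveM; exact: is_derive_coor.
rewrite (bigD1 j)//= big1 ?addr0 => [|i ij].
  by rewrite !mxE !eqxx /= scaler1 -mulr2n mulr_natl.
by rewrite mxE eqxx (negbTE ij) /= scaler0 addr0.
Qed.

End Ck_calculus.

Section piecewise_smooth.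
Context {R : realType}.

(** Building block of the C^1 splines [zeta] and [tsq]: its derivative is continuous across the
    kink. *)
Definition sqpos (s : R) : R := Num.max 0 s ^+ 2.

Lemma continuous_max0 : continuous (fun s : R => Num.max 0 s).
Proof.
by move=> s; apply: (@continuous_max R R (fun=> 0) id) => //; exact: cst_continuous.
Qed.

Lemma sqposE (s : R) : sqpos s = Num.max 0 s * s.
Proof. by rewrite /sqpos expr2; have [s0|s0] := leP 0 s; rewrite ?mul0r. Qed.

Lemma is_derive_sqpos (s : R) : is_derive s 1 sqpos (2 * Num.max 0 s).
Proof.
have [s0|s0|->] := ltgtP s 0.
- rewrite mulr0.
  apply: (@near_eq_is_derive _ _ _ (fun=> 0)) => //.
  near=> z; rewrite sqposE max_l ?mul0r//.
  by apply: ltW; near: z; exact: lt_nbhsl.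
- apply: (@near_eq_is_derive _ _ _ (fun z : R => z * z)).
    near=> z; rewrite sqposE max_r//.
    by apply: ltW; near: z; exact: lt_nbhsr.
  by apply: is_derive_eq; rewrite !scaler1; ring.
(* At the kink the slope function is [Num.max 0] itself, continuous with value 0. *)
- rewrite mulr0; apply/is_derive1_caratheodory.
  exists (fun z => Num.max 0 z); split; rewrite ?maxxx//.
  + by move=> z; rewrite sqposE /sqpos maxxx expr0n !subr0.
  + exact: continuous_max0.
Unshelve. all: by end_near. Qed.

End piecewise_smooth.

(** * Smooth functions that are flat at the origin *)

Section flat_function.
Context {R : realType}.
Variable c : R.
Hypothesis c0 : 0 < c.

(* The derivatives of exp(-c/s) are of the form P(1/s) exp(-c/s). *)
Definition flatp (P : {poly R}) (s : R) : R :=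
  if 0 < s then P.[s^-1] * expR (- (c / s)) else 0.

(** The exponential series gives exp(c/s) >= (c/s)^(k+2)/(k+2)!, so every s^-k exp(-c/s) is O(s^2).
    With this quadratic bound the slope at 0 tends to 0. *)
Lemma flatp_bound (P : {poly R}) :
  exists C : R, forall s, `|flatp P s| <= C * s ^+ 2.
Proof.
pose C k : R := (k.+2)`!%:R / c ^+ k.+2.
have C0 k : 0 <= C k by rewrite divr_ge0// exprn_ge0// ltW.
have monom k (s : R) : 0 < s -> s^-1 ^+ k * expR (- (c / s)) <= C k * s ^+ 2.
  move=> s0; have cs0 : 0 <= c / s by rewrite divr_ge0// ltW.
  have H : (c / s) ^+ k.+2 / k.+2`!%:R <= expR (c / s).
    by apply: le_trans (expR_ge1Dxn k.+1 cs0); rewrite lerDr.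
  rewrite expRN.
  rewrite ler_pdivrMr ?expR_gt0//.
  apply: (@le_trans _ _ (C k * s ^+ 2 * ((c / s) ^+ k.+2 / k.+2`!%:R))); last first.
    by rewrite ler_wpM2l// mulr_ge0// sqr_ge0.
  rewrite (_ : C k * _ * _ = s^-1 ^+ k) // /C -addn2 exprMn !exprD !exprVn.
  have /= F := fact_gt0 (k + 2); field.
  by rewrite pnatr_eq0 -lt0n F !gt_eqF ?exprn_gt0//.
exists (\sum_(i < size P) `|P`_i| * C i) => s; rewrite /flatp.
case: ifPn => [s0|_]; last first.
  by rewrite normr0 mulr_ge0 ?sqr_ge0// sumr_ge0// => i _; rewrite mulr_ge0.
rewrite normrM (ger0_norm (expR_ge0 _)) horner_coef mulr_suml.
apply: (@le_trans _ _ (\sum_(i < size P) (`|P`_i| * s^-1 ^+ i * expR (- (c / s))))).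
  rewrite -mulr_suml ler_wpM2r ?expR_ge0// (le_trans (ler_norm_sum _ _ _))//.
  apply: ler_sum => i _; rewrite normrM [X in _ * X]ger0_norm//.
  by rewrite exprn_ge0// invr_ge0 ltW.
apply: ler_sum => i _; rewrite -[leLHS]mulrA -[leRHS]mulrA ler_wpM2l//; exact: monom.
Qed.

(** The family is closed under differentiation: as polynomials in 1/s, P becomes c P - P' with an
    extra factor s^-2. Smoothness of every order then follows by induction. *)
Lemma is_derive_flatp (P : {poly R}) (s : R) :
  is_derive s 1 (flatp P) (flatp ('X^2 * (c *: P - P^`())) s).
Proof.
have [s0|s0|->] := ltgtP s 0.
- rewrite {2}/flatp ltNge (ltW s0)/=.
  apply: (@near_eq_is_derive _ _ _ (fun=> 0)) => //.
  near=> z; rewrite /flatp ltNge (_ : z <= 0)//.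
  by apply: ltW; near: z; exact: lt_nbhsl.
- have dV : is_derive s 1 (fun z : R => z^-1) (- s ^- 2).
    by apply: DeriveDef; [apply: derivableV => //; rewrite gt_eqF
      |rewrite deriveV ?gt_eqF// derive_id [_ *: _]mulr1].
  apply: (@near_eq_is_derive _ _ _ (fun z : R => P.[z^-1] * expR (- (c * z^-1)))).
    near=> z; rewrite /flatp (_ : 0 < z)//.
    by near: z; exact: lt_nbhsr.
  have d1 : is_derive s 1 (horner P \o (fun z : R => z^-1)) (P^`().[s^-1] * - s ^- 2).
    exact: is_derive_comp.
  have d2 : is_derive s 1 (expR \o (fun z : R => - (c * z^-1)))
      (expR (- (c * s^-1)) * - (c * - s ^- 2)).
    exact: is_derive_comp.
  apply: (is_derive_eq (is_deriveM d1 d2)).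
  rewrite /flatp s0 hornerM hornerXn hornerD hornerN hornerZ exprVn.
  by rewrite /GRing.scale /=; ring.
(* At 0 the slope function is [flatp P z / z], which the quadratic bound makes O(|z|). *)
- rewrite {2}/flatp ltxx; apply/is_derive1_caratheodory.
  have [C HC] := flatp_bound P.
  exists (fun z => flatp P z / z); split; rewrite ?invr0 ?mulr0//.
  + move=> z; rewrite {2}/flatp ltxx !subr0.
    have [->|z0] := eqVneq z 0; first by rewrite mulr0 /flatp ltxx.
    by rewrite divfK.
  + rewrite /prop_for /continuous_at /= invr0 mulr0.
    apply/cvgr0Pnorm_le => e e0.
    have near_e : \forall z \near (0 : R), `|z| <= e / (`|C| + 1).
      by apply: nbhs0_le; rewrite divr_gt0// ltr_wpDl.
    near=> z.
    have [->|z0] := eqVneq z 0; first by rewrite invr0 mulr0 normr0 ltW.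
    rewrite normrM normfV ler_pdivrMr ?normr_gt0// (le_trans (HC z))//.
    rewrite -real_normK ?num_real// expr2 mulrA ler_wpM2r//.
    rewrite (le_trans (ler_norm _))// normrM normr_id.
    rewrite (@le_trans _ _ ((`|C| + 1) * `|z|))// ?ler_wpM2r ?lerDl//.
    rewrite mulrC -ler_pdivlMr ?ltr_wpDl//.
    by near: z.
Unshelve. all: by end_near. Qed.

Lemma smooth_flatp k P : smooth k (flatp P).
Proof.
elim: k P => [|k IH] P /=; first exact: (is_derive_continuous (is_derive_flatp P)).
exists (flatp ('X^2 * (c *: P - P^`()))); first exact: is_derive_flatp.
exact: IH.
Qed.

(** The parameter serves two purposes: c = 1 gives a cutoff function, while c -> 0 makes [flat] tend
    to the indicator of the positive half-line. *)
Definition flat (s : R) : R := if 0 < s then expR (- (c / s)) else 0.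

Lemma flatE : flat = flatp 1.
Proof. by apply/funext => s; rewrite /flat /flatp hornerE mul1r. Qed.

Lemma smooth_flat k : smooth k flat.
Proof. rewrite flatE; exact: smooth_flatp. Qed.

Lemma flat_ge0 s : 0 <= flat s.
Proof. by rewrite /flat; case: ifPn => // _; exact: expR_ge0. Qed.

Lemma flat_gt0 s : 0 < s -> 0 < flat s.
Proof. by rewrite /flat => ->; exact: expR_gt0. Qed.

Lemma flat_eq0 s : s <= 0 -> flat s = 0.
Proof. by rewrite /flat ltNge => ->. Qed.

Lemma flat_le1 s : flat s <= 1.
Proof.
rewrite /flat; case: ifPn => // s0.
by rewrite expR_le1 oppr_le0 divr_ge0// ltW.
Qed.

End flat_function.

Lemma cvg_flat {R : realType} (s : R) :
  flat (k.+1%:R^-1) s @[k --> \oo] --> (if 0 < s then 1 else 0 : R).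
Proof.
rewrite /flat; case: ifPn => s0; last exact: cvg_cst.
rewrite -[X in _ --> X](@expR0 R); apply: continuous_cvg; first exact: continuous_expR.
rewrite -[X in _ --> X]oppr0; apply: cvgN.
rewrite -[X in _ --> X](mul0r s^-1); apply: cvgMr_tmp.
exact: cvg_harmonic.
Qed.

(** * Compactly supported functions *)

Section compactness.
Context {R : realType}.
Local Notation mu := (@lebesgue_rV R _).

Lemma cube_compact n (M : R) : compact (@cube R n M).
Proof.
rewrite (_ : cube M = [set v : 'rV[R]_n | forall i, `[- M, M]%classic (v ord0 i)]).
  by apply: (@rV_compact R n (fun=> `[- M, M]%classic)) => i; exact: segment_compact.
by apply/seteqP; split => x /= h i; move: (h i); rewrite /= in_itv /= ler_norml.
Qed.

Lemma continuous_cube_bounded n (M : R) (h : 'rV[R]_n -> R) : continuous h ->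
  exists C, forall x, cube M x -> `|h x| <= C.
Proof.
move=> ch.
have : compact (h @` cube M).
  apply: continuous_compact (@cube_compact n M).
  exact: continuous_subspaceT.
move=> /compact_bounded [C [_ hC]]; exists (C + 1) => x Mx.
have C1 : C < C + 1 by rewrite ltrDl.
by apply: (hC _ C1); exists x.
Qed.

Lemma uball_cube n : @uball R n `<=` cube 1.
Proof. by move=> x /= x1 i; rewrite (le_trans (le_coor_enorm _ _))// ltW. Qed.

Lemma continuous_uball_bounded n (h : 'rV[R]_n -> R) : continuous h ->
  exists C, forall x, uball x -> `|h x| <= C.
Proof.
move=> /(continuous_cube_bounded 1)[C hC].
by exists C => x /uball_cube; exact: hC.
Qed.

Lemma bounded_integrable n (A : set 'rV[R]_n) (h : 'rV[R]_n -> R) (C : R) :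
  measurable A -> (mu A < +oo)%E -> measurable_fun A h ->
  (forall x, A x -> `|h x| <= C) -> mu.-integrable A (EFin \o h).
Proof.
move=> mA Aoo mh hC; apply: measurable_bounded_integrable => //.
exists C; split; first exact: num_real.
by move=> D CD x Ax /=; apply: le_trans (hC x Ax) (ltW CD).
Qed.

Lemma continuous_integrable_uball n (h : 'rV[R]_n -> R) :
  continuous h -> mu.-integrable (@uball R n) (EFin \o h).
Proof.
move=> ch; have [C hC] := continuous_uball_bounded ch.
apply: (bounded_integrable (@measurable_uball R n) (uball_lty n) _ hC).
by apply: measurable_funTS; exact: continuous_measurable_rV.
Qed.

Lemma continuous_integrable_cube n (M : R) (h : 'rV[R]_n -> R) :
  continuous h -> (forall x, ~ cube M x -> h x = 0) ->
  mu.-integrable setT (EFin \o h).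
Proof.
move=> ch h0; have [C hC] := continuous_cube_bounded M ch.
have hE : EFin \o h = (EFin \o h) \_ (cube M).
  apply/funext => x; rewrite /patch; case: ifPn => //.
  by rewrite notin_setE => /h0 /= ->.
rewrite hE; apply/(integrable_restrict _ _ _) => //; first exact: measurable_cube.
rewrite setTI; apply: (bounded_integrable _ _ _ hC).
- exact: measurable_cube.
- exact: cube_lty.
- by apply: measurable_funTS; exact: continuous_measurable_rV.
Qed.

(** The complement of a cube is open, so a function that vanishes off a cube has partial derivatives
    that vanish there too. *)
Lemma near_cubeC n (M : R) (x : 'rV[R]_n) :
  ~ cube M x -> \forall y \near x, ~ cube M y.
Proof.
move=> /existsNP[i /negP]; rewrite -ltNge => Mx.
have ci : {for x, continuous (fun y : 'rV[R]_n => `|y ord0 i|)}.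
  by apply: continuous_comp; [exact: coord_continuous|exact: norm_continuous].
have : \forall y \near x, M < `|(y : 'rV[R]_n) ord0 i| by apply: (ci [set z | M < z]); exact: lt_nbhsr.
by apply: filterS => y My /(_ i); rewrite leNgt My.
Qed.

End compactness.

(** * Integrals of derivatives of compactly supported functions *)

Section integral_of_partial.
Context {R : realType}.
Local Notation mu := (@lebesgue_rV R _).
Local Notation leb := (@lebesgue_measure R).
Local Notation e_ j := (delta_mx ord0 j).

Lemma integral_derivative_eq0 (M : R) (g dg : R -> R) :
  (forall s : R, is_derive s 1 g (dg s)) -> continuous dg ->
  (forall s, M < `|s| -> g s = 0 /\ dg s = 0) ->
  (\int[leb]_s (dg s)%:E = 0)%E.
Proof.
move=> dgE cdg g0.
have cg : continuous g := is_derive_continuous dgE.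
(* N must be positive and exceed M, whose sign is not known. *)
pose N : R := `|M| + 1.
have N0 : 0 < N by rewrite ltr_wpDl.
have MN : M < N by rewrite (le_lt_trans (ler_norm _))// ltrDl.
transitivity (\int[leb]_(s in `[(- N)%R, N]) (dg s)%:E)%E.
  rewrite [RHS]integral_mkcond; apply: eq_integral => s _.
  rewrite /patch; case: ifPn => //; rewrite notin_setE /= in_itv /= -ler_norml.
  move=> /negP; rewrite -ltNge => Ns.
  by have [_ ->] := g0 s (lt_trans MN Ns).
rewrite (@continuous_FTC2 _ dg g).
- have [-> _] : g N = 0 /\ dg N = 0 by apply: g0; rewrite gtr0_norm.
  have [-> _] : g (- N) = 0 /\ dg (- N) = 0 by apply: g0; rewrite normrN gtr0_norm.
  by rewrite subee.
- by rewrite gtrN.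
- exact: continuous_subspaceT.
- split.
  + by move=> s _; case: (dgE s).
  + by apply: cvg_at_right_filter; exact: cg.
  + by apply: cvg_at_left_filter; exact: cg.
- by move=> s _; rewrite derive1E; case: (dgE s).
Qed.

Lemma rV_consD0 n (s t : R) (y : 'rV[R]_n) :
  t *: e_ ord0 + rV_cons (s, y) = rV_cons (t + s, y).
Proof.
apply/rowP => i; rewrite mxE [X in X + _]mxE mxE eqxx.
case: (unliftP ord0 i) => [j|] ->.
  by rewrite !rV_consS /= mulr0 add0r.
by rewrite !rV_cons0 eqxx /= mulr1.
Qed.

Lemma rV_consDS n (s t : R) (j : 'I_n) (y : 'rV[R]_n) :
  t *: e_ (lift ord0 j) + rV_cons (s, y) = rV_cons (s, t *: e_ j + y).
Proof.
apply/rowP => i; rewrite mxE [X in X + _]mxE mxE eqxx.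
case: (unliftP ord0 i) => [k|] ->.
  by rewrite !rV_consS /= !mxE eqxx /= (inj_eq lift_inj).
by rewrite !rV_cons0 /= mulr0 add0r.
Qed.

Lemma continuous_rV_cons1 n (y : 'rV[R]_n) :
  continuous (fun s : R => rV_cons (s, y)).
Proof.
move=> s A /nbhs_ballP[e /= e0 eA].
apply/nbhs_ballP; exists e => //= t st; apply: eA.
split => // i j; rewrite !ord1; case: (unliftP ord0 j) => [k|] ->.
  by rewrite !rV_consS; exact: ballxx.
by rewrite !rV_cons0.
Qed.

Lemma continuous_rV_cons2 n (s : R) :
  continuous (fun y : 'rV[R]_n => rV_cons (s, y)).
Proof.
move=> y A /nbhs_ballP[e /= e0 eA].
apply/nbhs_ballP; exists e => //= z [_ yz]; apply: eA.
split => // i j; rewrite !ord1; case: (unliftP ord0 j) => [k|] ->.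
  by rewrite !rV_consS; exact: yz.
by rewrite !rV_cons0; exact: ballxx.
Qed.

(** Induction on the dimension by Fubini. In the head direction the inner integral vanishes by the
    fundamental theorem of calculus; in a tail direction the head coordinate is frozen and the
    induction hypothesis applies. Only the j-th partial derivative is mentioned, so that slices
    inherit the hypotheses. *)
Lemma integral_partial_eq0 n (j : 'I_n) (M : R) (w : 'rV[R]_n -> R) :
  continuous w -> (forall x, derivable w x (e_ j)) -> continuous (partial j w) ->
  (forall x, ~ cube M x -> w x = 0) ->
  (\int[mu]_x (partial j w x)%:E = 0)%E.
Proof.
elim: n j w => [[] //|n IH] j w cw dw cdw w0.
have dw0 x : ~ cube M x -> partial j w x = 0.
  move=> Mx; rewrite /partial (@near_eq_derive _ _ _ _ (fun=> 0)) ?derive_cst//.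
  by apply: filterS (near_cubeC Mx) => y; exact: w0.
have idw := continuous_integrable_cube cdw dw0.
have cubeP (s : R) (y : 'rV[R]_n) : M < `|s| -> ~ cube M (rV_cons (s, y)).
  by move=> Ms /(_ ord0); rewrite rV_cons0 leNgt Ms.
have cubePS (s : R) (y : 'rV[R]_n) : ~ cube M y -> ~ cube M (rV_cons (s, y)).
  by move=> My Msy; apply: My => i; have := Msy (lift ord0 i); rewrite rV_consS.
case: (unliftP ord0 j) => [k|] jE.
- rewrite (integral_rVS idw).2 integral0_eq// => s _.
  have lineE (y : 'rV[R]_n) : is_derive y (e_ k) (fun y => w (rV_cons (s, y)))
      (partial j w (rV_cons (s, y))).
    apply/is_derive_line.
    rewrite (_ : (fun t : R => _) = (fun t : R => w (t *: e_ j + rV_cons (s, y)))).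
      by apply: (is_derive_line w _ _ _).1; apply: derivableP; exact: dw.
    by apply/funext => t; rewrite jE rV_consDS.
  have pE : partial k (fun y => w (rV_cons (s, y))) =
      (fun y => partial j w (rV_cons (s, y))).
    by apply/funext => y; case: (lineE y).
  have := IH k (fun y => w (rV_cons (s, y))).
  rewrite pE; apply.
  + by move=> y; apply: continuous_comp; [exact: continuous_rV_cons2|exact: cw].
  + by move=> y; case: (lineE y).
  + by move=> y; apply: continuous_comp; [exact: continuous_rV_cons2|exact: cdw].
  + by move=> y My; apply/w0/cubePS.
- rewrite (integral_rVS idw).1 integral0_eq// => y _.
  apply: (@integral_derivative_eq0 M (fun s => w (rV_cons (s, y)))
      (fun s => partial j w (rV_cons (s, y)))).
  + move=> s; apply/is_derive_line.
    rewrite (_ : (fun t : R => _) = (fun t : R => w (t *: e_ j + rV_cons (s, y)))).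
      by apply: (is_derive_line w _ _ _).1; apply: derivableP; exact: dw.
    by apply/funext => t; rewrite jE rV_consD0 [t *: 1]mulr1.
  + by move=> s; apply: continuous_comp; [exact: continuous_rV_cons1|exact: cdw].
  + by move=> s Ms; rewrite w0 ?dw0//; exact: cubeP.
Qed.

End integral_of_partial.

Section dominated.
Context {R : realType} {n : nat}.
Local Notation mu := (@lebesgue_rV R n).
Local Notation B := (@uball R n).
Local Notation mB := (@measurable_uball R n).

Lemma dominated_cvg_uball (h_ : ('rV[R]_n -> R)^nat) (h g : 'rV[R]_n -> R) :
  (forall k, measurable_fun B (h_ k)) ->
  (forall x, B x -> h_ k x @[k --> \oo] --> h x) ->
  mu.-integrable B (EFin \o g) ->
  (forall k x, B x -> `|h_ k x| <= g x) ->
  (\int[mu]_(x in B) (h_ k x)%:E)%E @[k --> \oo] --> (\int[mu]_(x in B) (h x)%:E)%E.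
Proof.
move=> mh hh ig hg; apply: (@dominated_cvg _ _ _ mu B mB _ _ (EFin \o g)) => //.
- by move=> k; apply/measurable_EFinP; exact: mh.
- by move=> x Bx; apply: cvg_EFin; [exact: nearW|exact: hh].
Qed.

Lemma integrable_mul_bounded (g phi : 'rV[R]_n -> R) (C : R) :
  mu.-integrable B (EFin \o g) -> measurable_fun B phi ->
  (forall x, B x -> `|phi x| <= C) ->
  mu.-integrable B (EFin \o (fun x => g x * phi x)).
Proof.
move=> ig mphi phiC.
apply: (@le_integrable _ _ _ mu B mB _ (EFin \o (fun x => C * `|g x|))).
- apply/measurable_EFinP/measurable_funM => //.
  by apply/measurable_EFinP; case/integrableP : ig.
- move=> x Bx /=; rewrite lee_fin normrM [leRHS]ger0_norm.
    by rewrite mulrC ler_wpM2r// phiC.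
  by rewrite mulr_ge0// (le_trans _ (phiC _ Bx)).
- rewrite (_ : EFin \o _ = (fun x => C%:E * (EFin \o (Num.norm \o g)) x)%E) //.
  by apply: integrableZl => //; [exact: mB|exact: integrable_norm].
Qed.

Lemma integrable_mul_continuous (g phi : 'rV[R]_n -> R) :
  mu.-integrable B (EFin \o g) -> continuous phi ->
  mu.-integrable B (EFin \o (fun x => g x * phi x)).
Proof.
move=> ig cphi; have [C hC] := continuous_uball_bounded cphi.
apply: (integrable_mul_bounded ig _ hC).
by apply: measurable_funTS; exact: continuous_measurable_rV.
Qed.

End dominated.

Lemma cvgr_prod {R : realType} (I : Type) (r : seq I) (F : I -> R^nat) (l : I -> R) :
  (forall i, F i k @[k --> \oo] --> l i) ->
  \prod_(i <- r) F i k @[k --> \oo] --> \prod_(i <- r) l i.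
Proof.
move=> Fl; elim: r => [|i r IH].
  by under eq_fun do rewrite big_nil; rewrite big_nil; exact: cvg_cst.
by under eq_fun do rewrite big_cons; rewrite big_cons; exact: cvgM.
Qed.

(** * The fundamental lemma of the calculus of variations *)

Section fundamental_lemma.
Context {R : realType} {n : nat}.
Local Notation mu := (@lebesgue_rV R n).
Local Notation B := (@uball R n).
Local Notation mB := (@measurable_uball R n).

(** Orthants form a pi-system generating the sigma-algebra, and their indicators are products of
    indicators of half-lines, which products of [flat] approximate. *)
Definition orthant (b : 'rV[R]_n) : set 'rV[R]_n :=
  [set x | forall i, x ord0 i < b ord0 i].

Let orthants : set (set 'rV[R]_n) := [set A | exists b, A = orthant b].

Let measurable_orthant b : measurable (orthant b).
Proof.
rewrite (_ : orthant b = \bigcap_(i in [set: 'I_n])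
    ((fun x : 'rV[R]_n => x ord0 i) @^-1` `]-oo, b ord0 i[)); last first.
  by apply/seteqP; split => x /= h i => [_|];
    move: (h i); rewrite /= in_itv //=; apply.
apply: fin_bigcap_measurable; first exact: finite_finset.
by move=> i _; rewrite -[X in measurable X]setTI; exact: measurable_coor.
Qed.

Let measurable_orthants : @measurable _ 'rV[R]_n = <<s orthants >>.
Proof.
apply/seteqP; split; last first.
  apply: smallest_sub; first exact: sigma_algebra_measurable.
  by move=> _ [b ->]; exact: measurable_orthant.
pose T := g_sigma_algebraType orthants.
suff mid : measurable_fun [set: T] (fun x : T => x : 'rV[R]_n).
  by move=> A mA; have := mid measurableT A mA; rewrite setTI.
apply: measurable_fun_rVP => i.
apply: (measurability _ (RGenInftyO.measurableE R)) => _ [_ [a ->] <-].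
(* The half-space x_i < a is exhausted by orthants whose other bounds N tend to infinity. *)
rewrite setTI (_ : _ @^-1` _ =
    \bigcup_N orthant (\row_j if j == i then a else N%:R)).
  by apply: bigcupT_measurable => N; apply: sub_sigma_algebra; eexists.
apply/seteqP; split => x /=; rewrite in_itv /=.
  move=> xa; exists (Num.truncn (enorm x)).+1 => // j; rewrite mxE.
  case: eqP => [->//|_].
  rewrite (le_lt_trans (ler_norm _))// (le_lt_trans (le_coor_enorm _ _))//.
  exact: truncnS_gt.
by move=> [N _ /(_ i)]; rewrite mxE eqxx.
Qed.

Let setI_orthants : setI_closed orthants.
Proof.
move=> _ _ [a ->] [b ->]; exists (\row_i Num.min (a ord0 i) (b ord0 i)).
apply/seteqP; split => x /=.
  by move=> [xa xb] i; rewrite mxE lt_min xa xb.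
by move=> xab; split => i; have := xab i; rewrite mxE lt_min => /andP[].
Qed.

(** The measurable sets on which g has integral 0 form a Dynkin system; the hypothesis on the whole
    space accounts for complements. *)
Lemma integral_orthant_ae_eq0 (g : 'rV[R]_n -> R) :
  mu.-integrable setT (EFin \o g) ->
  (\int[mu]_x (g x)%:E = 0)%E ->
  (forall b, \int[mu]_(x in orthant b) (g x)%:E = 0)%E ->
  {ae mu, forall x, g x = 0}.
Proof.
move=> ig gT gb.
have mg := measurable_int _ ig.
have gA A : measurable A -> (\int[mu]_(x in A) (g x)%:E = 0)%E.
  rewrite measurable_orthants; move: A.
  apply: (dynkin_induction measurable_orthants setI_orthants) => //.
  - by move=> _ [b ->]; exact: gb.
  - move=> S mS gS.
    move: gT; rewrite -(setUv S) integral_setU ?gS ?add0e//.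
    + exact: measurableC.
    + exact: measurable_funS mg.
    + by apply/disj_set2P; rewrite setICr.
  - move=> F mF tF gF; rewrite integral_bigcup//.
      by rewrite eseries0// => k _ _; exact: gF.
    apply: integrableS ig => //; exact: bigcupT_measurable.
have : ae_eq mu setT (EFin \o g) (cst 0%E).
  apply: integral_ae_eq => // E _ mE.
  by rewrite [LHS]gA// integral0.
by apply: filterS => x /(_ I) /= [].
Qed.

(** Positive exactly where [sqnorm x < r]: for 0 <= r < 1 it makes a test function of any smooth
    factor, and it can be divided out afterwards. *)
Definition cutoff (r : R) (x : 'rV[R]_n) : R := flat 1 (r - sqnorm x).

Lemma Ck_cutoff r k : Ck k (cutoff r).
Proof.
apply: (@Ck_comp _ _ k (flat 1) (fun x => r - sqnorm x)).
  by apply: smooth_flat; exact: ltr01.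
by apply: Ck_sub; [exact: Ck_cst|exact: Ck_sqnorm].
Qed.

Lemma test_function_cutoff r phi : 0 <= r < 1 -> (forall k, Ck k phi) ->
  test_function (fun x => cutoff r x * phi x).
Proof.
move=> /andP[r0 r1] Cphi; split => [k|].
  by apply: Ck_mul => //; exact: Ck_cutoff.
exists (Num.sqrt r); first by rewrite -sqrtr1 ltr_sqrt.
move=> x rx; rewrite /cutoff flat_eq0 ?mul0r// subr_le0 sqnormE.
by rewrite -(sqr_sqrtr r0) ler_sqr ?nnegrE ?sqrtr_ge0.
Qed.

(** For r < 1, g times the cutoff is tested against products of [flat] that converge to the
    indicator of an orthant. Its integral over every orthant is therefore 0, and it vanishes almost
    everywhere. Letting r -> 1 along a sequence removes the cutoff at every point of the ball. *)
Lemma fundamental_lemma (g : 'rV[R]_n -> R) : L1ball g ->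
  (forall phi, test_function phi -> (\int[mu]_(x in B) (g x * phi x)%:E = 0)%E) ->
  {ae mu, forall x, B x -> g x = 0}.
Proof.
move=> ig gphi.
suff gr (r : R) : 0 <= r < 1 ->
    {ae mu, forall x, ((fun x => g x * cutoff r x) \_ B) x = 0}.
  have : {ae mu, forall x (k : nat),
      ((fun x => g x * cutoff (1 - k.+1%:R^-1) x) \_ B) x = 0}.
    apply: ae_foralln => k; apply: gr.
    by rewrite subr_ge0 invf_le1// ler1n /= ltrBlDr ltrDl invr_gt0 ltr0n.
  apply: filterS => x + Bx; rewrite /uball /= in Bx.
  have sx : 0 < 1 - sqnorm x.
    by rewrite subr_gt0 sqnormE -(expr1n _ 2) ltr_sqr ?nnegrE ?enorm_ge0.
  (* This index k satisfies 1/(k+1) < 1 - |x|^2, so the cutoff is positive at x. *)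
  move=> /(_ (Num.truncn (1 - sqnorm x)^-1)); rewrite patchE mem_set//.
  move=> /eqP; rewrite mulf_eq0 => /orP[/eqP//|].
  rewrite gt_eqF// flat_gt0// addrAC subr_gt0.
  by rewrite invf_plt ?posrE// truncnS_gt.
move=> r01.
have [C hC] := continuous_uball_bounded (Ck_continuous (Ck_cutoff r 0)).
have igc := integrable_mul_continuous ig (Ck_continuous (Ck_cutoff r 0)).
have mg := measurable_int _ igc.
apply: integral_orthant_ae_eq0.
- rewrite -restrict_EFin; apply/(integrable_restrict _ _ _) => //; first exact: mB.
  by rewrite setTI.
- under eq_integral do rewrite -[((_ \_ _) _)%:E]/((EFin \o (_ \_ _)) _) -restrict_EFin.
  rewrite -integral_mkcond.
  (* The integral over the whole space is the test against the cutoff alone, with smooth factor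
     1. *)
  have := gphi _ (test_function_cutoff r01 (fun k => @Ck_cst R n k 1)).
  move=> <-; apply: eq_integral => x _ /=; by rewrite mulr1.
- move=> b.
  pose phi (m : nat) (x : 'rV[R]_n) : R := \prod_(i < n) flat m.+1%:R^-1 (b ord0 i - x ord0 i).
  have Cphi m k : Ck k (phi m).
    apply: Ck_prod => i.
    apply: (@Ck_comp _ _ k (flat m.+1%:R^-1) (fun x : 'rV[R]_n => b ord0 i - x ord0 i)).
      by apply: smooth_flat; rewrite invr_gt0.
    by apply: Ck_sub; [exact: Ck_cst|exact: Ck_coor].
  have phi01 m x : 0 <= phi m x <= 1.
    apply/andP; split; first by apply: prodr_ge0 => i _; exact: flat_ge0.
    by apply: Num.Theory.prodr_ile1 => i _; rewrite flat_ge0 flat_le1// invr_gt0.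
  have phi_cvg x : phi m x @[m --> \oo] --> (\1_(orthant b) x : R).
    rewrite (_ : \1_(orthant b) x = \prod_(i < n) (if 0 < b ord0 i - x ord0 i then 1 else 0)).
      by apply: cvgr_prod => i; exact: cvg_flat.
    rewrite indicE; case: (boolP (x \in orthant b)) => [/set_mem xb|/negP xb].
      by rewrite big1// => i _; rewrite subr_gt0 xb.
    have [i xbi] : exists i, ~~ (x ord0 i < b ord0 i).
      apply/not_existsP => h; apply: xb; apply/mem_set => i /=.
      by apply/negP => /negP; exact: h.
    by rewrite (bigD1 i)//= subr_gt0 (negbTE xbi) mul0r.
  have := @dominated_cvg_uball R n (fun m x => g x * cutoff r x * phi m x)
    (fun x => g x * cutoff r x * \1_(orthant b) x) (fun x => `|g x * cutoff r x|).
  have -> : (fun m => (\int[mu]_(x in B) (g x * cutoff r x * phi m x)%:E)%E) = cst 0%E.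
    apply/funext => m.
    have := gphi _ (test_function_cutoff r01 (Cphi m)).
    by move=> <-; apply: eq_integral => x _; rewrite mulrA.
  move=> H; transitivity (\int[mu]_(x in B) (g x * cutoff r x * \1_(orthant b) x)%:E)%E.
    rewrite integral_mkcond [RHS]integral_mkcond; apply: eq_integral => x _.
    rewrite /patch indicE; case: (x \in B); case: (x \in orthant b);
      by rewrite ?mulr1 ?mulr0.
  apply/esym; apply: (cvg_unique _ (cvg_cst _) (H _ _ _ _)) => //.
  + move=> m; apply: measurable_funM; first exact/measurable_EFinP.
    by apply: measurable_funTS; apply: continuous_measurable_rV; exact: (Ck_continuous (Cphi m 0%N)).
  + by move=> x _; apply: cvgMl_tmp; exact: phi_cvg.
  + exact: integrable_norm igc.
  + move=> m x _; rewrite normrM ler_piMr//.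
    by have /andP[p0 p1] := phi01 m x; rewrite ger0_norm.
Qed.

End fundamental_lemma.

(** * The sphere and the boundary estimate *)

Section sphere.
Context {R : realType} {n : nat}.
Hypothesis n0 : (0 < n)%N.
Local Notation mu := (@lebesgue_rV R n).
Local Notation B := (@uball R n).
Local Notation mB := (@measurable_uball R n).
Local Notation S := (@usphere R n).
Local Notation sigma := (@sphere_measure R n).

Lemma measurable_usphere : measurable S.
Proof.
rewrite (_ : S = setT `&` @enorm R n @^-1` [set 1]).
  exact: measurable_enorm.
by apply/seteqP; split => x //= -[].
Qed.

Lemma enorm0 : enorm (0 : 'rV[R]_n) = 0.
Proof. by apply/eqP; rewrite enorm_eq0. Qed.

(** On subsets of the sphere, [sphere_measure] is n times the image of Lebesgue measure on the ball
    under [radial], so the formula is a change of variables. *)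
Lemma ge0_integral_sphere (h : 'rV[R]_n -> R) :
  measurable_fun setT h -> (forall x, 0 <= h x) ->
  (\int[sigma]_(x in S) (h x)%:E =
   n%:R%:E * \int[mu]_(x in B) (h (radial x))%:E)%E.
Proof.
move=> mh h0.
(* The image measure needs a total map: outside the ball [rho] is 0, a point off the sphere, and so
   adds no mass there. *)
pose rho (x : 'rV[R]_n) : 'rV[R]_n :=
  \row_i ((fun x => radial x ord0 i) \_ B) x.
have rhoB x : B x -> rho x = radial x.
  by move=> Bx; apply/rowP => i; rewrite mxE patchE mem_set.
have rhoBC x : ~ B x -> rho x = 0.
  by move=> Bx; apply/rowP => i; rewrite !mxE patchE memNset.
have mrho : measurable_fun setT rho.
  apply: measurable_fun_rVP => i; under eq_fun do rewrite mxE.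
  apply/(measurable_restrictT _ _).1; first exact: mB.
  apply: measurable_funTS; apply: (measurableT_comp (measurable_coor i)).
  exact: measurable_radial.
have rhoS : rho @^-1` S = B `\ 0.
  apply/seteqP; split => x /=.
    have [Bx|Bx] := pselect (B x); last by rewrite /usphere /= rhoBC// enorm0 => /eqP; rewrite eq_sym oner_eq0.
    rewrite /usphere /= rhoB// => xS; split => //= x0; move: xS.
    by rewrite x0 /radial scaler0 enorm0 => /eqP; rewrite eq_sym oner_eq0.
  by move=> [Bx /eqP x0]; rewrite /usphere /= rhoB// enorm_radial.
have n_ge0 : 0 <= n%:R :> R by [].
rewrite [LHS](_ : _ =
    \int[mscale (NngNum n_ge0) (pushforward mu rho)]_(x in S) (h x)%:E)%E; last first.
  apply: eq_measure_integral => A mA AS.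
  rewrite /= /sphere_measure /mscale /= /pushforward; congr (_ * mu _)%E.
  apply/seteqP; split => x /=; first by move=> [Ax Bx]; rewrite rhoB.
  have [Bx|Bx] := pselect (B x); first by rewrite rhoB.
  by rewrite rhoBC// => /AS; rewrite /usphere /= enorm0 => /eqP; rewrite eq_sym oner_eq0.
have mhE A : measurable_fun A (fun x => (h x)%:E).
  by apply: measurable_funTS; apply/measurable_EFinP.
rewrite ge0_integral_mscale//; last 2 first.
- exact: measurable_usphere.
- by move=> x _; rewrite lee_fin.
rewrite ge0_integral_pushforward//; last 2 first.
- exact: measurable_usphere.
- by move=> x _; rewrite lee_fin.
rewrite rhoS; congr (_ * _)%E.
rewrite [RHS](@ge0_negligible_integral _ _ _ mu B [set 0])//.
- by apply: eq_integral => x /set_mem [Bx _] /=; rewrite rhoB.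
- exact: measurable_rV_set1_0.
- exact: mB.
- apply: measurable_funTS; apply/measurable_EFinP.
  by apply: (measurableT_comp mh); exact: measurable_radial.
- by move=> x _; rewrite lee_fin.
- exact: lebesgue_rV_set1_0.
Qed.

Lemma sphere_measure_lty : (sigma S < +oo)%E.
Proof.
rewrite /sphere_measure; apply: lte_mul_pinfty => //.
apply: le_lt_trans (uball_lty n); apply: le_measure.
- rewrite inE; apply: measurableI; last exact: mB.
  rewrite -[X in measurable X]setTI; apply: measurable_radial => //.
  exact: measurable_usphere.
- by rewrite inE; exact: mB.
- by move=> x [].
Qed.

Lemma radial_polar (x : 'rV[R]_n) : x = enorm x *: radial x.
Proof.
rewrite /radial scalerA; have [->|x0] := eqVneq x 0; first by rewrite scaler0.
by rewrite divff ?scale1r// enorm_eq0.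
Qed.

Lemma radial_cube (x : 'rV[R]_n) : cube 1 (radial x).
Proof.
move=> i; rewrite (le_trans (le_coor_enorm _ _))//.
have [->|x0] := eqVneq x 0; last by rewrite enorm_radial.
by rewrite /radial scaler0 enorm0.
Qed.

(** The estimate holds near each point by joint continuity of (x, t) -> w (t x), and compactness of
    the cube makes the neighbourhood of 1 uniform in x. *)
Lemma radial_uniform_cvg (w : 'rV[R]_n -> R) (e : R) : continuous w -> 0 < e ->
  \forall t \near (1 : R), forall x, cube 1 x -> `|w (t *: x) - w x| <= e.
Proof.
move=> cw e0.
have /compact_near_coveringP/(_ R (nbhs (1 : R)) (fun t x => `|w (t *: x) - w x| <= e)) := @cube_compact R n 1.
apply => x _.
have : {for (x, 1 : R), continuous (fun p : 'rV[R]_n * R => w (p.2 *: p.1) - w p.1)}.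
  apply: continuousB.
    apply: (@continuous_comp _ _ _ (fun p : 'rV[R]_n * R => p.2 *: p.1) w); last exact: cw.
    by apply: continuousZ; [exact: cvg_snd|exact: cvg_fst].
  apply: (@continuous_comp _ _ _ (@fst _ _) w); [exact: cvg_fst|exact: cw].
rewrite /prop_for /continuous_at /= scale1r subrr => /cvgr0Pnorm_le /(_ _ e0) [].
move=> [U V] /= [Ux V1] UV; exists (U, V) => // -[y t] [/= Uy Vt]; exact: (UV (y, t)).
Qed.

(** Near the sphere, w x differs from w (radial x) by at most e. The function |w (radial x)| + e is
    invariant under dilations, so its integral over the ball of radius t is t^n times that over B,
    and the annulus carries the fraction 1 - t^n. *)
Lemma integral_annulus (w : 'rV[R]_n -> R) (e : R) : continuous w -> 0 < e ->
  \forall t \near (1 : R), 0 < t < 1 ->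
  (\int[mu]_(x in B `\` eball t) `|w x|%:E <=
    (1 - t ^+ n)%:E * \int[mu]_(x in B) (`|w (radial x)| + e)%:E)%E.
Proof.
move=> cw e0.
have /nbhs_ballP[d /= d0 dw] := radial_uniform_cvg cw e0.
apply/nbhs_ballP; exists d => //= t; rewrite /ball /= => td /andP[t0 t1].
pose h (x : 'rV[R]_n) := `|w (radial x)| + e.
have h0 x : (0 <= (h x)%:E)%E by rewrite lee_fin addr_ge0// ltW.
have mw := continuous_measurable_rV cw.
have mh : measurable_fun setT (fun x => (h x)%:E).
  apply/measurable_EFinP; apply: measurable_funD => //.
  apply: measurableT_comp => //; apply: (measurableT_comp mw).
  exact: measurable_radial.
have tB : eball t `<=` B by move=> x /= xt; rewrite /uball /= (lt_trans xt).
have hoo : (\int[mu]_(x in B) (h x)%:E < +oo)%E.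
  have [C hC] := continuous_cube_bounded 1 cw.
  have : mu.-integrable B (EFin \o h).
    apply: (bounded_integrable (C := C + e) mB (uball_lty n)).
      by apply/measurable_EFinP; exact: (measurable_funTS mh).
    move=> x _; rewrite ger0_norm ?addr_ge0 ?(ltW e0)// lerD2r.
    by apply: hC; exact: radial_cube.
  by move=> /integrableP[_]; under eq_integral => x _ do rewrite (gee0_abs (h0 x)).
have hfin : (\int[mu]_(x in B) (h x)%:E)%E \is a fin_num.
  by rewrite ge0_fin_numE// integral_ge0.
apply: (@le_trans _ _ (\int[mu]_(x in B `\` eball t) (h x)%:E)%E).
  apply: ge0_le_integral => //.
  - by apply: measurableD; [exact: mB|exact: measurable_eball].
  - by apply/measurable_EFinP/measurableT_comp => //; exact: measurable_funTS.
  - exact: (measurable_funTS mh).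
  - move=> x [Bx /negP]; rewrite /eball /= -leNgt => tx.
    rewrite lee_fin /h.
    have {1}-> : w x = w (radial x) + (w (enorm x *: radial x) - w (radial x)).
      by rewrite -radial_polar addrC subrK.
    rewrite (le_trans (ler_normD _ _))// lerD2l dw//; last exact: radial_cube.
    move: Bx; rewrite /uball /ball /= => Bx.
    move: td; rewrite !gtr0_norm ?subr_gt0// => td.
    by rewrite (le_lt_trans _ td)// lerD2l lerN2.
set J := (\int[mu]_(x in B `\` eball t) (h x)%:E)%E.
have Jfin : J \is a fin_num.
  rewrite ge0_fin_numE ?integral_ge0//; apply: le_lt_trans hoo.
  apply: ge0_subset_integral => //.
  - by apply: measurableD; [exact: mB|exact: measurable_eball].
  - exact: mB.
  - exact: (measurable_funTS mh).
(* With I the integral of h over B, this reads I = t^n I + J; both are finite, so J can be solved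
   for. *)
have : (\int[mu]_(x in B) (h x)%:E = (t ^+ n)%:E * \int[mu]_(x in B) (h x)%:E + J)%E.
  have -> : (\int[mu]_(x in B) (h x)%:E = \int[mu]_(x in B) (h (t *: x))%:E)%E.
    by apply: eq_integral => x _; rewrite /h radialZ.
  rewrite -(ge0_integral_eball t0 mh h0) -ge0_integral_setU//.
  - rewrite setDUK//; apply: eq_integral => x _.
    by rewrite /h radialZ.
  - exact: measurable_eball.
  - by apply: measurableD; [exact: mB|exact: measurable_eball].
  - exact: (measurable_funTS mh).
  - by apply/disj_set2P; rewrite setDE setICA setICr setI0.
rewrite -(fineK hfin) -(fineK Jfin) -EFinM -EFinD => -[IE].
by rewrite -EFinM lee_fin; lra.
Qed.

End sphere.

Section cutoff_profile.
Context {R : realType}.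

(* A C^1 quadratic spline rising from 0 at s = 0 to 1 at s = 1. *)
Definition zeta (s : R) : R :=
  2 * sqpos s - 4 * sqpos (s - 2^-1) + 2 * sqpos (s - 1).

Definition dzeta (s : R) : R :=
  2 * (2 * Num.max 0 s) - 4 * (2 * Num.max 0 (s - 2^-1)) + 2 * (2 * Num.max 0 (s - 1)).

Lemma is_derive_sqposB (c s : R) :
  is_derive s 1 (fun s => sqpos (s - c)) (2 * Num.max 0 (s - c)).
Proof.
rewrite -[X in is_derive _ _ _ X]mulr1.
apply: (@is_derive_comp _ _ sqpos (fun s => s - c)); first exact: is_derive_sqpos.
by apply: is_derive_eq; rewrite subr0.
Qed.

Lemma is_derive_zeta (s : R) : is_derive s 1 zeta (dzeta s).
Proof.
have d0 := is_derive_sqpos s; have d1 := is_derive_sqposB 2^-1 s.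
have d2 := is_derive_sqposB 1 s.
exact: (is_deriveD (is_deriveB (is_deriveZ 2 d0) (is_deriveZ 4 d1)) (is_deriveZ 2 d2)).
Qed.

Lemma continuous_dzeta : continuous dzeta.
Proof.
have cB (c : R) : continuous (fun s : R => 2 * Num.max 0 (s - c)).
  move=> s; apply: (@continuousM R R (fun=> 2) (fun s => Num.max 0 (s - c))); first exact: cst_continuous.
  apply: (@continuous_comp R R R (fun s => s - c) (fun s => Num.max 0 s)).
    by apply: continuousB => //; exact: cst_continuous.
  exact: continuous_max0.
have cM (k c : R) : continuous (fun s : R => k * (2 * Num.max 0 (s - c))).
  by move=> s; apply: (@continuousM R R (fun=> k) (fun s => 2 * Num.max 0 (s - c))); [exact: cst_continuous|exact: cB].
move=> s.
rewrite (_ : dzeta = fun s => 2 * (2 * Num.max 0 (s - 0)) - 4 * (2 * Num.max 0 (s - 2^-1))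
   + 2 * (2 * Num.max 0 (s - 1))); last by apply/funext => z; rewrite subr0.
exact: (continuousD (continuousB (cM 2 0 s) (cM 4 2^-1 s)) (cM 2 1 s)).
Qed.

Lemma smooth1_zeta : smooth 1 zeta.
Proof. by exists dzeta; [exact: is_derive_zeta|exact: continuous_dzeta]. Qed.

Lemma zeta_le0 s : s <= 0 -> zeta s = 0 /\ dzeta s = 0.
Proof.
move=> s0; rewrite /zeta /dzeta /sqpos !max_l; [|lra|lra|lra].
by rewrite !expr0n /=; split; lra.
Qed.

Lemma zeta_ge1 s : 1 <= s -> zeta s = 1 /\ dzeta s = 0.
Proof.
move=> s1; rewrite /zeta /dzeta /sqpos !max_r; [|lra|lra|lra].
by split; field.
Qed.

(** The slope peaks at s = 1/2 with value 2, one of the two factors of the constant 4 in the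
    boundary estimate. *)
Lemma zeta_bound s : 0 <= zeta s <= 1 /\ 0 <= dzeta s <= 2.
Proof.
have [s0|s0] := leP s 0; first by have [-> ->] := zeta_le0 s0; lra.
have [s1|s1] := leP 1 s; first by have [-> ->] := zeta_ge1 s1; lra.
rewrite /zeta /dzeta /sqpos (@max_r _ _ 0 s) ?(ltW s0)//.
rewrite (@max_l _ _ 0 (s - 1)); last lra.
have [h|h] := leP 0 (s - 2^-1).
  split; last lra.
  have : 0 <= (1 - s) ^+ 2 <= 2^-1 by nra.
  by move=> /andP[? ?]; apply/andP; split; nra.
have h' : s <= 2^-1 by lra.
by rewrite !expr0n /=; split; nra.
Qed.

End cutoff_profile.

Lemma adde_eq0_opp {R : realType} (x y : \bar R) :
  x \is a fin_num -> (x + y = 0 -> y = - x)%E.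
Proof.
case: x => // r _; case: y => //= s [] /eqP; rewrite addrC addr_eq0 => /eqP ->.
by rewrite EFinN.
Qed.

(** * The boundary estimate *)

Section boundary_estimate.
Context {R : realType} {n : nat}.
Hypothesis n0 : (0 < n)%N.
Local Notation mu := (@lebesgue_rV R n).
Local Notation B := (@uball R n).
Local Notation mB := (@measurable_uball R n).
Local Notation S := (@usphere R n).
Local Notation sigma := (@sphere_measure R n).
Local Notation e_ j := (delta_mx ord0 j : 'rV[R]_n).

(** For 0 < t < 1, equal to 1 where |x| <= t and to 0 where |x| >= 1. *)
Let eta (t : R) (x : 'rV[R]_n) : R := zeta ((1 - sqnorm x) / (1 - t ^+ 2)).

Let deta (t : R) (j : 'I_n) (x : 'rV[R]_n) : R :=
  dzeta ((1 - sqnorm x) / (1 - t ^+ 2)) * (- (2 * x ord0 j) / (1 - t ^+ 2)).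

Let Ck_eta t : Ck 1 (eta t).
Proof.
apply: (@Ck_comp _ _ 1 zeta (fun x => (1 - sqnorm x) / (1 - t ^+ 2))).
  exact: smooth1_zeta.
apply: Ck_mul; last exact: Ck_cst.
by apply: Ck_sub; [exact: Ck_cst|exact: Ck_sqnorm].
Qed.

Let is_derive_eta t j x : is_derive x (e_ j) (eta t) (deta t j x).
Proof.
apply: (@is_derive_comp _ _ zeta (fun x => (1 - sqnorm x) / (1 - t ^+ 2))).
  exact: is_derive_zeta.
have d1 := is_deriveB (is_derive_cst (1 : R) x (e_ j)) (is_derive_sqnorm x j).
apply: (is_derive_eq (is_deriveM d1 (is_derive_cst ((1 - t ^+ 2)^-1) x (e_ j)))).
by rewrite scaler0 add0r sub0r /GRing.scale /= mulrC.
Qed.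

Lemma sqnorm_lt1 x : B x -> sqnorm x < 1.
Proof. by rewrite /uball /= => x1; rewrite sqnormE expr_lt1// enorm_ge0. Qed.

Lemma sqnorm_ge1 x : ~ B x -> 1 <= sqnorm x.
Proof.
move=> /negP; rewrite /uball /= -leNgt => x1.
by rewrite sqnormE expr_ge1// enorm_ge0.
Qed.

(** The product of w and eta is C^1 and vanishes outside the ball, so its derivative has integral 0
    and the derivative passes to eta. The gradient of eta lives on the annulus, where its j-th
    component is at most 2 times 2|x_j| / (1 - t^2). *)
Let cutoff_estimate (t : R) (j : 'I_n) (w : 'rV[R]_n -> R) : 0 < t < 1 -> Ck 1 w ->
  (`| \int[mu]_(x in B) (partial j w x * eta t x)%:E | <=
   (4 / (1 - t ^+ 2))%:E * \int[mu]_(x in B `\` eball t) `|w x|%:E)%E.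
Proof.
move=> /andP[t0 t1] Cw.
have t20 : 0 < 1 - t ^+ 2 by rewrite subr_gt0 expr_lt1// ltW.
have cw := Ck_continuous Cw.
have ceta := Ck_continuous (Ck_eta t).
have Cdw := CkS_partial j Cw.
have cdeta : continuous (deta t j).
  have -> : deta t j = partial j (eta t).
    by apply/funext => x; case: (is_derive_eta t j x).
  exact: (Ck_continuous (CkS_partial j (Ck_eta t))).
pose W x := w x * eta t x.
have CW : Ck 1 W by exact: Ck_mul.
have dWE : partial j W = fun x => w x * deta t j x + eta t x * partial j w x.
  apply/funext => x.
  by case: (is_deriveM (Ck_is_derive x j Cw) (is_derive_eta t j x)).
have outB x : ~ B x -> eta t x = 0 /\ deta t j x = 0.
  move=> /sqnorm_ge1 x1; have [z0 dz0] : zeta ((1 - sqnorm x) / (1 - t ^+ 2)) = 0 /\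
      dzeta ((1 - sqnorm x) / (1 - t ^+ 2)) = 0.
    by apply: zeta_le0; rewrite pmulr_lle0 ?invr_gt0// subr_le0.
  by rewrite /eta /deta z0 dz0 mul0r.
have IW : (\int[mu]_(x in B) (partial j W x)%:E = 0)%E.
  rewrite -[RHS](@integral_partial_eq0 R n j 1 W).
  - rewrite integral_mkcond; apply: eq_integral => x _; rewrite patchE.
    case: ifPn => //; rewrite notin_setE => /outB[e0 de0].
    by rewrite dWE e0 de0 mulr0 mul0r addr0.
  - exact: Ck_continuous CW.
  - by move=> x; case: (Ck_is_derive x j CW).
  - exact: Ck_continuous (CkS_partial j CW).
  - move=> x x1; have Bx : ~ B x by move=> Bx; apply: x1; exact: uball_cube.
    by rewrite /W; have [-> _] := outB x Bx; rewrite mulr0.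
have i1 : mu.-integrable B (EFin \o (fun x => w x * deta t j x)).
  by apply: integrable_mul_continuous => //; exact: continuous_integrable_uball.
have i2 : mu.-integrable B (EFin \o (fun x => partial j w x * eta t x)).
  apply: integrable_mul_continuous => //; apply: continuous_integrable_uball.
  exact: Ck_continuous Cdw.
have : (\int[mu]_(x in B) (w x * deta t j x)%:E +
        \int[mu]_(x in B) (partial j w x * eta t x)%:E = 0)%E.
  rewrite -integralD//; last exact: mB.
  rewrite -[RHS]IW; apply: eq_integral => x _.
  by rewrite dWE EFinD [eta t x * _]mulrC.
have f1 := integrable_fin_num mB i1; have f2 := integrable_fin_num mB i2.
move=> /(adde_eq0_opp f1) ->.
rewrite abseN; apply: le_trans (le_abse_integral _ mB (measurable_int _ i1)) _.
rewrite -ge0_integralZl//; last 3 first.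
- by apply: measurableD; [exact: mB|exact: measurable_eball].
- apply: measurable_funTS; do 2 apply: measurableT_comp => //.
  exact: continuous_measurable_rV.
- by rewrite lee_fin divr_ge0// ltW.
rewrite setDE integral_mkcondr; apply: ge0_le_integral => //.
- exact: mB.
- by apply: measurableT_comp => //; exact: measurable_int i1.
- apply/(measurable_restrict _ _ _).1; [exact: measurableC (measurable_eball _)|exact: mB|].
  apply: measurable_funTS; apply: measurable_funeM; do 2 apply: measurableT_comp => //.
  exact: continuous_measurable_rV.
- move=> x Bx; rewrite patchE; case: ifPn => [_|].
    rewrite /= -EFinM lee_fin normrM mulrC ler_wpM2r//.
    rewrite /deta normrM normrM normrN normrM normfV.
    have := (zeta_bound ((1 - sqnorm x) / (1 - t ^+ 2))).2 => /andP[dz0 dz2].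
    rewrite (ger0_norm dz0) [`|2|]ger0_norm// (gtr0_norm t20) mulrA ler_wpM2r ?invr_ge0 ?(ltW t20)//.
    have xj : `|x ord0 j| <= 1 by exact: le_trans (le_coor_enorm x j) (ltW (Bx : enorm x < 1)).
    by have := normr_ge0 (x ord0 j); nra.
  rewrite notin_setE => /contrapT xt.
  have [_ dz] : zeta ((1 - sqnorm x) / (1 - t ^+ 2)) = 1 /\
      dzeta ((1 - sqnorm x) / (1 - t ^+ 2)) = 0.
    apply: zeta_ge1; rewrite ler_pdivlMr// mul1r lerD2l lerN2 sqnormE.
    by rewrite ler_sqr ?nnegrE ?enorm_ge0 ?(ltW t0)// ltW.
  by rewrite /= /deta dz mul0r mulr0 normr0.
Qed.

(** Together with 1 - t <= 1 - t^2, this makes (1 - t^n) / (1 - t^2) at most n, so the thinness of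
    the annulus compensates the steepness of the cutoff. *)
Let onem_expr_le (t : R) k : 0 <= t <= 1 -> 1 - t ^+ k <= k%:R * (1 - t).
Proof.
move=> /andP[t0 t1]; elim: k => [|k IH]; first by rewrite expr0 subrr mul0r.
have tk : t ^+ k <= 1 by rewrite exprn_ile1.
have tk0 : 0 <= t ^+ k by rewrite exprn_ge0.
by rewrite exprSr -natr1; nra.
Qed.

(** The shift by 2 keeps the radius strictly between 0 and 1. *)
Let tk (k : nat) : R := 1 - k.+2%:R^-1.

Let tk01 k : 0 < tk k < 1.
Proof.
rewrite /tk subr_gt0 invf_lt1 ?ltr0n// ltr1n /=.
by rewrite gtrBl invr_gt0 ltr0n.
Qed.

Let tk_cvg : tk k @[k --> \oo] --> (1 : R).
Proof.
rewrite -[X in _ --> X](subr0 1); apply: cvgB; first exact: cvg_cst.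
by have := @cvg_harmonic R; rewrite -(cvg_shiftS (@harmonic R)).
Qed.

(** First t -> 1 for a fixed error e of the annulus estimate, then e -> 0. The factor n of
    [onem_expr_le] is absorbed by the one in the cone measure, leaving the constant 4. *)
Lemma boundary_estimate (j : 'I_n) (w : 'rV[R]_n -> R) : Ck 1 w ->
  (`| \int[mu]_(x in B) (partial j w x)%:E | <=
   4%:E * \int[sigma]_(x in S) `|w x|%:E)%E.
Proof.
move=> Cw; have cw := Ck_continuous Cw.
have mw := continuous_measurable_rV cw.
have cdw := Ck_continuous (CkS_partial j Cw).
have mwr : measurable_fun setT (fun x => `|w (radial x)|%:E).
  apply/measurable_EFinP; apply: measurableT_comp => //; apply: (measurableT_comp mw).
  exact: measurable_radial.
pose H (e : R) := (\int[mu]_(x in B) (`|w (radial x)| + e)%:E)%E.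
have He (e : R) : 0 < e -> (`| \int[mu]_(x in B) (partial j w x)%:E | <= (4 * n%:R)%:E * H e)%E.
  move=> e0.
  have H0 : (0 <= H e)%E.
    by apply: integral_ge0 => x _; rewrite lee_fin addr_ge0// ltW.
  have cvgI : (\int[mu]_(x in B) (partial j w x * eta (tk k) x)%:E)%E @[k --> \oo] -->
      (\int[mu]_(x in B) (partial j w x)%:E)%E.
    apply: (@dominated_cvg_uball R n _ _ (fun x => `|partial j w x|)).
    - move=> k; apply: measurable_funTS; apply: continuous_measurable_rV => x.
      by apply: continuousM; [exact: cdw|exact: (Ck_continuous (Ck_eta _))].
    (* Once 1 - t^2 < 1 - |x|^2 the cutoff equals 1 at x, so the sequence is eventually constant. *)
    - move=> x Bx; apply: cvg_near_cst.
      have x1 := sqnorm_lt1 Bx.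
      have : \forall t \near (1 : R), 1 - t ^+ 2 < 1 - sqnorm x.
        have : {for (1 : R), continuous (fun t : R => 1 - t ^+ 2)}.
          apply: continuousB; [exact: cst_continuous|exact: exprn_continuous].
        by move=> /(_ [set z | z < 1 - sqnorm x]); apply; apply: lt_nbhsl; rewrite expr1n subrr subr_gt0.
      move=> /tk_cvg near_k.
      have {}near_k : \forall k \near \oo, 1 - tk k ^+ 2 < 1 - sqnorm x by exact: near_k.
      apply: filterS near_k => k kx.
      have /andP[t0 t1] := tk01 k.
      have t20 : 0 < 1 - tk k ^+ 2 by rewrite subr_gt0 expr_lt1// ltW.
      have [z1 _] : zeta ((1 - sqnorm x) / (1 - tk k ^+ 2)) = 1 /\
          dzeta ((1 - sqnorm x) / (1 - tk k ^+ 2)) = 0.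
        by apply: zeta_ge1; rewrite ler_pdivlMr// mul1r ltW.
      by rewrite /eta z1 mulr1.
    - by apply: integrable_norm; exact: continuous_integrable_uball.
    - move=> k x Bx; rewrite normrM ler_piMr//.
      by have [/andP[z0 z1] _] := zeta_bound ((1 - sqnorm x) / (1 - tk k ^+ 2)); rewrite ger0_norm.
  have cvgN : `|\int[mu]_(x in B) (partial j w x * eta (tk k) x)%:E|%E @[k --> \oo] -->
      `|\int[mu]_(x in B) (partial j w x)%:E|%E by exact: cvg_abse.
  rewrite -(cvg_lim _ cvgN)//; apply: lime_le; first by apply/cvg_ex; eexists; exact: cvgN.
  have /tk_cvg near_k := integral_annulus cw e0.
  have {}near_k : \forall k \near \oo, 0 < tk k < 1 ->
      (\int[mu]_(x in B `\` eball (tk k)) `|w x|%:E <= (1 - tk k ^+ n)%:E * H e)%E.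
    exact: near_k.
  apply: filterS near_k => k kA.
  have t01 := tk01 k; have /andP[t0 t1] := t01.
  have t20 : 0 < 1 - tk k ^+ 2 by rewrite subr_gt0 expr_lt1// ltW.
  apply: le_trans (cutoff_estimate j t01 Cw) _.
  apply: (@le_trans _ _ ((4 / (1 - tk k ^+ 2))%:E * ((1 - tk k ^+ n)%:E * H e))%E).
    by rewrite lee_wpmul2l ?kA// lee_fin divr_ge0// ltW.
  rewrite muleA -EFinM lee_wpmul2r// lee_fin -mulrA ler_pM2l//.
  rewrite mulrC ler_pdivrMr//.
  have := @onem_expr_le (tk k) n; rewrite (ltW t0) (ltW t1) => /(_ isT) h.
  by apply: le_trans h _; rewrite ler_wpM2l//; nra.
rewrite (ge0_integral_sphere n0 (h := fun x => `|w x|))//; last exact: measurableT_comp.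
set A := (\int[mu]_(x in B) `|w (radial x)|%:E)%E in He *.
have HE e : 0 < e -> (H e = A + e%:E * mu B)%E.
  move=> e0; rewrite /H; under eq_integral do rewrite EFinD.
  rewrite ge0_integralD//.
  - by rewrite integral_cst//; exact: mB.
  - exact: mB.
  - exact: (measurable_funTS mwr).
  - by move=> x _; rewrite lee_fin ltW.
have Bfin := @uball_fin_num R n.
apply/lee_addgt0Pr => e e0.
(* Chosen so that 4 n d |B| <= e; the added 1 keeps the denominator positive. *)
pose d := e / (4 * n%:R * (fine (mu B) + 1)).
have n0' : 0 < n%:R :> R by rewrite ltr0n.
have fB : 0 <= fine (mu B) by rewrite fine_ge0.
have d0 : 0 < d by rewrite divr_gt0// !mulr_gt0// ltr_wpDl.
apply: le_trans (He d d0) _; rewrite HE// muleDr//; last first.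
  by rewrite fin_num_adde_defl// fin_numM.
rewrite [X in (_ <= X + _)%E]muleA -EFinM; apply: leeD2l.
rewrite -(fineK Bfin) -!EFinM lee_fin.
have -> : 4 * n%:R * (d * fine (mu B)) = e * (fine (mu B) / (fine (mu B) + 1)).
  have nn : n%:R != 0 :> R by rewrite gt_eqF.
  have m1 : fine (mu B) + 1 != 0 by rewrite gt_eqF// ltr_wpDl.
  by rewrite /d; field; rewrite m1 nn.
apply: ler_piMr; first exact: ltW.
by rewrite ler_pdivrMr ?mul1r ?lerDl// ltr_wpDl.
Qed.

End boundary_estimate.

(** * Weak derivatives and traces *)

Section weak_derivatives.
Context {R : realType} {n : nat}.
Hypothesis n0 : (0 < n)%N.
Local Notation mu := (@lebesgue_rV R n).
Local Notation B := (@uball R n).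
Local Notation mB := (@measurable_uball R n).
Local Notation S := (@usphere R n).
Local Notation sigma := (@sphere_measure R n).
Local Notation e_ j := (delta_mx ord0 j : 'rV[R]_n).

Definition L1cvg (w : ('rV[R]_n -> R)^nat) (v : 'rV[R]_n -> R) : Prop :=
  (fun k => \int[mu]_(x in B) `|w k x - v x|%:E)%E @ \oo --> 0%E.

Lemma L1cvg_integral_mul (w : ('rV[R]_n -> R)^nat) (v phi : 'rV[R]_n -> R) (C : R) :
  (forall k, L1ball (w k)) -> L1ball v -> measurable_fun B phi ->
  (forall x, B x -> `|phi x| <= C) -> L1cvg w v ->
  (\int[mu]_(x in B) (w k x * phi x)%:E)%E @[k --> \oo] -->
  (\int[mu]_(x in B) (v x * phi x)%:E)%E.
Proof.
move=> iw iv mphi phiC wv.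
have iwp k := integrable_mul_bounded (iw k) mphi phiC.
have ivp := integrable_mul_bounded iv mphi phiC.
have fv := integrable_fin_num mB ivp.
suff : (`|\int[mu]_(x in B) (w k x * phi x)%:E - \int[mu]_(x in B) (v x * phi x)%:E|%E)
    @[k --> \oo] --> 0%E.
  by move/cvg_abse0P/sube_cvg0; apply.
have wv0 : (`|C|%:E * \int[mu]_(x in B) `|w k x - v x|%:E)%E @[k --> \oo] --> 0%E.
  by rewrite -(mule0 `|C|%:E); apply: cvgeZl.
apply: (squeeze_cvge _ (cvg_cst _) wv0).
apply: nearW => k; rewrite abse_ge0 /= -integralB; [|exact: mB|exact: iwp|exact: ivp].
have imk : mu.-integrable B (EFin \o (fun x => w k x - v x)).
  exact: (integrableB mB (iw k) iv).
have mk : measurable_fun B (fun x => w k x - v x) by apply/measurable_EFinP; exact: (measurable_int _ imk).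
apply: (le_trans (le_abse_integral _ mB _)).
  exact: (measurable_int _ (integrableB mB (iwp k) ivp)).
rewrite -ge0_integralZl//; last 2 first.
- exact: mB.
- by apply/measurable_EFinP; exact: measurableT_comp.
apply: ge0_le_integral => //.
- exact: mB.
- apply: measurableT_comp => //.
  exact: (measurable_int _ (integrableB mB (iwp k) ivp)).
- by apply: measurable_funeM; apply/measurable_EFinP; exact: measurableT_comp.
- move=> x Bx /=; rewrite -EFinM lee_fin -mulrBl normrM mulrC.
  by rewrite ler_wpM2r// (le_trans (phiC x Bx))// ler_norm.
Qed.

Lemma Ck_L1ball k (w : 'rV[R]_n -> R) : Ck k w -> L1ball w.
Proof. by move=> /Ck_continuous; exact: continuous_integrable_uball. Qed.

Lemma partial_mul (w psi : 'rV[R]_n -> R) (j : 'I_n) : Ck 1 w -> Ck 1 psi ->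
  partial j (fun x => w x * psi x) =
  (fun x => w x * partial j psi x + psi x * partial j w x).
Proof.
move=> Cw Cpsi; apply/funext => x.
by case: (is_deriveM (Ck_is_derive x j Cw) (Ck_is_derive x j Cpsi)).
Qed.

Lemma integral_partial_mul (w psi : 'rV[R]_n -> R) (j : 'I_n) : Ck 1 w -> Ck 1 psi ->
  (\int[mu]_(x in B) (partial j (fun x => w x * psi x) x)%:E =
   \int[mu]_(x in B) (w x * partial j psi x)%:E +
   \int[mu]_(x in B) (partial j w x * psi x)%:E)%E.
Proof.
move=> Cw Cpsi; rewrite partial_mul//.
rewrite -integralD//; last 3 first.
- exact: mB.
- by apply: integrable_mul_continuous; [exact: Ck_L1ball Cw|exact: Ck_continuous (CkS_partial j Cpsi)].
- by apply: integrable_mul_continuous; [exact: Ck_L1ball (CkS_partial j Cw)|exact: Ck_continuous Cpsi].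
by apply: eq_integral => x _; rewrite EFinD [psi x * _]mulrC.
Qed.

Section approximation.
Variables (w : ('rV[R]_n -> R)^nat) (v g : 'rV[R]_n -> R) (j : 'I_n).
Hypotheses (Cw : forall k, Ck 1 (w k)) (iv : L1ball v) (ig : L1ball g).
Hypotheses (wv : L1cvg w v) (wg : L1cvg (fun k => partial j (w k)) g).

(** The left side is controlled by the boundary estimate and tends to 0 in two cases: psi is 0 on
    the sphere, or w_k tends to 0 there. These cases yield [is_weak_partial_approx] and
    [zero_trace_ibp]. *)
Lemma cvg_integral_partial_mul psi : Ck 1 psi ->
  (\int[mu]_(x in B) (partial j (fun x => w k x * psi x) x)%:E)%E @[k --> \oo] -->
  (\int[mu]_(x in B) (v x * partial j psi x)%:E + \int[mu]_(x in B) (g x * psi x)%:E)%E.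
Proof.
move=> Cpsi.
have cpsi := Ck_continuous Cpsi; have cdpsi := Ck_continuous (CkS_partial j Cpsi).
under eq_fun do rewrite (integral_partial_mul j (Cw _) Cpsi).
have [C hC] := continuous_uball_bounded cpsi.
have [D hD] := continuous_uball_bounded cdpsi.
apply: cvgeD.
- apply: fin_num_adde_defr; apply: integrable_fin_num; first exact: mB.
  exact: integrable_mul_continuous.
- apply: (L1cvg_integral_mul _ _ _ hD) => //; first by move=> k; exact: Ck_L1ball (Cw k).
  by apply: measurable_funTS; exact: continuous_measurable_rV.
- apply: (L1cvg_integral_mul _ _ _ hC) => //.
    by move=> k; exact: Ck_L1ball (CkS_partial j (Cw k)).
  by apply: measurable_funTS; exact: continuous_measurable_rV.
Qed.

Lemma test_function_sphere phi : test_function phi -> forall x, S x -> phi x = 0.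
Proof.
by move=> [_ [rho rho1 rho0]] x; rewrite /usphere /= => x1; apply: rho0; rewrite x1 ltW.
Qed.

Lemma integral_partial_sphere0 (phi : 'rV[R]_n -> R) : Ck 1 phi ->
  (forall x, S x -> phi x = 0) -> (\int[mu]_(x in B) (partial j phi x)%:E = 0)%E.
Proof.
move=> Cphi phi0; apply/eqP; rewrite -abse_eq0 eq_le abse_ge0 andbT.
apply: (le_trans (boundary_estimate n0 j Cphi)).
by rewrite integral0_eq ?mule0// => x Sx; rewrite phi0// normr0.
Qed.

(** Produces a weak derivative from C^1 approximation alone; applied to truncated squares and to the
    radial map. *)
Lemma is_weak_partial_approx : is_weak_partial j v g.
Proof.
move=> phi tphi; have Cphi := tphi.1 1%N.
have vphi : mu.-integrable B (EFin \o (fun x => g x * phi x)).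
  by apply: integrable_mul_continuous => //; exact: Ck_continuous Cphi.
have := cvg_integral_partial_mul Cphi.
rewrite (_ : (fun k => _) = cst 0%E); last first.
  apply/funext => k; apply: integral_partial_sphere0; first exact: Ck_mul.
  by move=> x Sx; rewrite (test_function_sphere tphi)// mulr0.
move=> /(cvg_unique _ (cvg_cst _)) /= => /(_ (@ereal_hausdorff R)) /esym.
rewrite addeC => /(adde_eq0_opp (integrable_fin_num mB vphi)) ->//.
Qed.

(** Here psi need not vanish on the sphere: the boundary estimate bounds the integral of the
    derivative of w_k psi by 4 sup |psi| times the L^1 norm of w_k on the sphere. *)
Lemma zero_trace_ibp psi : Ck 1 psi ->
  (\int[sigma]_(x in S) `|w k x|%:E)%E @[k --> \oo] --> 0%E ->
  (\int[mu]_(x in B) (v x * partial j psi x)%:E + \int[mu]_(x in B) (g x * psi x)%:E = 0)%E.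
Proof.
move=> Cpsi w0; have cpsi := Ck_continuous Cpsi.
have [C hC] := continuous_cube_bounded 1 cpsi.
have CS x : S x -> `|psi x| <= `|C|.
  move=> Sx; apply: le_trans (hC x _) (ler_norm _) => i.
  by rewrite (le_trans (le_coor_enorm _ _))// Sx.
have lim0 : (\int[mu]_(x in B) (partial j (fun x => w k x * psi x) x)%:E)%E @[k --> \oo] --> 0%E.
  apply/cvg_abse0P.
  have b0 : ((4 * `|C|)%:E * \int[sigma]_(x in S) `|w k x|%:E)%E @[k --> \oo] --> 0%E.
    by rewrite -(mule0 (4 * `|C|)%:E); apply: cvgeZl.
  apply: (squeeze_cvge _ (cvg_cst _) b0).
  apply: nearW => k; rewrite abse_ge0 /=.
  apply: (le_trans (boundary_estimate n0 j (Ck_mul (Cw k) Cpsi))).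
  rewrite EFinM -muleA lee_pmul2l// -ge0_integralZl//; last 2 first.
  - exact: measurable_usphere.
  - apply: measurable_funTS; apply/measurable_EFinP; apply: measurableT_comp => //.
    exact: continuous_measurable_rV (Ck_continuous (Cw k)).
  apply: ge0_le_integral => //.
  - exact: measurable_usphere.
  - apply: measurable_funTS; apply/measurable_EFinP; apply: measurableT_comp => //.
    exact: continuous_measurable_rV (Ck_continuous (Ck_mul (Cw k) Cpsi)).
  - apply: measurable_funTS; apply: measurable_funeM; apply/measurable_EFinP; apply: measurableT_comp => //.
    exact: continuous_measurable_rV (Ck_continuous (Cw k)).
  - by move=> x Sx; rewrite -EFinM lee_fin normrM mulrC ler_wpM2r// CS.
exact: (cvg_unique (@ereal_hausdorff R) (cvg_integral_partial_mul Cpsi) lim0).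
Qed.

End approximation.

(** The difference g - h annihilates every test function. Since [weak_partial] is a choice, explicit
    gradients are compared with it through this lemma. *)
Lemma weak_partial_unique (j : 'I_n) (v g h : 'rV[R]_n -> R) : L1ball g -> L1ball h ->
  is_weak_partial j v g -> is_weak_partial j v h ->
  {ae mu, forall x, B x -> g x = h x}.
Proof.
move=> ig ih wg wh.
have igh : L1ball (fun x => g x - h x).
  exact: (integrableB mB ig ih).
have := fundamental_lemma igh.
move=> H; have : {ae mu, forall x, B x -> g x - h x = 0}; last first.
  by apply: filterS => x /[apply] /eqP; rewrite subr_eq0 => /eqP.
apply: H => phi tphi; have cphi := Ck_continuous (tphi.1 0%N).
have igp := integrable_mul_continuous ig cphi.
have ihp := integrable_mul_continuous ih cphi.
rewrite (_ : (fun x => _) = (EFin \o (fun x => g x * phi x)%R) \- (EFin \o (fun x => h x * phi x)%R))%E; last first.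
  by apply/funext => x /=; rewrite mulrBl EFinB.
rewrite integralB; [|exact: mB|exact: igp|exact: ihp].
have := wg _ tphi; rewrite (wh _ tphi) => /eqe_oppP ->.
by rewrite subee// (integrable_fin_num mB igp).
Qed.

Lemma weak_partialP (j : 'I_n) (v : 'rV[R]_n -> R) : W11 v ->
  L1ball (weak_partial j v) /\ is_weak_partial j v (weak_partial j v).
Proof.
move=> [_ /(_ j)[g ig wg]].
exact: (@xgetPex _ (fun=> 0) [set g | L1ball g /\ is_weak_partial j v g]
  (ex_intro _ g (conj ig wg))).
Qed.

End weak_derivatives.

(** * Sphere-valued maps *)

Section truncated_square.
Context {R : realType}.

(* A globally Lipschitz C^1 function that agrees with the square on [-1, 1]. *)
Definition tsq (s : R) : R := s ^+ 2 - sqpos (s - 1) - sqpos (- s - 1).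

Definition dtsq (s : R) : R :=
  2 * s - 2 * Num.max 0 (s - 1) + 2 * Num.max 0 (- s - 1).

Lemma is_derive_tsq (s : R) : is_derive s 1 tsq (dtsq s).
Proof.
have d1 : is_derive s 1 (fun s : R => s * s) (2 * s).
  by apply: is_derive_eq; rewrite scaler1 -mulr2n mulr_natl.
have d2 := is_derive_sqposB 1 s.
have d3 : is_derive s 1 (fun s => sqpos (- s - 1)) (2 * Num.max 0 (- s - 1) * -1).
  apply: (@is_derive_comp _ _ sqpos (fun s : R => - s - 1)); first exact: is_derive_sqpos.
  by apply: is_derive_eq; rewrite subr0.
rewrite (_ : tsq = (fun s => s * s - sqpos (s - 1) - sqpos (- s - 1))); last first.
  by apply/funext => z; rewrite /tsq expr2.
apply: (is_derive_eq (is_deriveB (is_deriveB d1 d2) d3)).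
by rewrite /dtsq; ring.
Qed.

Lemma continuous_dtsq : continuous dtsq.
Proof.
have c1 (s : R) : {for s, continuous (fun s : R => 2 * s)}.
  exact: mulrl_continuous.
have c2 (s : R) : {for s, continuous (fun s : R => 2 * Num.max 0 (s - 1))}.
  apply: (@continuousM R R (fun=> 2) (fun s => Num.max 0 (s - 1))); first exact: cst_continuous.
  apply: (@continuous_comp R R R (fun s => s - 1) (fun s => Num.max 0 s)).
    by apply: continuousB => //; exact: cst_continuous.
  exact: continuous_max0.
have c3 (s : R) : {for s, continuous (fun s : R => 2 * Num.max 0 (- s - 1))}.
  apply: (@continuousM R R (fun=> 2) (fun s => Num.max 0 (- s - 1))); first exact: cst_continuous.
  apply: (@continuous_comp R R R (fun s => - s - 1) (fun s => Num.max 0 s)).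
    by apply: continuousB; [exact: opp_continuous|exact: cst_continuous].
  exact: continuous_max0.
move=> s; exact: (continuousD (continuousB (c1 s) (c2 s)) (c3 s)).
Qed.

Lemma smooth1_tsq : smooth 1 tsq.
Proof. by exists dtsq; [exact: is_derive_tsq|exact: continuous_dtsq]. Qed.

Lemma tsqE s : `|s| <= 1 -> tsq s = s ^+ 2 /\ dtsq s = 2 * s.
Proof.
rewrite ler_norml => /andP[s1 s2].
by rewrite /tsq /dtsq /sqpos !max_l; [rewrite !expr0n /=; split; ring|lra|lra].
Qed.

(** The three pieces of the spline, with which each Lipschitz bound splits into nine polynomial
    cases. *)
Let clampP s : [\/ [/\ s <= -1, tsq s = - 2 * s - 1 & dtsq s = - 2],
  [/\ -1 <= s, s <= 1, tsq s = s ^+ 2 & dtsq s = 2 * s] |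
  [/\ 1 <= s, tsq s = 2 * s - 1 & dtsq s = 2]].
Proof.
have [s1|s1] := leP s (-1).
  apply: Or31; rewrite /tsq /dtsq /sqpos (@max_l _ _ 0 (s - 1)); last lra.
  by rewrite max_r; [rewrite expr0n /=; split => //; ring|lra].
have [s2|s2] := leP s 1.
  have [] := @tsqE s; first by rewrite ler_norml (ltW s1).
  by move=> -> ->; apply: Or32; split => //; exact: ltW.
apply: Or33; rewrite /tsq /dtsq /sqpos (@max_r _ _ 0 (s - 1)); last lra.
by rewrite max_l; [rewrite expr0n /=; split; [exact: ltW|ring|ring]|lra].
Qed.

Lemma tsq_lipschitz a b : `|tsq a - tsq b| <= 2 * `|a - b|.
Proof.
wlog ab : a b / b <= a.
  by move=> H; have [/H//|/ltW/H] := leP b a; rewrite (distrC (tsq b)) (distrC b).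
rewrite (@ger0_norm _ (a - b)) ?subr_ge0// ler_norml.
by case: (clampP a) => [[? -> _]|[? ? -> _]|[? -> _]];
  case: (clampP b) => [[? -> _]|[? ? -> _]|[? -> _]]; apply/andP; split; nra.
Qed.

Lemma dtsq_lipschitz a b : `|dtsq a - dtsq b| <= 2 * `|a - b|.
Proof.
wlog ab : a b / b <= a.
  by move=> H; have [/H//|/ltW/H] := leP b a; rewrite (distrC (dtsq b)) (distrC b).
rewrite (@ger0_norm _ (a - b)) ?subr_ge0// ler_norml.
by case: (clampP a) => [[? _ ->]|[? ? _ ->]|[? _ ->]];
  case: (clampP b) => [[? _ ->]|[? ? _ ->]|[? _ ->]]; apply/andP; split; nra.
Qed.

Lemma dtsq_le2 a : `|dtsq a| <= 2.
Proof.
rewrite ler_norml.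
by case: (clampP a) => [[? _ ->]|[? ? _ ->]|[? _ ->]]; apply/andP; split; lra.
Qed.

End truncated_square.

Section nneg_cvge0.
Context {R : realType}.
Local Open Scope ereal_scope.

Lemma nneg_cvge0 (u : (\bar R)^nat) : (forall k, 0 <= u k) ->
  (forall e : R, (0 < e)%R -> \forall k \near \oo, u k <= e%:E) -> u @ \oo --> 0.
Proof.
move=> u0 ue; apply/fine_cvgP; split.
  apply: filterS (ue 1%R ltr01) => k uk.
  by rewrite ge0_fin_numE// (le_lt_trans uk)// ltry.
apply/cvgr0Pnorm_le => e e0; apply: filterS (ue e e0) => k uk /=.
have uf : u k \is a fin_num by rewrite ge0_fin_numE// (le_lt_trans uk)// ltry.
by rewrite ger0_norm ?fine_ge0// -lee_fin fineK.
Qed.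

Lemma cvge0_near_le (u : (\bar R)^nat) (e : R) : u @ \oo --> 0 -> (0 < e)%R ->
  \forall k \near \oo, u k <= e%:E.
Proof.
move=> /fine_cvgP[ufin /cvgr0_norm_le /= ue] e0; have {}ue := ue e e0.
near=> k; have kf : u k \is a fin_num by near: k.
rewrite -(fineK kf) lee_fin (le_trans (ler_norm _))//.
by near: k.
Unshelve. all: by end_near. Qed.

End nneg_cvge0.

(** * Chain rule for the truncated square *)

Section chain_rule_W11.
Context {R : realType} {n : nat}.
Hypothesis n0 : (0 < n)%N.
Local Notation mu := (@lebesgue_rV R n).
Local Notation B := (@uball R n).
Local Notation mB := (@measurable_uball R n).

Lemma L1ball_measurable (g : 'rV[R]_n -> R) : L1ball g -> measurable_fun B g.
Proof. by move=> ig; apply/measurable_EFinP; exact: measurable_int ig. Qed.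

Lemma integral_tail (g : 'rV[R]_n -> R) : L1ball g ->
  (\int[mu]_(x in B) (if (`|g x| <= k%:R)%R then 0 else `|g x|)%:E)%E @[k --> \oo] --> 0%E.
Proof.
move=> ig; have mg := L1ball_measurable ig.
rewrite -[X in _ --> X](@integral0 _ _ R mu B).
apply: (@dominated_cvg_uball R n _ (fun=> 0) (fun x => `|g x|)).
- move=> k; apply: measurable_fun_if => //.
  + exact: mB.
  + by apply: measurable_fun_ler => //; exact: measurableT_comp.
  + by apply: measurable_funS (measurableT_comp _ mg) => //; exact: mB.
- move=> x Bx; apply: cvg_near_cst.
  near=> k; rewrite ifT//; near: k.
  exists (Num.truncn `|g x|).+1 => // k /= xk.
  by rewrite (le_trans (ltW (truncnS_gt _)))// ler_nat.
- exact: integrable_norm.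
- by move=> k x Bx; case: ifPn; rewrite ?normr0 ?normr_id.
Unshelve. all: by end_near. Qed.

(* Splitting at the level |g| = M. *)
Lemma L1_mul_bounded_cvg0 (d : ('rV[R]_n -> R)^nat) (h : ('rV[R]_n -> R)^nat)
    (g : 'rV[R]_n -> R) (C : R) :
  L1ball g -> (forall k, measurable_fun B (h k)) ->
  (forall k, measurable_fun B (d k)) ->
  (forall k x, B x -> `|h k x| <= C) -> (forall k x, B x -> `|h k x| <= d k x) ->
  (\int[mu]_(x in B) (d k x)%:E)%E @[k --> \oo] --> 0%E ->
  (\int[mu]_(x in B) `|h k x * g x|%:E)%E @[k --> \oo] --> 0%E.
Proof.
move=> ig mh md hC hd d0; have mg := L1ball_measurable ig.
pose tail k x := if `|g x| <= k%:R then 0 else `|g x|.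
have tail_ge0 k x : 0 <= tail k x by rewrite /tail; case: ifP.
have mtail k : measurable_fun B (tail k).
  apply: measurable_fun_if => //.
  + exact: mB.
  + by apply: measurable_fun_ler => //; exact: measurableT_comp.
  + by apply: measurable_funS (measurableT_comp _ mg) => //; exact: mB.
have d_ge0 k x : B x -> 0 <= d k x by move=> Bx; exact: le_trans (hd k x Bx).
have bound M k : (\int[mu]_(x in B) `|h k x * g x|%:E <=
    M%:R%:E * \int[mu]_(x in B) (d k x)%:E + `|C|%:E * \int[mu]_(x in B) (tail M x)%:E)%E.
  rewrite -!ge0_integralZl//; last 6 first.
  - exact: mB.
  - exact/measurable_EFinP.
  - by move=> x _; rewrite lee_fin.
  - exact: mB.
  - exact/measurable_EFinP.
  - by move=> x Bx; rewrite lee_fin d_ge0.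
  rewrite -ge0_integralD//; last 5 first.
  - exact: mB.
  - by move=> x Bx; rewrite mule_ge0// lee_fin d_ge0.
  - by apply: measurable_funeM; exact/measurable_EFinP.
  - by move=> x Bx; rewrite mule_ge0// lee_fin.
  - by apply: measurable_funeM; exact/measurable_EFinP.
  apply: ge0_le_integral => //.
  - exact: mB.
  - by apply/measurable_EFinP; apply: measurableT_comp => //; exact: measurable_funM.
  - by apply: emeasurable_funD; apply: measurable_funeM; exact/measurable_EFinP.
  - move=> x Bx; rewrite -!EFinM -EFinD lee_fin normrM /tail.
    have := hC k x Bx; have := hd k x Bx; have := ler_norm C.
    have := normr_ge0 (h k x); have := normr_ge0 (g x).
    by case: ifPn => [gM|_] *; rewrite ?mulr0 ?addr0; first nra;
      rewrite ler_wpDl ?mulr_ge0 ?d_ge0//; nra.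
apply: nneg_cvge0 => [k|e e0]; first exact: integral_ge0.
(* The level M is fixed first, making the tail term at most e / 2; k is then taken large depending
   on M. *)
pose e1 := e / 2 / (`|C| + 1).
have C1 : 0 < `|C| + 1 by rewrite ltr_wpDl.
have e10 : 0 < e1 by rewrite !divr_gt0.
have [M _ /(_ _ (leqnn M)) /= tM] := cvge0_near_le (integral_tail ig) e10.
pose e2 := e / 2 / (M%:R + 1).
have M1 : 0 < M%:R + 1 :> R by rewrite ltr_wpDl.
have e20 : 0 < e2 by rewrite !divr_gt0.
apply: filterS (cvge0_near_le d0 e20) => k dk.
apply: le_trans (bound M k) _.
have -> : e = e / 2 + e / 2 by rewrite -splitr.
rewrite EFinD; apply: leeD.
  apply: (@le_trans _ _ (M%:R%:E * e2%:E)%E); first by rewrite lee_wpmul2l// lee_fin.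
  rewrite -EFinM lee_fin /e2 mulrCA ler_piMr ?divr_ge0 ?(ltW e0)//.
  by rewrite ler_pdivrMr// mul1r lerDl.
apply: (@le_trans _ _ (`|C|%:E * e1%:E)%E); first by rewrite lee_wpmul2l// lee_fin.
rewrite -EFinM lee_fin /e1 mulrCA ler_piMr ?divr_ge0 ?(ltW e0)//.
by rewrite ler_pdivrMr// mul1r lerDl.
Qed.

Lemma Ck_measurable k (w : 'rV[R]_n -> R) (A : set 'rV[R]_n) : Ck k w -> measurable_fun A w.
Proof.
by move=> Cw; apply: measurable_funTS; exact: continuous_measurable_rV (Ck_continuous Cw).
Qed.

Lemma L1ball_tsq (v : 'rV[R]_n -> R) : L1ball v -> L1ball (tsq \o v).
Proof.
move=> iv; apply: (@le_integrable _ _ _ mu B mB _ (EFin \o (fun x => 2 * `|v x|))).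
- apply/measurable_EFinP; apply: measurableT_comp; last exact: L1ball_measurable.
  by apply: continuous_measurable_fun; exact: (smooth_continuous smooth1_tsq).
- move=> x Bx /=; rewrite lee_fin [leRHS]ger0_norm ?mulr_ge0//.
  have t0 : tsq (0 : R) = 0 by have [] := @tsqE R 0; rewrite ?normr0// expr0n.
  by have := tsq_lipschitz (v x) 0; rewrite t0 !subr0.
- rewrite (_ : EFin \o _ = (fun x => 2%:E * (EFin \o (Num.norm \o v)) x)%E) //.
  by apply: integrableZl => //; [exact: mB|exact: integrable_norm].
Qed.

Lemma L1ball_dtsq_mul (v g : 'rV[R]_n -> R) : L1ball v -> L1ball g ->
  L1ball (fun x => g x * dtsq (v x)).
Proof.
move=> iv ig; apply: (integrable_mul_bounded (C := 2) ig).
- apply: measurableT_comp; last exact: L1ball_measurable.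
  by apply: continuous_measurable_fun; exact: continuous_dtsq.
- by move=> x _; exact: dtsq_le2.
Qed.

(** The derivatives of tsq (w_k) differ from the limit by dtsq (w_k) (d_j w_k - g) and (dtsq (w_k) -
    dtsq (v)) g. The first is at most twice an L^1 error. The second has no rate, g being merely
    integrable, and needs both the boundedness and the Lipschitz property of [dtsq]. *)
Lemma is_weak_partial_tsq (w : ('rV[R]_n -> R)^nat) (v g : 'rV[R]_n -> R) (j : 'I_n) :
  (forall k, Ck 1 (w k)) -> L1ball v -> L1ball g -> L1cvg w v ->
  L1cvg (fun k => partial j (w k)) g ->
  is_weak_partial j (tsq \o v) (fun x => g x * dtsq (v x)).
Proof.
move=> Cw iv ig wv wg.
have mv := L1ball_measurable iv; have mg := L1ball_measurable ig.
have mdv : measurable_fun B (fun x => dtsq (v x)).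
  by apply: measurableT_comp => //; apply: continuous_measurable_fun; exact: continuous_dtsq.
have mw k : measurable_fun B (w k) by exact: Ck_measurable.
have mdw k : measurable_fun B (partial j (w k)) by exact: Ck_measurable (CkS_partial j (Cw k)).
have mdtw k : measurable_fun B (fun x => dtsq (w k x)).
  by apply: measurableT_comp => //; apply: continuous_measurable_fun; exact: continuous_dtsq.
have Ctw k : Ck 1 (tsq \o w k) by apply: Ck_comp => //; exact: smooth1_tsq.
have mtv : measurable_fun B (tsq \o v) := L1ball_measurable (L1ball_tsq iv).
have mtw k : measurable_fun B (tsq \o w k) by exact: Ck_measurable.
have dtwE k : partial j (tsq \o w k) = (fun x => dtsq (w k x) * partial j (w k) x).
  apply/funext => x.
  by case: (is_derive_comp (is_derive_tsq (w k x)) (Ck_is_derive x j (Cw k))).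
apply: (is_weak_partial_approx n0 (w := fun k => tsq \o w k)) => //.
- exact: L1ball_tsq.
- exact: L1ball_dtsq_mul.
- apply: nneg_cvge0 => [k|e e0]; first exact: integral_ge0.
  have e20 : 0 < e / 2 by rewrite divr_gt0.
  apply: filterS (cvge0_near_le wv e20) => k wk.
  apply: (@le_trans _ _ (2%:E * \int[mu]_(x in B) `|w k x - v x|%:E)%E).
    have mwv : measurable_fun B (fun x => `|w k x - v x|%:E).
      by apply/measurable_EFinP; apply: measurableT_comp => //; exact: measurable_funB.
    rewrite -ge0_integralZl//; last exact: mB.
    apply: ge0_le_integral => //.
    + exact: mB.
    + by apply/measurable_EFinP; apply: measurableT_comp => //; exact: measurable_funB.
    + exact: measurable_funeM.
    + by move=> x _; rewrite -EFinM lee_fin; exact: tsq_lipschitz.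
  have -> : e = 2 * (e / 2) by field.
  by rewrite EFinM lee_pmul2l.
- pose h k x := dtsq (w k x) - dtsq (v x).
  have h0 : (\int[mu]_(x in B) `|h k x * g x|%:E)%E @[k --> \oo] --> 0%E.
    (* The bound 4 is 2 + 2, each value of [dtsq] being at most 2 in absolute value. *)
    apply: (@L1_mul_bounded_cvg0 (fun k x => 2 * `|w k x - v x|) _ g 4) => //.
    + by move=> k; exact: measurable_funB.
    + move=> k; apply: measurable_funM => //.
      by apply: measurableT_comp => //; exact: measurable_funB.
    + move=> k x _; rewrite (le_trans (ler_normB _ _))//.
      by have := dtsq_le2 (w k x); have := dtsq_le2 (v x); lra.
    + by move=> k x _; exact: dtsq_lipschitz.
    + have -> : (fun k => \int[mu]_(x in B) (2 * `|w k x - v x|)%:E)%E =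
          (fun k => 2%:E * \int[mu]_(x in B) `|w k x - v x|%:E)%E.
        apply/funext => k; under eq_integral do rewrite EFinM.
        rewrite ge0_integralZl//; first exact: mB.
        by apply/measurable_EFinP; apply: measurableT_comp => //; exact: measurable_funB.
      by rewrite -(mule0 2%:E); apply: cvgeZl.
  have mdg k : measurable_fun B (fun x => `|partial j (w k) x - g x|%:E).
    by apply/measurable_EFinP; apply: measurableT_comp => //; exact: measurable_funB.
  have mhg k : measurable_fun B (fun x => `|h k x * g x|%:E).
    apply/measurable_EFinP; apply: measurableT_comp => //.
    by apply: measurable_funM => //; exact: measurable_funB.
  apply: nneg_cvge0 => [k|e e0]; first exact: integral_ge0.
  have e40 : 0 < e / 4 by rewrite divr_gt0.
  apply: filterS2 (cvge0_near_le wg e40) (cvge0_near_le h0 e40) => k dk hk.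
  apply: (@le_trans _ _ (2%:E * \int[mu]_(x in B) `|partial j (w k) x - g x|%:E +
      \int[mu]_(x in B) `|h k x * g x|%:E)%E).
    rewrite -ge0_integralZl//; last exact: mB.
    rewrite -ge0_integralD//; last 2 first.
    + exact: mB.
    + exact: measurable_funeM.
    apply: ge0_le_integral => //.
    + exact: mB.
    + apply/measurable_EFinP; apply: measurableT_comp => //; apply: measurable_funB.
        by apply: Ck_measurable (CkS_partial j (Ctw k)).
      exact: measurable_funM.
    + by apply: emeasurable_funD => //; exact: measurable_funeM.
    + move=> x _; rewrite dtwE -EFinM -EFinD lee_fin.
      have -> : dtsq (w k x) * partial j (w k) x - g x * dtsq (v x) =
          dtsq (w k x) * (partial j (w k) x - g x) + h k x * g x by rewrite /h; ring.
      rewrite (le_trans (ler_normD _ _))// lerD2r normrM ler_wpM2r//.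
      exact: dtsq_le2.
  apply: (@le_trans _ _ (2%:E * (e / 4)%:E + (e / 4)%:E)%E).
    by apply: leeD => //; rewrite lee_pmul2l.
  by rewrite -EFinM -EFinD lee_fin; lra.
Qed.

End chain_rule_W11.

Section sphere_valued.
Context {R : realType} {n : nat}.
Hypothesis n0 : (0 < n)%N.
Local Notation mu := (@lebesgue_rV R n).
Local Notation B := (@uball R n).
Local Notation mB := (@measurable_uball R n).
Local Notation S := (@usphere R n).
Local Notation sigma := (@sphere_measure R n).
Implicit Types u : 'rV[R]_n -> 'rV[R]_n.

Lemma L1ball_sum (F : 'I_n -> 'rV[R]_n -> R) : (forall i, L1ball (F i)) ->
  L1ball (fun x => \sum_(i < n) F i x).
Proof.
move=> iF; rewrite /L1ball (_ : EFin \o _ = (fun x => \sum_(i < n) (F i x)%:E)%E).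
  by apply: (@integrable_sum _ _ _ mu B mB _ _ xpredT (fun i x => (F i x)%:E)) => i _; exact: iF.
by apply/funext => x /=; rewrite sumEFin.
Qed.

Lemma integral_L1ball_sum (F : 'I_n -> 'rV[R]_n -> R) : (forall i, L1ball (F i)) ->
  (\int[mu]_(x in B) (\sum_(i < n) F i x)%:E =
   \sum_(i < n) \int[mu]_(x in B) (F i x)%:E)%E.
Proof.
move=> iF; rewrite -(integral_sum mB)//.
by apply: eq_integral => x _; rewrite sumEFin.
Qed.

Lemma component_W11 u i : admissible u -> W11 (component u i).
Proof. by move=> [[]]. Qed.

Lemma enorm1_coor_le1 (y : 'rV[R]_n) i : enorm y = 1 -> `|y ord0 i| <= 1.
Proof. by move=> <-; exact: le_coor_enorm. Qed.

(** The components lie in [-1, 1], where [tsq] is the square, so the sum of the tsq (u_i) is 1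
    almost everywhere. Its weak derivative, the sum of the 2 u_i d_j u_i, annihilates every test
    function and so vanishes by the fundamental lemma. *)
Lemma weak_gradient_orthogonal u (j : 'I_n) : admissible u ->
  {ae mu, forall x, B x -> \sum_i u x ord0 i * weak_gradient u x i j = 0}.
Proof.
move=> au; have [[Wu u1] tru] := au.
pose d i := weak_partial j (component u i).
have idP i := weak_partialP j (Wu i).
have iu i : L1ball (component u i) := (Wu i).1.
pose F i x := d i x * dtsq (component u i x).
have iF i : L1ball (F i) by apply: L1ball_dtsq_mul => //; case: (idP i).
have wF i : is_weak_partial j (tsq \o component u i) (F i).
  have [w Cw [wv wg _]] := tru i.
  by apply: (is_weak_partial_tsq n0 Cw (iu i) (idP i).1 wv (wg j)).
have G0 : {ae mu, forall x, B x -> \sum_i F i x = 0}.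
  apply: fundamental_lemma; first exact: L1ball_sum.
  move=> phi tphi; have Cphi := tphi.1 1%N.
  have cphi := Ck_continuous Cphi; have cdphi := Ck_continuous (CkS_partial j Cphi).
  under eq_integral do rewrite mulr_suml.
  rewrite integral_L1ball_sum => [|i]; last exact: (integrable_mul_continuous (iF i) cphi).
  have it i : L1ball (fun x => tsq (component u i x) * partial j phi x).
    by apply: integrable_mul_continuous => //; exact: L1ball_tsq.
  (* The sum is replaced by the constant 1, and the derivative of a test function has integral 0. *)
  have : (\int[mu]_(x in B) (\sum_i tsq (component u i x) * partial j phi x)%:E = 0)%E.
    rewrite -[RHS](integral_partial_sphere0 n0 j Cphi (test_function_sphere tphi)).
    apply: ae_eq_integral.
    - exact: mB.
    - exact: measurable_int (L1ball_sum it).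
    - by apply/measurable_EFinP; exact: Ck_measurable (CkS_partial j Cphi).
    - apply: filterS u1 => x xu Bx; congr EFin; rewrite -mulr_suml -[RHS]mul1r; congr (_ * _).
      rewrite -(expr1n _ 2) -(xu Bx) sqr_enorm; apply: eq_bigr => i _.
      by have [-> _] := tsqE (enorm1_coor_le1 i (xu Bx)).
  rewrite integral_L1ball_sum// => sum0.
  have aE i : (\int[mu]_(x in B) (F i x * phi x)%:E =
      - \int[mu]_(x in B) (tsq (component u i x) * partial j phi x)%:E)%E.
    by have := wF i _ tphi => /= ->; rewrite oppeK.
  under eq_bigr do rewrite aE.
  rewrite fin_num_sumeN => [|i _]; first by rewrite sum0 oppe0.
  exact: (integrable_fin_num mB (it i)).
apply: filterS2 u1 G0 => x xu xG Bx.
have := xG Bx; rewrite /F; under eq_bigr => i _.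
  rewrite (tsqE (enorm1_coor_le1 i (xu Bx))).2 mulrCA.
  over.
rewrite -mulr_sumr => /eqP; rewrite mulf_eq0 pnatr_eq0 /= => /eqP sum0.
rewrite -[RHS]sum0.
by apply: eq_bigr => i _; rewrite mxE mulrC.
Qed.

Let L1cvg_sub (w1 w2 : ('rV[R]_n -> R)^nat) (v1 v2 : 'rV[R]_n -> R) :
  (forall k, L1ball (w1 k)) -> (forall k, L1ball (w2 k)) -> L1ball v1 -> L1ball v2 ->
  L1cvg w1 v1 -> L1cvg w2 v2 ->
  L1cvg (fun k x => w1 k x - w2 k x) (fun x => v1 x - v2 x).
Proof.
move=> iw1 iw2 iv1 iv2 c1 c2.
have mdiff (a b : 'rV[R]_n -> R) : L1ball a -> L1ball b ->
    measurable_fun B (fun x => `|a x - b x|%:E).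
  move=> ia ib; apply/measurable_EFinP; apply: measurableT_comp => //.
  by apply: measurable_funB; exact: L1ball_measurable.
have c12 : (\int[mu]_(x in B) `|w1 k x - v1 x|%:E +
    \int[mu]_(x in B) `|w2 k x - v2 x|%:E)%E @[k --> \oo] --> 0%E.
  by rewrite -(adde0 0%E); apply: cvgeD.
apply: (squeeze_cvge _ (cvg_cst _) c12).
apply: nearW => k; rewrite integral_ge0//=.
rewrite -ge0_integralD//; [|exact: mB|exact: mdiff|exact: mdiff].
have iB (a b : 'rV[R]_n -> R) : L1ball a -> L1ball b -> L1ball (fun x => a x - b x).
  by move=> ia ib; exact: (integrableB mB ia ib).
apply: ge0_le_integral => //.
- exact: mB.
- by apply: mdiff; exact: iB.
- by apply: emeasurable_funD; exact: mdiff.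
- move=> x _; rewrite -EFinD lee_fin.
  have -> : w1 k x - w2 k x - (v1 x - v2 x) = (w1 k x - v1 x) - (w2 k x - v2 x) by ring.
  exact: ler_normB.
Qed.

Let sphere_cvg_sub (w1 w2 : ('rV[R]_n -> R)^nat) (h : 'rV[R]_n -> R) :
  (forall k, continuous (w1 k)) -> (forall k, continuous (w2 k)) -> continuous h ->
  (\int[sigma]_(x in S) `|w1 k x - h x|%:E)%E @[k --> \oo] --> 0%E ->
  (\int[sigma]_(x in S) `|w2 k x - h x|%:E)%E @[k --> \oo] --> 0%E ->
  (\int[sigma]_(x in S) `|w1 k x - w2 k x|%:E)%E @[k --> \oo] --> 0%E.
Proof.
move=> cw1 cw2 ch c1 c2.
have mdiff (a b : 'rV[R]_n -> R) : continuous a -> continuous b ->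
    measurable_fun S (fun x => `|a x - b x|%:E).
  move=> ca cb; apply/measurable_EFinP; apply: measurableT_comp => //.
  by apply: measurable_funB; apply: measurable_funTS; exact: continuous_measurable_rV.
have c12 : (\int[sigma]_(x in S) `|w1 k x - h x|%:E +
    \int[sigma]_(x in S) `|w2 k x - h x|%:E)%E @[k --> \oo] --> 0%E.
  by rewrite -(adde0 0%E); apply: cvgeD.
apply: (squeeze_cvge _ (cvg_cst _) c12).
apply: nearW => k; rewrite integral_ge0//=.
rewrite -ge0_integralD//; [|exact: measurable_usphere|exact: mdiff|exact: mdiff].
apply: ge0_le_integral => //.
- exact: measurable_usphere.
- exact: mdiff.
- by apply: emeasurable_funD; exact: mdiff.
- move=> x _; rewrite -EFinD lee_fin.
  have -> : w1 k x - w2 k x = (w1 k x - h x) - (w2 k x - h x) by ring.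
  exact: ler_normB.
Qed.

(** Both maps have the trace x_i, so the differences of their approximants tend to 0 in L^1 of the
    sphere. No boundary term remains, although psi is arbitrary there. *)
Lemma admissible_ibp u1 u2 (i j : 'I_n) psi : admissible u1 -> admissible u2 -> Ck 1 psi ->
  (\int[mu]_(x in B) ((u1 x ord0 i - u2 x ord0 i) * partial j psi x)%:E +
   \int[mu]_(x in B) ((weak_gradient u1 x i j - weak_gradient u2 x i j) * psi x)%:E = 0)%E.
Proof.
move=> a1 a2 Cpsi.
have [w1 Cw1 [wv1 wg1 ws1]] := a1.2 i; have [w2 Cw2 [wv2 wg2 ws2]] := a2.2 i.
have [ig1 _] := weak_partialP j (component_W11 i a1).
have [ig2 _] := weak_partialP j (component_W11 i a2).
have [iu1 _] := component_W11 i a1; have [iu2 _] := component_W11 i a2.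
have iB (a b : 'rV[R]_n -> R) : L1ball a -> L1ball b -> L1ball (fun x => a x - b x).
  by move=> ia ib; exact: (integrableB mB ia ib).
have gE : (fun x => ((weak_gradient u1 x i j - weak_gradient u2 x i j) * psi x)%:E) =
    (fun x => ((weak_partial j (component u1 i) x - weak_partial j (component u2 i) x) * psi x)%:E).
  by apply/funext => x; rewrite !mxE.
rewrite gE; apply: (zero_trace_ibp n0 (w := fun k x => w1 k x - w2 k x)) => //.
- by move=> k; exact: Ck_sub.
- exact: iB.
- exact: iB.
- apply: L1cvg_sub => //; by move=> k; exact: Ck_L1ball.
- have -> : (fun k => partial j (fun x => w1 k x - w2 k x)) =
      (fun k x => partial j (w1 k) x - partial j (w2 k) x).
    apply/funext => k; apply/funext => x.
    by case: (is_deriveB (Ck_is_derive x j (Cw1 k)) (Ck_is_derive x j (Cw2 k))).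
  apply: L1cvg_sub => //.
  + by move=> k; exact: Ck_L1ball (CkS_partial j (Cw1 k)).
  + by move=> k; exact: Ck_L1ball (CkS_partial j (Cw2 k)).
  + exact: wg1.
  + exact: wg2.
- apply: (sphere_cvg_sub _ _ _ ws1 ws2).
  + by move=> k; exact: Ck_continuous (Cw1 k).
  + by move=> k; exact: Ck_continuous (Cw2 k).
  + exact: coord_continuous.
Qed.

End sphere_valued.

(** * The radial map *)

Section inverse_norm.
Context {R : realType} {n : nat}.
Hypothesis n2 : (2 <= n)%N.
Local Notation mu := (@lebesgue_rV R n).
Local Notation B := (@uball R n).
Local Notation mB := (@measurable_uball R n).

Lemma measurable_inv_enorm : measurable_fun setT (fun x : 'rV[R]_n => (enorm x)^-1).
Proof.
rewrite (_ : (fun x => _) = (fun x : 'rV[R]_n => enorm x `^ (-1))); last first.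
  by apply/funext => x; rewrite powR_inv1 ?sqrtr_ge0.
by apply: (measurableT_comp (measurable_powR _)); exact: measurable_enorm.
Qed.

(** Truncation at m makes the integral finite, so that it may be subtracted from both sides of an
    inequality; Fatou's lemma removes m afterwards. *)
Let g (m : nat) (x : 'rV[R]_n) : R := Num.min (enorm x)^-1 m%:R.

Let g_ge0 m x : 0 <= g m x.
Proof. by rewrite le_min invr_ge0 enorm_ge0 ler0n. Qed.

Let mg m : measurable_fun setT (fun x => (g m x)%:E).
Proof.
apply/measurable_EFinP; apply: measurable_minr; last exact: measurable_cst.
exact: measurable_inv_enorm.
Qed.

(* Rescaling the half ball to the full one shows I <= 2 |B| + I / 2. *)
Let integral_g m : (\int[mu]_(x in B) (g m x)%:E <= 4%:E * mu B)%E.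
Proof.
set I := (\int[mu]_(x in B) _)%E.
have Bfin := @uball_fin_num R n.
have half0 : 0 < 2^-1 :> R by lra.
have half1 : 2^-1 < 1 :> R by lra.
have Ifin : I \is a fin_num.
  rewrite ge0_fin_numE ?integral_ge0//; last by move=> x _; rewrite lee_fin.
  apply: (@le_lt_trans _ _ (\int[mu]_(x in B) m%:R%:E)%E).
    apply: ge0_le_integral => //.
    - exact: mB.
    - by move=> x _; rewrite lee_fin.
    - exact: (measurable_funTS (mg m)).
    - by move=> x _; rewrite lee_fin ge_min lexx orbT.
  rewrite integral_cst; last exact: mB.
  by apply: lte_mul_pinfty => //; exact: uball_lty.
have sub : eball 2^-1 `<=` B by move=> x /= xt; rewrite /uball /= (lt_trans xt).
have mD : measurable (B `\` eball 2^-1) by apply: measurableD; [exact: mB|exact: measurable_eball].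
have IE : (I = \int[mu]_(x in eball 2^-1) (g m x)%:E + \int[mu]_(x in B `\` eball 2^-1) (g m x)%:E)%E.
  rewrite -ge0_integral_setU//.
  - by rewrite setDUK.
  - exact: measurable_eball.
  - exact: (measurable_funTS (mg m)).
  - by move=> x _; rewrite lee_fin.
  - by apply/disj_set2P; rewrite setDE setICA setICr setI0.
have I1 : (\int[mu]_(x in eball 2^-1) (g m x)%:E <= 2^-1%:E * I)%E.
  rewrite (ge0_integral_eball half0 (mg m)); last by move=> x; rewrite lee_fin.
  apply: (@le_trans _ _ ((2^-1 ^+ n)%:E * (2%:E * I))%E).
    apply: lee_wpmul2l; first by rewrite lee_fin exprn_ge0// ltW.
    rewrite -ge0_integralZl//; last 3 first.
    - exact: mB.
    - exact: (measurable_funTS (mg m)).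
    - by move=> x _; rewrite lee_fin.
    apply: ge0_le_integral => //.
    - exact: mB.
    - by move=> x _; rewrite lee_fin.
    - apply: measurable_funTS; apply: (measurableT_comp (mg m)).
      exact: measurable_scale_rV.
    - by apply: measurable_funTS; exact: measurable_funeM.
    (* Halving x doubles 1/|x|, and the truncation level m stays below 2 m. *)
    - move=> x _; rewrite -EFinM lee_fin /g enormZ gtr0_norm// invfM invrK.
      rewrite minr_pMr ?ler0n// le_min ge_min lexx /= ge_min.
      by rewrite [X in _ || X](_ : _ = true) ?orbT// ler_peMl// ler1n.
  rewrite muleA -EFinM; apply: lee_wpmul2r.
    by rewrite integral_ge0// => x _; rewrite lee_fin.
  (* The dimension enters here: 2^-n times 2 is at most 1/2 because n >= 2. *)
  rewrite lee_fin -(subnK n2) exprD.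
  have : (2^-1 : R) ^+ (n - 2) <= 1 by rewrite exprn_ile1// ltW.
  by have := exprn_ge0 (n - 2) (ltW half0); nra.
have I2 : (\int[mu]_(x in B `\` eball 2^-1) (g m x)%:E <= 2%:E * mu B)%E.
  apply: (@le_trans _ _ (\int[mu]_(x in B `\` eball 2^-1) 2%:E)%E).
    apply: ge0_le_integral => //.
    - by move=> x _; rewrite lee_fin.
    - exact: (measurable_funTS (mg m)).
    - move=> x [_ /negP]; rewrite /eball /= -leNgt => x2.
      by rewrite lee_fin ge_min -[2]invrK lef_pV2 ?x2// posrE// (lt_le_trans half0).
  rewrite integral_cst// lee_wpmul2l// le_measure ?inE//; exact: mB.
move: IE; rewrite -(fineK Ifin) -(fineK Bfin) in I1 I2 * => IE.
have : ((fine I)%:E <= (2^-1 * fine I)%:E + (2 * fine (mu B))%:E)%E.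
  by rewrite {1}IE; apply: leeD; [rewrite EFinM|rewrite EFinM].
by rewrite -EFinD -EFinM !lee_fin; lra.
Qed.

Lemma integrable_inv_enorm : L1ball (fun x : 'rV[R]_n => (enorm x)^-1).
Proof.
apply/integrableP; split.
  by apply/measurable_EFinP; apply: measurable_funTS; exact: measurable_inv_enorm.
have g_cvg x : (fun m => (g m x)%:E) @ \oo --> ((enorm x)^-1)%:E.
  apply: cvg_near_cst; near=> m; rewrite /g min_l//; near: m.
  exists (Num.truncn (enorm x)^-1).+1 => // k /= xk.
  by rewrite (le_trans (ltW (truncnS_gt _)))// ler_nat.
apply: (@le_lt_trans _ _ (4%:E * mu B)%E); last first.
  by apply: lte_mul_pinfty => //; exact: uball_lty.
have F := @fatou _ _ _ mu B mB (fun m x => (g m x)%:E)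
  (fun m => measurable_funTS (mg m)) (fun m x _ => g_ge0 m x : (0 <= (g m x)%:E)%E).
apply: le_trans (le_trans F _).
  rewrite le_eqVlt; apply/orP; left; apply/eqP; apply: eq_integral => x _.
  rewrite is_cvg_limn_einfE; last by apply/cvg_ex; eexists; exact: g_cvg.
  by rewrite (cvg_lim _ (g_cvg x))// gee0_abs// lee_fin invr_ge0 enorm_ge0.
rewrite limn_einf_lim; apply: lime_le; first exact: is_cvg_einfs.
apply: nearW => m; apply: le_trans (integral_g m).
by apply: ereal_inf_lbound; exists m => /=.
Unshelve. all: by end_near. Qed.

End inverse_norm.

Section radial_map.
Context {R : realType} {n : nat}.
Hypothesis n2 : (2 <= n)%N.
Let n0 : (0 < n)%N := ltnW n2.
Local Notation mu := (@lebesgue_rV R n).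
Local Notation B := (@uball R n).
Local Notation mB := (@measurable_uball R n).
Local Notation S := (@usphere R n).
Local Notation sigma := (@sphere_measure R n).
Local Notation e_ j := (delta_mx ord0 j : 'rV[R]_n).

Let rho (e : R) (x : 'rV[R]_n) : R := Num.sqrt (sqnorm x + e).

(** C^1 approximant of x_i / |x|: adding e under the square root removes the singularity at the
    origin. *)
Definition regularized_radial (e : R) (i : 'I_n) (x : 'rV[R]_n) : R :=
  x ord0 i * (rho e x)^-1.

Let dreg (e : R) (i j : 'I_n) (x : 'rV[R]_n) : R :=
  (j == i)%:R * (rho e x)^-1 - x ord0 i * x ord0 j * (rho e x)^-1 ^+ 3.

(** The classical gradient of x_i / |x|, with value 0 at the origin since the inverse of 0 is 0. *)
Definition radial_gradient (i j : 'I_n) (x : 'rV[R]_n) : R :=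
  (j == i)%:R * (enorm x)^-1 - x ord0 i * x ord0 j * (enorm x)^-1 ^+ 3.

Let rho_gt0 e x : 0 < e -> 0 < rho e x.
Proof. by move=> e0; rewrite sqrtr_gt0 ltr_wpDl// sqnorm_ge0. Qed.

Let rho_ge e x : 0 < e -> enorm x <= rho e x.
Proof. by move=> e0; apply: ler_wsqrtr; rewrite lerDl ltW. Qed.

Let is_derive_inv_sqrt (s : R) : 0 < s ->
  is_derive s 1 (fun s => (Num.sqrt s)^-1) (- 2^-1 * (Num.sqrt s)^-1 ^+ 3).
Proof.
move=> s0; have ss0 : 0 < Num.sqrt s by rewrite sqrtr_gt0.
have d1 : is_derive (Num.sqrt s) 1 (fun z : R => z^-1) (- (Num.sqrt s) ^- 2).
  by apply: DeriveDef; [apply: derivableV => //; rewrite gt_eqF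
    |rewrite deriveV ?gt_eqF// derive_id [_ *: _]mulr1].
have d2 := is_derive1_sqrt s0.
apply: (is_derive_eq (is_derive_comp d1 d2)).
by field; rewrite gt_eqF.
Qed.

Let continuous_inv_rho e : 0 < e -> continuous (fun x => (rho e x)^-1).
Proof.
move=> e0 x; apply: continuous_comp; last by apply: inv_continuous; rewrite gt_eqF// rho_gt0.
apply: (@continuous_comp _ _ _ (fun x => sqnorm x + e) Num.sqrt); last exact: sqrt_continuous.
by apply: continuousD; [exact: (Ck_continuous (@Ck_sqnorm R n 0))|exact: cst_continuous].
Qed.

Let is_derive_reg e i j x : 0 < e ->
  is_derive x (e_ j) (regularized_radial e i) (dreg e i j x).
Proof.
move=> e0; have s0 : 0 < sqnorm x + e by rewrite ltr_wpDl// sqnorm_ge0.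
have d1 : is_derive x (e_ j) (fun x => sqnorm x + e) (2 * x ord0 j + 0).
  exact: (is_deriveD (is_derive_sqnorm x j) (is_derive_cst e x (e_ j))).
have d2 : is_derive x (e_ j) (fun x => (rho e x)^-1)
    (- 2^-1 * (rho e x)^-1 ^+ 3 * (2 * x ord0 j + 0)).
  exact: (@is_derive_comp _ _ (fun s => (Num.sqrt s)^-1) (fun x => sqnorm x + e) _ _ _ _
    (is_derive_inv_sqrt s0) d1).
apply: (is_derive_eq (is_deriveM (is_derive_coor i x (e_ j)) d2)).
rewrite mxE eqxx /= /GRing.scale /= /dreg [i == j]eq_sym.
by field; rewrite gt_eqF// rho_gt0.
Qed.

Let continuous_dreg e i j : 0 < e -> continuous (dreg e i j).
Proof.
move=> e0 x; have c := continuous_inv_rho e0.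
have c3 : {for x, continuous (fun x => (rho e x)^-1 ^+ 3)}.
  by apply: (@continuous_comp _ _ _ (fun x => (rho e x)^-1) (fun z : R => z ^+ 3));
    [exact: c|exact: exprn_continuous].
have cc (k : 'I_n) : {for x, continuous (fun x : 'rV[R]_n => x ord0 k)}.
  exact: coord_continuous.
exact: (continuousB (continuousM (@cst_continuous _ _ _ _) (c x))
  (continuousM (continuousM (cc i) (cc j)) c3)).
Qed.

Lemma Ck_regularized_radial e i : 0 < e -> Ck 1 (regularized_radial e i).
Proof.
move=> e0; apply: (@CkS_intro _ _ 0 _ (dreg e i)).
- move=> x; apply: (@continuousM _ _ (fun x : 'rV[R]_n => x ord0 i) (fun x => (rho e x)^-1)).
    exact: coord_continuous.
  exact: continuous_inv_rho.
- by move=> j x; exact: is_derive_reg.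
- by move=> j; exact: continuous_dreg.
Qed.

(** The radius r is either |x| or its regularization, so one bound serves both gradients. *)
Let gradient_bound (r : R) (i j : 'I_n) (x : 'rV[R]_n) : 0 < r -> enorm x <= r ->
  `|(j == i)%:R * r^-1 - x ord0 i * x ord0 j * r^-1 ^+ 3| <= 2 * r^-1.
Proof.
move=> r0 xr; have r1 : 0 < r^-1 by rewrite invr_gt0.
rewrite (le_trans (ler_normB _ _))// [leRHS]mulr_natl mulr2n lerD//.
  by rewrite normrM (gtr0_norm r1) ger0_norm// ler_piMl ?(ltW r1)// lern1 leq_b1.
rewrite normrM (ger0_norm (exprn_ge0 3 (ltW r1))) normrM.
have xi := le_trans (le_coor_enorm x i) xr.
have xj := le_trans (le_coor_enorm x j) xr.
apply: (@le_trans _ _ (r * r * r^-1 ^+ 3)).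
  by rewrite ler_wpM2r ?exprn_ge0 ?(ltW r1)// ler_pM.
by rewrite le_eqVlt; apply/orP; left; apply/eqP; field; rewrite gt_eqF.
Qed.

Let L1cvg_dominated (w : ('rV[R]_n -> R)^nat) (v g : 'rV[R]_n -> R) :
  (forall k, measurable_fun B (w k)) -> measurable_fun B v -> L1ball g ->
  (forall k (x : 'rV[R]_n), x != 0 -> `|w k x - v x| <= g x) ->
  (forall x : 'rV[R]_n, x != 0 -> w k x @[k --> \oo] --> v x) -> L1cvg w v.
Proof.
move=> mw mv ig wvg wv.
have mwv k : measurable_fun B (fun x => `|w k x - v x|%:E).
  by apply/measurable_EFinP; apply: measurableT_comp => //; exact: measurable_funB.
have [||_ _] := @dominated_convergence _ _ _ mu B mB
  (fun k x => `|w k x - v x|%:E) (cst 0%E) (EFin \o g) mwv (measurable_cst _) _ ig _; last first.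
- by rewrite integral0.
- by apply: filterS (ae_rV_neq0 n0) => x x0 k Bx /=; rewrite lee_fin normr_id wvg.
- apply: filterS (ae_rV_neq0 n0) => x x0 Bx; apply: cvg_EFin; first exact: nearW.
  have -> : (0 : R) = `|v x - v x| by rewrite subrr normr0.
  by apply: cvg_norm; apply: cvgB; [exact: wv|exact: cvg_cst].
Qed.

Let eps (k : nat) : R := k.+1%:R^-1.

Let eps_gt0 k : 0 < eps k. Proof. by rewrite invr_gt0. Qed.

Let cvg_inv_rho (x : 'rV[R]_n) : x != 0 -> (rho (eps k) x)^-1 @[k --> \oo] --> (enorm x)^-1.
Proof.
move=> x0; apply: cvgV; first by rewrite enorm_eq0.
rewrite -[enorm x]/(Num.sqrt (sqnorm x)); apply: continuous_cvg.
  exact: sqrt_continuous.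
rewrite -[X in _ --> X]addr0; apply: cvgD; first exact: cvg_cst.
exact: cvg_harmonic.
Qed.

Let regE k i x : regularized_radial (eps k) i x = x ord0 i * (rho (eps k) x)^-1.
Proof. by []. Qed.

Let radialE i x : component (@radial R n) i x = x ord0 i * (enorm x)^-1.
Proof. by rewrite /component mxE mulrC. Qed.

Let coor_radial_le1 i (r : R) (x : 'rV[R]_n) : 0 < r -> enorm x <= r -> `|x ord0 i * r^-1| <= 1.
Proof.
move=> r0 xr; rewrite normrM normfV (gtr0_norm r0) ler_pdivrMr// mul1r.
exact: le_trans (le_coor_enorm _ _) xr.
Qed.

Let component_radial_le1 i x : `|component (@radial R n) i x| <= 1.
Proof.
rewrite radialE; have [->|x0] := eqVneq x 0; first by rewrite mxE mul0r normr0.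
by apply: coor_radial_le1 => //; rewrite lt_neqAle enorm_ge0 eq_sym enorm_eq0 x0.
Qed.

Let measurable_component_radial i : measurable_fun setT (component (@radial R n) i).
Proof. exact: (measurableT_comp (measurable_coor i) (@measurable_radial R n)). Qed.

Let L1ball_component_radial i : L1ball (component (@radial R n) i).
Proof.
apply: (bounded_integrable mB (uball_lty n)); first exact: measurable_funTS (measurable_component_radial i).
by move=> x _; exact: component_radial_le1.
Qed.

Let L1ball_radial_gradient i j : L1ball (radial_gradient i j).
Proof.
apply: (@le_integrable _ _ _ mu B mB _ (EFin \o (fun x => 2 * (enorm x)^-1))).
- apply/measurable_EFinP; apply: measurable_funTS.
  have mi := @measurable_inv_enorm R n.
  apply: measurable_funB; first by apply: measurable_funM => //; exact: measurable_cst.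
  apply: measurable_funM; last exact: measurable_funX.
  by apply: measurable_funM; exact: measurable_coor.
- move=> x Bx /=; rewrite lee_fin [leRHS]ger0_norm ?mulr_ge0 ?invr_ge0 ?enorm_ge0//.
  have [->|x0] := eqVneq x 0; last by apply: gradient_bound => //; exact: enorm_gt0.
  by rewrite /radial_gradient enorm0 invr0 !mulr0 mxE mul0r mul0r subr0 normr0.
- rewrite (_ : EFin \o _ = (fun x => 2%:E * (EFin \o (fun x : 'rV[R]_n => (enorm x)^-1)%R) x)%E) //.
  by apply: integrableZl => //; [exact: mB|exact: integrable_inv_enorm].
Qed.

Let L1cvg_reg i : L1cvg (fun k => regularized_radial (eps k) i) (component (@radial R n) i).
Proof.
apply: (L1cvg_dominated (g := fun=> 2)).
- by move=> k; exact: Ck_measurable (Ck_regularized_radial i (eps_gt0 k)).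
- exact: measurable_funTS (measurable_component_radial i).
- exact: Ck_L1ball (@Ck_cst R n 0 2).
- move=> k x x0; rewrite (le_trans (ler_normB _ _))// [leRHS](_ : _ = 1 + 1); last ring.
  by rewrite lerD ?component_radial_le1// coor_radial_le1 ?rho_gt0 ?rho_ge.
- move=> x x0; rewrite radialE; apply: cvgM; [exact: cvg_cst|exact: cvg_inv_rho].
Qed.

Let partial_reg k i j : partial j (regularized_radial (eps k) i) = dreg (eps k) i j.
Proof. by apply/funext => x; case: (is_derive_reg i j x (eps_gt0 k)). Qed.

(** The regularized norm is at least |x|, so away from the origin both gradients are bounded by
    2/|x| and 4/|x| dominates their difference. *)
Let L1cvg_dreg i j : L1cvg (fun k => partial j (regularized_radial (eps k) i)) (radial_gradient i j).
Proof.
under eq_fun do rewrite partial_reg.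
apply: (L1cvg_dominated (g := fun x => 4 * (enorm x)^-1)).
- move=> k; apply: measurable_funTS; apply: continuous_measurable_rV.
  exact: continuous_dreg.
- exact: L1ball_measurable (L1ball_radial_gradient i j).
- rewrite /L1ball (_ : EFin \o _ = (fun x => 4%:E * (EFin \o (fun x : 'rV[R]_n => (enorm x)^-1)%R) x)%E) //.
  by apply: integrableZl => //; [exact: mB|exact: integrable_inv_enorm].
- move=> k x x0; rewrite (le_trans (ler_normB _ _))// [leRHS](_ : _ = 2 * (enorm x)^-1 + 2 * (enorm x)^-1); last ring.
  rewrite lerD//; last by apply: gradient_bound => //; exact: enorm_gt0.
  apply: le_trans (gradient_bound i j (rho_gt0 x (eps_gt0 k)) (rho_ge x (eps_gt0 k))) _.
  by rewrite ler_pM2l// lef_pV2 ?posrE ?enorm_gt0 ?rho_gt0// rho_ge.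
- move=> x x0; have c := cvg_inv_rho x0; apply: cvgB.
    by apply: cvgM; [exact: cvg_cst|exact: c].
  apply: cvgM; first exact: cvg_cst.
  rewrite -[(enorm x)^-1 ^+ 3]/((fun z : R => z ^+ 3) (enorm x)^-1).
  by apply: continuous_cvg; [exact: exprn_continuous|exact: c].
Qed.

Lemma is_weak_partial_radial i j :
  is_weak_partial j (component (@radial R n) i) (radial_gradient i j).
Proof.
apply: (is_weak_partial_approx n0 (w := fun k => regularized_radial (eps k) i)) => //.
by move=> k; exact: Ck_regularized_radial.
Qed.

Lemma W11_radial i : W11 (component (@radial R n) i).
Proof.
split; first exact: L1ball_component_radial.
by move=> j; exists (radial_gradient i j); last exact: is_weak_partial_radial.
Qed.

Lemma weak_gradient_radial i j :
  {ae mu, forall x, B x -> weak_gradient (@radial R n) x i j = radial_gradient i j x}.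
Proof.
have [ig wg] := weak_partialP j (W11_radial i).
have := weak_partial_unique ig (L1ball_radial_gradient i j) wg (is_weak_partial_radial i j).
by apply: filterS => x /[apply] <-; rewrite mxE.
Qed.

Lemma admissible_radial : admissible (@radial R n).
Proof.
split; first split.
- exact: W11_radial.
- by apply: filterS (ae_rV_neq0 n0) => x x0 _; exact: enorm_radial.
move=> i; exists (fun k => regularized_radial (eps k) i).
  by move=> k; exact: Ck_regularized_radial.
split; first exact: L1cvg_reg.
(* [has_trace] refers to the chosen weak derivative, which agrees with the explicit gradient almost
   everywhere. *)
- move=> j; have [ig wg] := weak_partialP j (W11_radial i).
  have := L1cvg_dreg i j; rewrite /L1cvg.
  set a := (fun k => _); set b := (fun k => _); suff -> : a = b by [].
  apply/funext => k; rewrite /a /b.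
  have mk : measurable_fun B (partial j (regularized_radial (eps k) i)).
    exact: Ck_measurable (CkS_partial j (Ck_regularized_radial i (eps_gt0 k))).
  apply: ae_eq_integral.
  + exact: mB.
  + apply/measurable_EFinP; apply: measurableT_comp => //.
    by apply: measurable_funB => //; exact: L1ball_measurable.
  + apply/measurable_EFinP; apply: measurableT_comp => //.
    by apply: measurable_funB => //; exact: L1ball_measurable.
  + apply: filterS (weak_gradient_radial i j) => x + Bx.
    by move=> /(_ Bx) <-; rewrite mxE.
(* On the sphere the regularized component is x_i / sqrt(1 + eps k), so its distance to x_i is at
   most c k. *)
- pose c k : R := 1 - (Num.sqrt (1 + eps k))^-1.
  have c_cvg : c k @[k --> \oo] --> (0 : R).
    have -> : (0 : R) = 1 - (Num.sqrt (1 + 0))^-1 by rewrite addr0 sqrtr1 invr1 subrr.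
    apply: cvgB; first exact: cvg_cst.
    apply: cvgV; first by rewrite addr0 sqrtr1 oner_eq0.
    apply: continuous_cvg.
      exact: sqrt_continuous.
    by apply: cvgD; [exact: cvg_cst|exact: cvg_harmonic].
  have sfin : sigma S \is a fin_num by rewrite ge0_fin_numE// sphere_measure_lty.
  have b0 : ((c k)%:E * sigma S)%E @[k --> \oo] --> 0%E.
    rewrite -(mul0e (sigma S)); apply: cvgeZr => //.
    by apply: cvg_EFin => //; exact: nearW.
  apply: (squeeze_cvge _ (cvg_cst _) b0).
  apply: nearW => k; rewrite integral_ge0//= -integral_cst; last exact: measurable_usphere.
  apply: ge0_le_integral => //.
  + exact: measurable_usphere.
  + apply/measurable_EFinP; apply: measurableT_comp => //; apply: measurable_funB.
      exact: Ck_measurable (Ck_regularized_radial i (eps_gt0 k)).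
    by apply: measurable_funTS; exact: measurable_coor.
  + move=> x Sx; rewrite lee_fin regE /rho sqnormE (Sx : enorm x = 1) expr1n.
    have r1 : (Num.sqrt (1 + eps k))^-1 <= 1.
      rewrite invf_le1 ?sqrtr_gt0 ?addr_gt0//.
      by rewrite -[leLHS]sqrtr1 ler_sqrt ?lerDl ?addr_ge0// ltW.
    rewrite -[X in _ - X]mulr1 -mulrBr normrM.
    rewrite [X in _ * X]distrC [X in _ * X]ger0_norm ?subr_ge0//.
    by rewrite ler_piMl ?subr_ge0//; exact: enorm1_coor_le1.
Qed.

End radial_map.

(** * Minimality *)

Section pointwise.
Context {R : realType} {n : nat}.
Implicit Types (y x : 'rV[R]_n) (A : 'M[R]_n).

(* The orthogonal projection onto the hyperplane y^T, when y is a unit vector. *)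
Let proj y i j : R := (j == i)%:R - y ord0 i * y ord0 j.

Let sum_proj_diag y : enorm y = 1 -> \sum_i proj y i i = n%:R - 1.
Proof.
move=> y1; rewrite /proj sumrB; congr (_ - _).
  rewrite (eq_bigr (fun=> 1)) => [|i _]; last by rewrite eqxx.
  by rewrite sumr_const card_ord.
by rewrite -(expr1n _ 2) -y1 sqr_enorm; apply: eq_bigr => i _; rewrite expr2.
Qed.

(** The projection is symmetric and idempotent, so its squared Frobenius norm is its trace. *)
Let sum_proj_sqr y : enorm y = 1 -> \sum_i \sum_j proj y i j ^+ 2 = n%:R - 1.
Proof.
move=> y1; have y1' : \sum_i y ord0 i ^+ 2 = 1 by rewrite -sqr_enorm y1 expr1n.
rewrite -(sum_proj_diag y1); apply: eq_bigr => i _.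
rewrite (eq_bigr (fun j => (j == i)%:R * (1 - 2 * y ord0 i * y ord0 j)
    + y ord0 i ^+ 2 * y ord0 j ^+ 2)); last first.
  by move=> j _; rewrite /proj; case: (j == i) => /=; ring.
rewrite big_split /= -mulr_sumr y1' (bigD1 i)//= big1 => [|j ji]; last first.
  by rewrite (negbTE ji) mul0r.
by rewrite /proj !eqxx /=; ring.
Qed.

(* Cauchy-Schwarz against the projection, whose Frobenius norm is sqrt (n - 1). *)
Lemma trace_le_frobenius y A : (1 < n)%N -> enorm y = 1 ->
  (forall j, \sum_i y ord0 i * A i j = 0) ->
  \sum_i A i i <= Num.sqrt (n%:R - 1) * frobenius A.
Proof.
move=> n1 y1 yA.
set N := Num.sqrt _; set c := frobenius A.
have n10 : 0 < n%:R - 1 :> R by rewrite subr_gt0 ltr1n.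
have N2 : N ^+ 2 = n%:R - 1 by rewrite sqr_sqrtr// ltW.
have N0 : 0 < N by rewrite sqrtr_gt0.
have A2 : c ^+ 2 = \sum_i \sum_j A i j ^+ 2.
  by rewrite sqr_sqrtr// sumr_ge0// => i _; rewrite sumr_ge0// => j _; exact: sqr_ge0.
(* Since y is orthogonal to the columns of A, the part y_i y_j of the projection contributes
   nothing. *)
have trE : \sum_i \sum_j A i j * proj y i j = \sum_i A i i.
  have z : \sum_j y ord0 j * (\sum_i y ord0 i * A i j) = 0.
    by rewrite big1// => j _; rewrite yA mulr0.
  rewrite -[RHS]subr0 -[X in _ - X]z.
  under [X in _ - X]eq_bigr do rewrite mulr_sumr.
  rewrite [X in _ - X]exchange_big /= -sumrB; apply: eq_bigr => i _.
  rewrite (eq_bigr (fun j => A i j * (j == i)%:R - y ord0 j * (y ord0 i * A i j))); last first.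
    by move=> j _; rewrite /proj; ring.
  rewrite sumrB; congr (_ - _).
  rewrite (bigD1 i)//= eqxx mulr1 big1 ?addr0// => j ji.
  by rewrite (negbTE ji) mulr0.
have c_ge0 : 0 <= c by exact: sqrtr_ge0.
(* The case A = 0 is treated apart, because the final inequality is divided by N c. *)
move: (c_ge0); rewrite le_eqVlt => /predU1P[c0|c0].
  rewrite -c0 mulr0 -trE big1// => i _; rewrite big1// => j _.
  suff -> : A i j = 0 by rewrite mul0r.
  move: A2; rewrite -c0 expr0n /= => /esym /eqP.
  rewrite psumr_eq0 => [/allP /(_ i)|k _]; last by rewrite sumr_ge0// => l _; exact: sqr_ge0.
  rewrite mem_index_enum => /(_ isT) /=.
  rewrite psumr_eq0 => [/allP /(_ j)|k _]; last exact: sqr_ge0.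
  by rewrite mem_index_enum => /(_ isT) /=; rewrite sqrf_eq0 => /eqP.
(* Both matrices in this difference have Frobenius norm N c, so expanding gives 2 N c tr A <= 2 N^2
   c^2. *)
have : 0 <= \sum_i \sum_j (N * A i j - c * proj y i j) ^+ 2.
  by rewrite sumr_ge0// => i _; rewrite sumr_ge0// => j _; exact: sqr_ge0.
have -> : \sum_i \sum_j (N * A i j - c * proj y i j) ^+ 2 =
    N ^+ 2 * c ^+ 2 - 2 * N * c * (\sum_i A i i) + c ^+ 2 * N ^+ 2.
  rewrite {1}A2 -trE N2 -(sum_proj_sqr y1) !mulr_sumr -sumrB -big_split /=.
  apply: eq_bigr => i _; rewrite !mulr_sumr -sumrB -big_split /=.
  apply: eq_bigr => j _; rewrite (sum_proj_sqr y1) -N2; ring.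
move=> H; have Nc : 0 < N * c by rewrite mulr_gt0.
by rewrite -(ler_pM2l Nc); nra.
Qed.

(** The gradient of the radial map is a multiple of the projection, which is the equality case of
    Cauchy-Schwarz. *)
Lemma radial_gradient_proj x i j : x != 0 ->
  radial_gradient i j x = (enorm x)^-1 * proj (radial x) i j.
Proof.
by move=> x0; rewrite /radial_gradient /proj !mxE; ring.
Qed.

Lemma trace_radial_gradient x A : (1 < n)%N -> x != 0 ->
  (forall i j, A i j = radial_gradient i j x) ->
  \sum_i A i i = Num.sqrt (n%:R - 1) * frobenius A.
Proof.
move=> n1 x0 AE; have r1 := enorm_radial x0.
have n10 : 0 < n%:R - 1 :> R by rewrite subr_gt0 ltr1n.
rewrite (eq_bigr (fun i => (enorm x)^-1 * proj (radial x) i i)); last first.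
  by move=> i _; rewrite AE radial_gradient_proj.
rewrite -mulr_sumr sum_proj_diag// /frobenius.
have -> : \sum_i \sum_j A i j ^+ 2 = (enorm x)^-1 ^+ 2 * (n%:R - 1).
  rewrite -(sum_proj_sqr r1) mulr_sumr; apply: eq_bigr => i _.
  rewrite mulr_sumr; apply: eq_bigr => j _.
  by rewrite AE radial_gradient_proj// exprMn.
rewrite sqrtrM ?sqr_ge0// sqrtr_sqr ger0_norm ?invr_ge0 ?enorm_ge0//.
by rewrite mulrCA -expr2 sqr_sqrtr// ltW.
Qed.

End pointwise.

(** * Smooth approximation of the weight *)

Section profile.
Context {R : realType}.
Variable f : R -> R.
Hypothesis f_ge0 : forall r : R, 0 <= r <= 1 -> 0 <= f r.
Hypothesis f_diff : differentiable01 f.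
Hypothesis f_nd : forall r s : R, 0 <= r -> r <= s -> s <= 1 -> f r <= f s.

(* f as a function of the squared radius, extended by constants. *)
Definition sqprofile (s : R) : R := f (Num.sqrt (Num.min 1 s)).

Let root01 (s : R) : 0 <= Num.sqrt (Num.min 1 s) <= 1.
Proof.
rewrite sqrtr_ge0 /= -[leRHS]sqrtr1.
by apply: ler_wsqrtr; rewrite ge_min lexx.
Qed.

Lemma sqprofile_sqr (r : R) : 0 <= r <= 1 -> sqprofile (r ^+ 2) = f r.
Proof.
move=> /andP[r0 r1]; rewrite /sqprofile min_r ?expr_le1//.
by rewrite sqrtr_sqr ger0_norm.
Qed.

Lemma sqprofile_nd (s t : R) : s <= t -> sqprofile s <= sqprofile t.
Proof.
move=> st; have /andP[s0 _] := root01 s; have /andP[_ t1] := root01 t.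
apply: f_nd => //; apply: ler_wsqrtr.
by rewrite le_min ge_min lexx /= ge_min st orbT.
Qed.

Lemma sqprofile_bound (s : R) : 0 <= sqprofile s <= f 1.
Proof.
have /andP[s0 s1] := root01 s; apply/andP; split; first by apply: f_ge0; exact: root01.
by apply: f_nd.
Qed.

(** Near x the difference quotients are bounded by |l| + 1, where l is the derivative at x within
    [0, 1]. *)
Let f_continuous (x : R) : 0 <= x <= 1 -> forall e : R, 0 < e ->
  \forall y \near x, 0 <= y <= 1 -> `|f y - f x| <= e.
Proof.
move=> x01 e e0; have /cvg_ex[l /=] := f_diff x01.
move=> /cvgrPdist_le /(_ 1 ltr01); rewrite !near_withinE => near_l.
have K0 : 0 < `|l| + 1 by rewrite ltr_wpDl.
have near_e : \forall y \near x, `|x - y| <= e / (`|l| + 1).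
  by have := @cvg_id _ (nbhs x) => /cvgrPdist_le; apply; rewrite divr_gt0.
near=> y => y01; have [->|yx] := eqVneq y x; first by rewrite subrr normr0 ltW.
have yx0 : y - x != 0 by rewrite subr_eq0.
have : `|l - (f y - f x) / (y - x)| <= 1.
  have : (y != x -> `[0, 1]%classic y -> `|l - (f y - f x) / (y - x)| <= 1) by near: y.
  by apply => //=; rewrite in_itv.
move=> H.
have q : `|(f y - f x) / (y - x)| <= `|l| + 1.
  rewrite (_ : (f y - f x) / (y - x) = l - (l - (f y - f x) / (y - x))); last ring.
  by rewrite (le_trans (ler_normB _ _))// lerD2l.
have -> : f y - f x = (f y - f x) / (y - x) * (y - x) by rewrite divfK.
rewrite normrM (@le_trans _ _ ((`|l| + 1) * (e / (`|l| + 1))))//.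
  apply: ler_pM => //; rewrite distrC.
  by near: y.
by rewrite mulrC divfK// gt_eqF.
Unshelve. all: by end_near. Qed.

Lemma continuous_sqprofile : continuous sqprofile.
Proof.
move=> s; apply/cvgrPdist_le => e e0.
have croot : {for s, continuous (fun s : R => Num.sqrt (Num.min 1 s))}.
  apply: continuous_comp; last exact: sqrt_continuous.
  by apply: (@continuous_min R R (fun=> 1) id) => //; exact: cst_continuous.
have near_root : \forall t \near s, 0 <= Num.sqrt (Num.min 1 t) <= 1 ->
    `|f (Num.sqrt (Num.min 1 t)) - f (Num.sqrt (Num.min 1 s))| <= e.
  exact: croot (f_continuous (root01 s) e0).
apply: filterS near_root => t /(_ (root01 t)).
by rewrite distrC.
Qed.

(** The primitive starts at -1 so that s = 0 is an interior point and F is differentiable there. *)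
Let F (s : R) : R := (\int[lebesgue_measure]_(t in `[(- 1)%R, s]) sqprofile t)%R.

Let is_derive_F (s : R) : -1 < s -> is_derive s 1 F (sqprofile s).
Proof.
move=> s1; have su : s < s + 1 by rewrite ltrDl.
have iF : lebesgue_measure.-integrable `[(- 1)%R, s + 1] (EFin \o sqprofile).
  apply: continuous_compact_integrable; first exact: segment_compact.
  exact: continuous_subspaceT continuous_sqprofile.
have [dF FE] := continuous_FTC1_closed su iF s1 (continuous_sqprofile (x := s)).
split; first exact: dF.
by rewrite -derive1E; exact: FE.
Qed.

Let h (m : nat) : R := m.+1%:R^-1.

Let h_gt0 m : 0 < h m. Proof. by rewrite invr_gt0. Qed.

(* Difference quotients of a primitive: nondecreasing C^1 approximants of the profile. *)
Definition smooth_profile (m : nat) (s : R) : R := (F (s + h m) - F s) / h m.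

Definition dsmooth_profile (m : nat) (s : R) : R :=
  (sqprofile (s + h m) - sqprofile s) / h m.

Lemma dsmooth_profile_ge0 m (s : R) : 0 <= dsmooth_profile m s.
Proof. by rewrite divr_ge0 ?subr_ge0 ?sqprofile_nd ?lerDl ?(ltW (h_gt0 m)). Qed.

Let is_derive_smooth_profile m (s : R) : 0 <= s ->
  is_derive s 1 (smooth_profile m) (dsmooth_profile m s).
Proof.
move=> s0; have s1 : -1 < s by lra.
have hm := h_gt0 m.
have d1 : is_derive s 1 (fun s => F (s + h m)) (sqprofile (s + h m) * 1).
  apply: (@is_derive_comp _ _ F (fun s : R => s + h m)).
    by apply: is_derive_F; lra.
  by apply: is_derive_eq; rewrite addr0.
have d2 := is_derive_F s1.
apply: (is_derive_eq (is_deriveM (is_deriveB d1 d2) (is_derive_cst (h m)^-1 s 1))).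
by rewrite scaler0 add0r /dsmooth_profile /GRing.scale /= mulr1 mulrC.
Qed.

(** By the mean value theorem the quotient is a value of the profile between s and s + h m; the
    uniform bound and the convergence both follow. *)
Let smooth_profile_between m (s : R) : 0 <= s ->
  sqprofile s <= smooth_profile m s <= sqprofile (s + h m).
Proof.
move=> s0; have hm := h_gt0 m.
have ssh : s < s + h m by rewrite ltrDl.
have dF t : s <= t -> is_derive t 1 F (sqprofile t).
  by move=> st; apply: is_derive_F; lra.
have [c cs E] : exists2 c, c \in `]s, s + h m[%R & F (s + h m) - F s = sqprofile c * (s + h m - s).
  apply: MVT => //; first by move=> t /[!in_itv]/= /andP[/ltW/dF].
  apply: derivable_within_continuous => t /[!in_itv]/= /andP[/dF dt _].
  by case: dt.
rewrite /smooth_profile E (_ : s + h m - s = h m); last ring.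
rewrite mulfK ?gt_eqF//; move: cs; rewrite in_itv /= => /andP[sc ch].
by rewrite !sqprofile_nd// ltW.
Qed.

Lemma smooth_profile_bound m (s : R) : 0 <= s -> `|smooth_profile m s| <= f 1.
Proof.
move=> s0; have /andP[a b] := smooth_profile_between m s0.
have /andP[c _] := sqprofile_bound s; have /andP[_ d] := sqprofile_bound (s + h m).
by rewrite ger0_norm; lra.
Qed.

Let cvg_h : h m @[m --> \oo] --> (0 : R).
Proof. exact: cvg_harmonic. Qed.

Lemma cvg_smooth_profile (s : R) : 0 <= s ->
  smooth_profile m s @[m --> \oo] --> sqprofile s.
Proof.
move=> s0; apply: (squeeze_cvgr (f := fun=> sqprofile s) (h := fun m => sqprofile (s + h m))).
- by apply: nearW => m; exact: smooth_profile_between.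
- exact: cvg_cst.
- apply: continuous_cvg; first exact: continuous_sqprofile.
  by rewrite -[X in _ --> X]addr0; apply: cvgD; [exact: cvg_cst|exact: cvg_h].
Qed.

Lemma is_derive_sqprofile (r : R) : 0 < r < 1 ->
  is_derive (r ^+ 2) 1 sqprofile (derive1 f r * (2 * r)^-1).
Proof.
move=> /andP[r0 r1].
have r01 : 0 <= r <= 1 by lra.
have df : is_derive r 1 f (derive1 f r).
  rewrite derive1E; apply: derivableP.
  have /cvg_ex[l /= fl] := f_diff r01.
  apply/cvg_ex; exists l.
  apply/cvgrPdist_le => e e0; move/cvgrPdist_le : fl => /(_ e e0).
  rewrite !near_withinE => /nbhs_ballP[d /= d0 dl].
  (* Within this distance r + t stays in [0, 1], so the derivative relative to the interval is a
     two-sided one. *)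
  apply/nbhs_ballP; exists (Num.min d (Num.min r (1 - r))) => /=.
    by rewrite !lt_min d0 r0 subr_gt0.
  move=> t; rewrite /ball /= sub0r normrN !lt_min => /and3P[td tr t1] t0.
  have := dl (t + r); rewrite /ball /= opprD addrCA subrr addr0 normrN => /(_ td).
  have tr1 : t + r != r by rewrite -subr_eq0 addrK.
  move=> /(_ tr1); rewrite addrK mulrC [t%:A]mulr1; apply.
  by move: tr t1; rewrite in_itv /= !ltr_norml => /andP[? ?] /andP[? ?]; lra.
have s0 : 0 < r ^+ 2 by rewrite exprn_gt0.
have d2 := is_derive1_sqrt s0.
have rE : Num.sqrt (r ^+ 2) = r by rewrite sqrtr_sqr gtr0_norm.
rewrite rE in d2.
apply: (@near_eq_is_derive _ _ _ (f \o Num.sqrt)).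
  near=> z; rewrite /sqprofile min_r//.
  by apply: ltW; near: z; apply: lt_nbhsl; rewrite expr_lt1// ltW.
by apply: is_derive_comp => //; rewrite rE.
Unshelve. all: by end_near. Qed.

(** The derivative of the approximant is itself the difference quotient of the profile with step
    1/(m+1), so pointwise differentiability of f is enough. *)
Lemma cvg_dsmooth_profile (r : R) : 0 < r < 1 ->
  dsmooth_profile m (r ^+ 2) @[m --> \oo] --> derive1 f r * (2 * r)^-1.
Proof.
move=> r01; have [dr dE] := is_derive_sqprofile r01.
rewrite -dE.
have ch : h m @[m --> \oo] --> (0 : R)^'.
  move=> A /= A0; have A1 : \forall m \near \oo, h m != 0 -> A (h m) by exact: cvg_h A0.
  by apply: filterS A1 => m; apply; rewrite gt_eqF.
pose q (t : R) := t^-1 *: ((sqprofile \o shift (r ^+ 2)) (t *: 1) - sqprofile (r ^+ 2)).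
have c : q @ (0 : R)^' --> 'D_1 sqprofile (r ^+ 2) by exact: dr.
have -> : (fun m => dsmooth_profile m (r ^+ 2)) = q \o h.
  apply/funext => m; rewrite /q /= /dsmooth_profile [_%:A]mulr1 [h m + _]addrC.
  by rewrite mulrC.
exact: cvg_comp ch c.
Qed.

Let is_derive_smooth_profile_sqnorm n m (j : 'I_n) x :
  is_derive x (delta_mx ord0 j : 'rV[R]_n) (fun x : 'rV[R]_n => smooth_profile m (sqnorm x))
    (dsmooth_profile m (sqnorm x) * (2 * x ord0 j)).
Proof.
apply: (@is_derive_comp _ _ (smooth_profile m) (@sqnorm R n)); last exact: is_derive_sqnorm.
by apply: is_derive_smooth_profile; exact: sqnorm_ge0.
Qed.

Lemma partial_smooth_profile n m (j : 'I_n) :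
  partial j (fun x : 'rV[R]_n => smooth_profile m (sqnorm x)) =
  (fun x => dsmooth_profile m (sqnorm x) * (2 * x ord0 j)).
Proof. by apply/funext => x; case: (is_derive_smooth_profile_sqnorm m j x). Qed.

Lemma continuous_dsmooth_profile m : continuous (dsmooth_profile m).
Proof.
have c1 (s : R) : {for s, continuous (fun s => sqprofile (s + h m))}.
  apply: (@continuous_comp R R R (fun s => s + h m) sqprofile); last exact: continuous_sqprofile.
  by apply: continuousD => //; exact: cst_continuous.
move=> s.
exact: (continuousM (continuousB (c1 s) (@continuous_sqprofile s)) (@cst_continuous _ _ _ _)).
Qed.

Lemma Ck_smooth_profile n m : Ck 1 (fun x : 'rV[R]_n => smooth_profile m (sqnorm x)).
Proof.
have csq : continuous (@sqnorm R n) := Ck_continuous (@Ck_sqnorm R n 0).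
apply: (@CkS_intro _ _ 0 _ (fun j x => dsmooth_profile m (sqnorm x) * (2 * x ord0 j))).
- move=> x; apply: (@continuous_comp _ _ _ (@sqnorm R n) (smooth_profile m)); first exact: csq.
  apply/differentiable_continuous/derivable1_diffP.
  by case: (is_derive_smooth_profile m (sqnorm_ge0 x)).
- by move=> j x; exact: is_derive_smooth_profile_sqnorm.
- move=> j; apply: Ck_mul; last by apply: Ck_mul; [exact: Ck_cst|exact: Ck_coor].
  move=> x; apply: (@continuous_comp _ _ _ (@sqnorm R n) (dsmooth_profile m)); first exact: csq.
  exact: continuous_dsmooth_profile.
Qed.

End profile.

Section real_integrals.
Context {R : realType} {n : nat}.
Local Notation mu := (@lebesgue_rV R n).
Local Notation B := (@uball R n).
Local Notation mB := (@measurable_uball R n).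
Local Notation J g := (Rintegral mu B g).
Implicit Types g h : 'rV[R]_n -> R.

Lemma RintegralE g : L1ball g -> (\int[mu]_(x in B) (g x)%:E = (J g)%:E)%E.
Proof. by move=> ig; rewrite /Rintegral fineK// (integrable_fin_num mB ig). Qed.

Lemma ae_eq_Rintegral g h : L1ball g -> L1ball h ->
  {ae mu, forall x, B x -> g x = h x} -> J g = J h.
Proof.
move=> ig ih gh; congr fine; apply: ae_eq_integral.
- exact: mB.
- exact: measurable_int ig.
- exact: measurable_int ih.
- by apply: filterS gh => x /[apply] ->.
Qed.

Lemma ae_Rintegral_ge0 g : L1ball g -> {ae mu, forall x, B x -> 0 <= g x} -> 0 <= J g.
Proof.
move=> ig g0; rewrite (@ae_eq_Rintegral g (fun x => `|g x|))//.
- by apply: Rintegral_ge0 => x _.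
- exact: integrable_norm.
- by apply: filterS g0 => x /[apply] /ger0_norm.
Qed.

Lemma L1ballB g h : L1ball g -> L1ball h -> L1ball (fun x => g x - h x).
Proof. by move=> ig ih; exact: (integrableB mB ig ih). Qed.

Lemma L1ballZ (c : R) g : L1ball g -> L1ball (fun x => c * g x).
Proof.
move=> ig; rewrite /L1ball (_ : EFin \o _ = (fun x => c%:E * (EFin \o g) x)%E) //.
by apply: integrableZl => //; exact: mB.
Qed.

Lemma sum_sqr_le_sqr_sum (I : Type) (r : seq I) (a : I -> R) : (forall i, 0 <= a i) ->
  \sum_(i <- r) a i ^+ 2 <= (\sum_(i <- r) a i) ^+ 2.
Proof.
move=> a0; elim: r => [|i r IH]; first by rewrite !big_nil expr0n.
rewrite !big_cons sqrrD -addrA lerD2l (le_trans IH)// lerDr mulrn_wge0//.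
by rewrite mulr_ge0// sumr_ge0.
Qed.

Lemma frobenius_le (A : 'M[R]_n) : frobenius A <= \sum_i \sum_j `|A i j|.
Proof.
have S0 i : 0 <= \sum_j `|A i j| by exact: sumr_ge0.
rewrite -[leRHS]ger0_norm ?sumr_ge0// -sqrtr_sqr; apply: ler_wsqrtr.
apply: le_trans (sum_sqr_le_sqr_sum _ S0); apply: ler_sum => i _.
apply: le_trans (sum_sqr_le_sqr_sum _ (fun j => normr_ge0 (A i j))).
by apply: ler_sum => j _; rewrite real_normK// num_real.
Qed.

Lemma L1ball_frobenius (A : 'rV[R]_n -> 'M[R]_n) :
  (forall i j, L1ball (fun x => A x i j)) -> L1ball (fun x => frobenius (A x)).
Proof.
move=> iA.
apply: (@le_integrable _ _ _ mu B mB _ (EFin \o (fun x => \sum_i \sum_j `|A x i j|))).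
- apply/measurable_EFinP; apply: (measurableT_comp (f := @Num.sqrt R)).
    by apply: continuous_measurable_fun; exact: sqrt_continuous.
  apply: measurable_sum => i; apply: measurable_sum => j.
  by apply: measurable_funX; exact: L1ball_measurable.
- move=> x _ /=; rewrite lee_fin ger0_norm ?sqrtr_ge0//.
  exact: le_trans (frobenius_le _) (ler_norm _).
- apply: L1ball_sum => i; apply: L1ball_sum => j; exact: integrable_norm (iA i j).
Qed.

Lemma ae_ord m (P : 'I_m -> 'rV[R]_n -> Prop) :
  (forall i, {ae mu, forall x, P i x}) -> {ae mu, forall x i, P i x}.
Proof.
move=> aeP.
have : {ae mu, forall x (k : nat) (i : 'I_m), i = k :> nat -> P i x}.
  apply: ae_foralln => k; case: (ltnP k m) => km.
    apply: filterS (aeP (Ordinal km)) => x Px i ik.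
    by rewrite (_ : i = Ordinal km)//; exact: val_inj.
  by apply: aeW => x i ik; have := ltn_ord i; rewrite ik ltnNge km.
by apply: filterS => x Px i; exact: (Px i i).
Qed.

End real_integrals.

(** * Comparison of energies and the equality case *)

Section minimality.
Context {R : realType} {n : nat}.
Variable f : R -> R.
Hypothesis n_ge3 : (3 <= n)%N.
Hypothesis f_ge0 : forall r : R, 0 <= r <= 1 -> 0 <= f r.
Hypothesis f_diff : differentiable01 f.
Hypothesis f_nd : forall r s : R, 0 <= r -> r <= s -> s <= 1 -> f r <= f s.
Let n2 : (2 <= n)%N := ltnW n_ge3.
Let n0 : (0 < n)%N := ltnW n2.
Local Notation mu := (@lebesgue_rV R n).
Local Notation B := (@uball R n).
Local Notation mB := (@measurable_uball R n).
Local Notation J g := (Rintegral mu B g).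
Local Notation u0 := (@radial R n).
Implicit Types u : 'rV[R]_n -> 'rV[R]_n.

Let fe (x : 'rV[R]_n) : R := f (enorm x).
(** Equal to f(|x|) on the ball but continuous on all of R^n, so multiplication by it preserves
    integrability on the ball. *)
Let fq (x : 'rV[R]_n) : R := sqprofile f (sqnorm x).
Let divg u (x : 'rV[R]_n) : R := \sum_i weak_gradient u x i i.
Let frob u (x : 'rV[R]_n) : R := frobenius (weak_gradient u x).
Let N : R := Num.sqrt (n%:R - 1).
(* x . (u0 - u), nonnegative because |u| = 1 *)
Let W u (x : 'rV[R]_n) : R := \sum_i (u0 x ord0 i - u x ord0 i) * x ord0 i.

Let N_gt0 : 0 < N.
Proof. by rewrite sqrtr_gt0 subr_gt0 ltr1n. Qed.

Let fqE x : B x -> fq x = fe x.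
Proof.
move=> Bx; rewrite /fq sqnormE sqprofile_sqr// enorm_ge0 ltW//; exact: Bx.
Qed.

Let continuous_fq : continuous fq.
Proof.
move=> x; apply: (@continuous_comp _ _ _ (@sqnorm R n) (sqprofile f)).
  exact: (Ck_continuous (@Ck_sqnorm R n 0)).
exact: continuous_sqprofile.
Qed.

Let L1_weak_gradient u i j : admissible u -> L1ball (fun x => weak_gradient u x i j).
Proof.
move=> au; have [ig _] := weak_partialP j (component_W11 i au).
by move: ig; congr (L1ball _); apply/funext => x; rewrite mxE.
Qed.

Let L1_divg u : admissible u -> L1ball (divg u).
Proof. by move=> au; apply: L1ball_sum => i; exact: L1_weak_gradient. Qed.

Let L1_frob u : admissible u -> L1ball (frob u).
Proof. by move=> au; apply: L1ball_frobenius => i j; exact: L1_weak_gradient. Qed.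

Let L1_mul_fq g : L1ball g -> L1ball (fun x => g x * fq x).
Proof. by move=> ig; exact: integrable_mul_continuous. Qed.

Let energyE u : admissible u -> energy f u = (J (fun x => frob u x * fq x))%:E.
Proof.
move=> au; rewrite -RintegralE; last exact: L1_mul_fq (L1_frob au).
by apply: eq_integral => x /set_mem Bx; rewrite fqE// mulrC.
Qed.

Let div_le_frob u : admissible u ->
  J (fun x => divg u x * fq x) <= N * J (fun x => frob u x * fq x).
Proof.
move=> au; have id := L1_mul_fq (L1_divg au); have ifr := L1_mul_fq (L1_frob au).
rewrite -RintegralZl//; last exact: mB.
rewrite -subr_ge0 -RintegralB//; [|exact: mB|exact: L1ballZ].
apply: ae_Rintegral_ge0; first by apply: L1ballB => //; exact: L1ballZ.
have orth : {ae mu, forall x (j : 'I_n), B x ->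
    \sum_i u x ord0 i * weak_gradient u x i j = 0}.
  by apply: ae_ord => j; exact: weak_gradient_orthogonal.
have [[_ u1] _] := au.
apply: filterS2 orth u1 => x ox ux Bx.
rewrite mulrA -mulrBl mulr_ge0//; last by have /andP[] := sqprofile_bound f_ge0 f_nd (sqnorm x).
by rewrite subr_ge0; apply: (trace_le_frobenius _ (ux Bx)) => // j; exact: ox.
Qed.

Let aeu0 : admissible u0 := admissible_radial n2.

Let div_eq_frob_radial :
  J (fun x => divg u0 x * fq x) = N * J (fun x => frob u0 x * fq x).
Proof.
have id := L1_mul_fq (L1_divg aeu0); have ifr := L1_mul_fq (L1_frob aeu0).
rewrite -RintegralZl//; last exact: mB.
apply: ae_eq_Rintegral => //; first exact: L1ballZ.
have grad : {ae mu, forall x (i j : 'I_n), B x ->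
    weak_gradient u0 x i j = radial_gradient i j x}.
  by apply: ae_ord => i; apply: ae_ord => j; exact: weak_gradient_radial.
apply: filterS2 grad (ae_rV_neq0 n0) => x gx x0 Bx.
rewrite mulrA; congr (_ * _); apply: (trace_radial_gradient _ x0) => // i j.
exact: gx.
Qed.

Let G u (x : 'rV[R]_n) : R := divg u0 x - divg u x.

Let L1_G u : admissible u -> L1ball (G u).
Proof. by move=> au; apply: L1ballB; exact: L1_divg. Qed.

Let psi m (x : 'rV[R]_n) : R := smooth_profile f m (sqnorm x).
Let dpsi m (x : 'rV[R]_n) : R := dsmooth_profile f m (sqnorm x).

Let Ck_psi m : Ck 1 (psi m).
Proof. exact: Ck_smooth_profile. Qed.

Let continuous_dpsi m : continuous (dpsi m).
Proof.
move=> x; apply: (@continuous_comp _ _ _ (@sqnorm R n) (dsmooth_profile f m)).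
  exact: (Ck_continuous (@Ck_sqnorm R n 0)).
exact: continuous_dsmooth_profile.
Qed.

Let L1_W u : admissible u -> L1ball (W u).
Proof.
move=> au; apply: L1ball_sum => i; apply: integrable_mul_continuous; last exact: coord_continuous.
by apply: L1ballB; [exact: (component_W11 i aeu0).1|exact: (component_W11 i au).1].
Qed.

(** The integrations by parts of the diagonal entries are summed; the factor 2 comes from the
    gradient 2 x of |x|^2. *)
Let ibp u m : admissible u ->
  J (fun x => G u x * psi m x) = - J (fun x => W u x * (2 * dpsi m x)).
Proof.
move=> au.
have cpsi := Ck_continuous (Ck_psi m).
have cd : continuous (fun x => 2 * dpsi m x).
  by move=> x; apply: (@continuousM _ _ (fun=> 2) (dpsi m)); [exact: cst_continuous|exact: continuous_dpsi].
have i1 := integrable_mul_continuous (L1_G au) cpsi.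
have i2 := integrable_mul_continuous (L1_W au) cd.
apply: EFin_inj; rewrite EFinN -!RintegralE//.
apply: (adde_eq0_opp (integrable_fin_num mB i2)).
have L1a i : L1ball (fun x => (u0 x ord0 i - u x ord0 i) * partial i (psi m) x).
  apply: integrable_mul_continuous; last exact: Ck_continuous (CkS_partial i (Ck_psi m)).
  by apply: L1ballB; [exact: (component_W11 i aeu0).1|exact: (component_W11 i au).1].
have L1b i : L1ball (fun x => (weak_gradient u0 x i i - weak_gradient u x i i) * psi m x).
  apply: integrable_mul_continuous => //.
  by apply: L1ballB; exact: L1_weak_gradient.
transitivity (\sum_i (\int[mu]_(x in B) ((u0 x ord0 i - u x ord0 i) * partial i (psi m) x)%:E +
   \int[mu]_(x in B) ((weak_gradient u0 x i i - weak_gradient u x i i) * psi m x)%:E))%E; last first.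
  by rewrite big1// => i _; exact: admissible_ibp.
rewrite big_split /= -!integral_L1ball_sum//; congr (_ + _)%E.
- apply: eq_integral => x _; congr EFin; rewrite /W mulr_suml; apply: eq_bigr => i _.
  by rewrite /psi partial_smooth_profile// /dpsi; ring.
- apply: eq_integral => x _; congr EFin; rewrite /G /divg -sumrB mulr_suml.
  by apply: eq_bigr.
Qed.

(** After multiplication by 2|x|, the scalar product x . (u0 - y) becomes the squared length of |x|
    y - x, which yields both the sign of [W] and its zero set. *)
Let W_identity x y : enorm y = 1 -> x != 0 ->
  2 * enorm x * (\sum_i (u0 x ord0 i - y ord0 i) * x ord0 i) =
  \sum_i (enorm x * y ord0 i - x ord0 i) ^+ 2.
Proof.
move=> y1 x0; have r0 : enorm x != 0 by rewrite enorm_eq0.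
have y2 : \sum_i y ord0 i ^+ 2 = 1 by rewrite -sqr_enorm y1 expr1n.
have -> : \sum_i (u0 x ord0 i - y ord0 i) * x ord0 i =
    (enorm x)^-1 * enorm x ^+ 2 - \sum_i y ord0 i * x ord0 i.
  rewrite sqr_enorm mulr_sumr -sumrB; apply: eq_bigr => i _.
  by rewrite mxE; ring.
rewrite [RHS](eq_bigr (fun i => enorm x ^+ 2 * y ord0 i ^+ 2 - 2 * enorm x * (y ord0 i * x ord0 i)
   + x ord0 i ^+ 2)); last by move=> i _; ring.
rewrite big_split /= sumrB -!mulr_sumr y2 -sqr_enorm.
by field.
Qed.

Let W_ge0 u : admissible u -> {ae mu, forall x, B x -> 0 <= W u x}.
Proof.
move=> au; have [[_ u1] _] := au; apply: filterS2 (ae_rV_neq0 n0) u1 => x x0 ux Bx.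
rewrite -(pmulr_rge0 _ (_ : 0 < 2 * enorm x)) ?mulr_gt0 ?enorm_gt0//.
by rewrite (W_identity (ux Bx) x0) sumr_ge0// => i _; exact: sqr_ge0.
Qed.

Let W_eq0 u : admissible u -> {ae mu, forall x, B x -> W u x = 0} ->
  {ae mu, forall x, B x -> u x = u0 x}.
Proof.
move=> au W0; have [[_ u1] _] := au; apply: filterS3 (ae_rV_neq0 n0) u1 W0 => x x0 ux Wx Bx.
have := W_identity (ux Bx) x0; rewrite [\sum_i (_ - _) * _](Wx Bx) mulr0 => /esym/eqP.
rewrite psumr_eq0 => [/allP H|i _]; last exact: sqr_ge0.
apply/rowP => i; have := H i; rewrite mem_index_enum => /(_ isT) /=.
rewrite sqrf_eq0 subr_eq0 => /eqP xE.
by rewrite mxE -xE mulKf// enorm_eq0.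
Qed.

Let ibp_le0 u m : admissible u -> J (fun x => G u x * psi m x) <= 0.
Proof.
move=> au; rewrite ibp// oppr_le0; apply: ae_Rintegral_ge0.
  apply: integrable_mul_continuous; first exact: L1_W.
  by move=> x; apply: (@continuousM _ _ (fun=> 2) (dpsi m)); [exact: cst_continuous|exact: continuous_dpsi].
apply: filterS (W_ge0 au) => x Wx Bx; rewrite mulr_ge0 ?Wx// mulr_ge0//.
exact: dsmooth_profile_ge0.
Qed.

Let cvg_ibp u : admissible u ->
  J (fun x => G u x * psi m x) @[m --> \oo] --> J (fun x => G u x * fq x).
Proof.
move=> au; have iG := L1_G au.
have ip m := integrable_mul_continuous iG (Ck_continuous (Ck_psi m)).
have : (\int[mu]_(x in B) (G u x * psi m x)%:E)%E @[m --> \oo] -->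
    (\int[mu]_(x in B) (G u x * fq x)%:E)%E.
  apply: (@dominated_cvg_uball R n _ _ (fun x => f 1 * `|G u x|)).
  - by move=> m; exact: L1ball_measurable (ip m).
  - move=> x _; apply: cvgM; first exact: cvg_cst.
    by apply: cvg_smooth_profile => //; exact: sqnorm_ge0.
  - by apply: L1ballZ; exact: integrable_norm.
  - move=> m x _; rewrite normrM mulrC ler_wpM2r//.
    by apply: smooth_profile_bound => //; exact: sqnorm_ge0.
rewrite (RintegralE (L1_mul_fq iG)) => /fine_cvgP[_].
by apply: cvg_trans.
Qed.

Let G_le0 u : admissible u -> J (fun x => G u x * fq x) <= 0.
Proof.
move=> au; rewrite -(cvg_lim _ (cvg_ibp au))//.
apply: limr_le; first by apply/cvg_ex; eexists; exact: cvg_ibp.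
by apply: nearW => m; exact: ibp_le0.
Qed.

Let div_split u : admissible u ->
  J (fun x => G u x * fq x) = J (fun x => divg u0 x * fq x) - J (fun x => divg u x * fq x).
Proof.
move=> au; rewrite -RintegralB; [|exact: mB|exact: L1_mul_fq (L1_divg aeu0)|exact: L1_mul_fq (L1_divg au)].
by apply: eq_Rintegral => x _; rewrite /G mulrBl.
Qed.

(** With E the energy, N E(u0) = int f div u0 <= int f div u <= N E(u): the equality for the radial
    map, then the sign of the integral of f div V, then Cauchy-Schwarz. *)
Lemma radial_minimizes u : admissible u -> (energy f u0 <= energy f u)%E.
Proof.
move=> au; rewrite (energyE aeu0) (energyE au) lee_fin -(ler_pM2l N_gt0).
have := G_le0 au; rewrite (div_split au) subr_le0 => /le_trans/(_ (div_le_frob au)).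
by apply: le_trans; rewrite div_eq_frob_radial.
Qed.

Let dW u m (x : 'rV[R]_n) : R := W u x * (2 * dpsi m x).
Let H u (x : 'rV[R]_n) : R := W u x * (2 * (derive1 f (enorm x) * (2 * enorm x)^-1)).

Let W_0 u : W u 0 = 0.
Proof. by rewrite /W big1// => i _; rewrite [X in _ * X]mxE mulr0. Qed.

Let cvg_dW u x : B x -> dW u m x @[m --> \oo] --> H u x.
Proof.
(* At the origin everything vanishes with [W u 0]; the derivative of the profile is used only for 0
   < |x| < 1. *)
move=> Bx; have [->|x0] := eqVneq x 0.
  rewrite /H /dW W_0 mul0r (_ : (fun=> _) = cst 0); last by apply/funext => m; rewrite mul0r.
  exact: cvg_cst.
apply: cvgM; first exact: cvg_cst.
apply: cvgM; first exact: cvg_cst.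
rewrite /dpsi sqnormE; apply: cvg_dsmooth_profile => //.
by rewrite enorm_gt0// x0; exact: Bx.
Qed.

Let L1_dW u m : admissible u -> L1ball (dW u m).
Proof.
move=> au; apply: integrable_mul_continuous; first exact: L1_W.
by move=> x; apply: (@continuousM _ _ (fun=> 2) (dpsi m)); [exact: cst_continuous|exact: continuous_dpsi].
Qed.

(** The functions [dW u m] are nonnegative almost everywhere and, by [ibp], their integrals tend to
    minus the integral of [G u x * fq x], which is 0. Fatou's lemma then bounds the integral of the
    absolute value of their limit [H u] by 0. *)
Let ae_H_eq0 u : admissible u -> J (fun x => G u x * fq x) = 0 ->
  {ae mu, forall x, B x -> H u x = 0}.
Proof.
move=> au G0.
have absE m : (\int[mu]_(x in B) `|(dW u m x)%:E| = (J (dW u m))%:E)%E.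
  transitivity (\int[mu]_(x in B) `|dW u m x|%:E)%E; first by [].
  rewrite RintegralE; last exact: integrable_norm (L1_dW m au).
  congr EFin; apply: ae_eq_Rintegral; [exact: integrable_norm (L1_dW m au)|exact: L1_dW|].
  apply: filterS (W_ge0 au) => x Wx Bx; rewrite ger0_norm// mulr_ge0 ?Wx// mulr_ge0//.
  exact: dsmooth_profile_ge0.
have mdW m : measurable_fun B (EFin \o dW u m) by exact: measurable_int (L1_dW m au).
have mH : measurable_fun B (EFin \o H u).
  apply: (emeasurable_fun_cvg (fun m => EFin \o dW u m) _ mdW) => x Bx.
  by apply: cvg_EFin; [exact: nearW|exact: cvg_dW].
suff /(ae_eq_integral_abs mu mB mH) H0 : (\int[mu]_(x in B) `|(EFin \o H u) x| = 0)%E.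
  by apply: filterS H0 => x /[apply] -[].
apply/eqP; rewrite eq_le integral_ge0//= andbT.
have HE : {in B, (fun x => limn_einf (fun m => `|(dW u m x)%:E|)%E) =1 (fun x => `|(EFin \o H u) x|%E)}.
  move=> x /set_mem Bx.
  have c : `|(dW u m x)%:E|%E @[m --> \oo] --> `|(H u x)%:E|%E.
    by apply: cvg_EFin; [exact: nearW|apply: cvg_norm; exact: cvg_dW].
  by rewrite is_cvg_limn_einfE ?(cvg_lim _ c)//; apply/cvg_ex; eexists; exact: c.
rewrite -(eq_integral _ _ HE).
apply: le_trans (@fatou _ _ _ mu B mB (fun m x => `|(dW u m x)%:E|%E) _ _) _ => //.
  by move=> m; apply: measurableT_comp => //; exact: mdW.
have c : (\int[mu]_(x in B) `|(dW u m x)%:E|)%E @[m --> \oo] --> 0%E.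
  under eq_fun do rewrite absE.
  apply: cvg_EFin; first exact: nearW.
  rewrite (_ : _ \o _ = (fun m => - J (fun x => G u x * psi m x))); last first.
    by apply/funext => m; rewrite ibp// opprK.
  rewrite -oppr0 -G0; apply: cvgN; exact: cvg_ibp.
by rewrite is_cvg_limn_einfE ?(cvg_lim _ c)//; apply/cvg_ex; eexists; exact: c.
Qed.

Lemma eq_energy_radial u : (forall r : R, 0 < r < 1 -> derive1 f r <> 0) ->
  admissible u -> energy f u0 = energy f u -> {ae mu, forall x, B x -> u x = u0 x}.
Proof.
move=> f'0 au; rewrite (energyE aeu0) (energyE au) => E0.
have fE := EFin_inj E0.
apply: (W_eq0 au).
(* One inequality is [G_le0]; the other is [div_le_frob] for u, as the two energies agree. *)
have G0 : J (fun x => G u x * fq x) = 0.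
  apply/eqP; rewrite eq_le (G_le0 au) (div_split au) subr_ge0 div_eq_frob_radial fE.
  exact: div_le_frob.
apply: filterS2 (ae_rV_neq0 n0) (ae_H_eq0 au G0) => x x0 Hx Bx.
have r0 : 0 < enorm x by rewrite enorm_gt0.
have /f'0/eqP fx : 0 < enorm x < 1 by rewrite r0; exact: Bx.
have /eqP := Hx Bx.
by rewrite /H !mulf_eq0 invr_eq0 !mulf_eq0 pnatr_eq0 (negbTE fx) (gt_eqF r0) !orbF => /eqP.
Qed.

(** Weak derivatives depend only on the class almost everywhere, so the two sets from which [xget]
    chooses coincide and the chosen gradients are equal as functions. *)
Lemma eq_energy u v : admissible u -> admissible v ->
  {ae mu, forall x, B x -> u x = v x} -> energy f u = energy f v.
Proof.
move=> au av uv.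
suff wE i j : weak_partial j (component u i) = weak_partial j (component v i).
  apply: eq_integral => x _; congr (EFin (_ * frobenius _)).
  by apply/matrixP => i j; rewrite !mxE wE.
rewrite /weak_partial; congr xget; apply/seteqP.
have int_uv phi : test_function phi ->
    (\int[mu]_(x in B) (component u i x * partial j phi x)%:E =
     \int[mu]_(x in B) (component v i x * partial j phi x)%:E)%E.
  move=> tphi; have cphi := Ck_continuous (CkS_partial j (tphi.1 1%N)).
  apply: ae_eq_integral; first exact: mB.
  - exact: measurable_int (integrable_mul_continuous (component_W11 i au).1 cphi).
  - exact: measurable_int (integrable_mul_continuous (component_W11 i av).1 cphi).
  - by apply: filterS uv => x /[apply]; rewrite /component => ->.
split=> g [ig wg]; split=> // phi tphi; first by rewrite -int_uv// wg.
by rewrite int_uv// wg.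
Qed.

End minimality.

Theorem theorem0p1 (R : realType) (n : nat) (f : R -> R)
    (n_ge3 : (3 <= n)%N)
    (f_ge0 : forall r : R, 0 <= r <= 1 -> 0 <= f r)
    (f_diff : differentiable01 f)
    (f_nd : forall r s : R, 0 <= r -> r <= s -> s <= 1 -> f r <= f s) :
  (admissible (@radial R n) /\
   forall u : 'rV[R]_n -> 'rV[R]_n, admissible u ->
     (energy f (@radial R n) <= energy f u)%E) /\
  ((forall r : R, 0 < r < 1 -> derive1 f r <> 0) ->
   forall u : 'rV[R]_n -> 'rV[R]_n, admissible u ->
     (energy f (@radial R n) = energy f u <->
      {ae lebesgue_rV n, forall x, uball x -> u x = radial x})).
Proof.
have a0 := @admissible_radial R n (ltnW n_ge3).
split.
  split; first exact: a0.
  by move=> u au; exact: (radial_minimizes n_ge3 f_ge0 f_diff f_nd au).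
move=> f'0 u au; split.
  exact: (eq_energy_radial n_ge3 f_ge0 f_diff f_nd f'0 au).
move=> uE; apply: (eq_energy f a0 au).
by apply: filterS uE => x xE Bx; rewrite xE.
Qed.
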